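(* For any $\gamma,\theta\ge0$ there is a unique Markov family $(P_x)_{x\in C}$ on $(C,d)$ (with càdlàg paths and with stochastically continuous Feller transition function) whose Markov generator coincides on cylindric functions $f=h\circ\pi_n$ ($n\in\mathbb{N}$, $h:L_n\to\mathbb{R}$) with the operator $$Af(x)=\gamma\sum_{k=1}^n\theta^k\bigl(\langle h\rangle_{n,k,x}-h(\pi_nx)\bigr),\qquad x\in C.$$ This Markov family is SSS, and the self-similarity identity holds with scaling parameters $\alpha_n=\theta^n$, $n\in\mathbb{N}$.
   Context: Cantor set. $C=\{0,1\}^{\mathbb{N}}$ (the triadic Cantor set, with $x=\sum_{k\ge1}2x_k3^{-k}$ identified with the sequence $(x_k)_{k\in\mathbb{N}}$), $\mathbb{N}=\{1,2,\dots\}$, with the ultrametric $d(x,y)=3^{-c(x,y)}$, $c(x,y)=\min\{k: x_k\ne y_k\}$, $d(x,x)=0$. For $n\in\mathbb{N}$: $L_n=\{0,1\}^n$, $\pi_nx=(x_1,\dots,x_n)$, and $[v]=\{x\in C:\pi_nx=v\}$ for $v\in L_n$. For $x\in C$, $v\in L_n$ with $x\notin[v]$, $c(x,v)=\min\{k:x_k\neq v_k\}$. For $h:L_n\to\mathbb{R}$ and $1\le k\le n$, $$\langle h\rangle_{n,k,x}=2^{-(n-k)}\sum_{v\in L_n:\,c(x,v)=k}h(v).$$ A function $f:C\to\mathbb{R}$ is cylindric if $f=h\circ\pi_n$ for some $n$ and $h:L_n\to\mathbb{R}$. $\mathcal{C}(C)$ is the space of continuous real functions on $C$ with the sup norm.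 Markov families. Given a homogeneous Markov transition function $P(t,x,B)$ ($t\ge0$, $x\in C$, $B$ Borel), a compatible Markov family $(P_x)_{x\in C}$ is a family of probability measures on càdlàg paths $[0,\infty)\to C$ such that, for the canonical process $X$, $P_x\{X(0)=x\}=1$ and under $P_x$ the process $X$ is Markov with transition function $P$. The semigroup is $(S^tf)(x)=\int_C f(y)P(t,x,dy)$, and its generator is $f\mapsto\lim_{t\downarrow0}(S^tf-f)/t$ with domain the set of $f\in\mathcal{C}(C)$ for which this limit exists uniformly. Stochastically continuous: $\lim_{t\downarrow0}P(t,x,U)=1$ for every open $U$ and $x\in U$. Feller: $S^t\mathcal{C}(C)\subset\mathcal{C}(C)$ for all $t\ge 0$. Isometry invariant: $P(t,g(x),g(B))=P(t,x,B)$ for every isometry $g$ of $(C,d)$ and all $t,x,B$. Confinement. For $T>0$, $v\in L_n$, $x\in[v]$, let $P_x^{v,T}$ be the law of $X_{[0,T]}$ (the restriction of $X$ to $[0,T]$) under $P_x$ conditioned on $\{X_t\in[v]\text{ for all }t\le T\}$. For stochastically continuous, isometry invariant families the conditioning event has positive probability and these laws are consistent in $T$; $P_x^v$ denotes the resulting measure on paths $[0,\infty)\to[v]$. Self-similar: for every $n\in\mathbb{N}$ there is a number $\alpha_n\ge 0$ such that for every $v\in L_n$, $x\in[v]$, every similarity map $h:[v]\to C$ (bijection with $d(h(y),h(z))=3^nd(y,z)$), all $l\in\mathbb{N}$, times $t_1,\dots,t_l\ge0$ and Borel sets $B_1,\dots,B_l\subset[v]$, the self-similarity identity $$P_x^v\{X_{t_1}\in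 B_1,\dots,X_{t_l}\in B_l\}=P_{h(x)}\{X_{\alpha_nt_1}\in h(B_1),\dots,X_{\alpha_nt_l}\in h(B_l)\}$$ holds. SSS (symmetric self-similar): the Markov family (with càdlàg paths) is stochastically continuous, Feller, isometry invariant and self-similar. *)

(* Defs.v *)
From HB Require Import structures.
From mathcomp Require Import all_boot all_order all_algebra.
From mathcomp Require Import interval_inference.
From mathcomp Require Import all_classical all_reals all_analysis.

Set Implicit Arguments.
Unset Strict Implicit.
Unset Printing Implicit Defensive.

Import Order.TTheory GRing.Theory Num.Theory.
Import numFieldNormedType.Exports.

Local Open Scope classical_set_scope.
Local Open Scope ring_scope.

(* Sequences are indexed from 0: the coordinate x_k, k >= 1, is [x k.-1]. *)

Definition cantor_open : set (set cantor_space) := [set U | open U].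

HB.instance Definition _ := Measurable.copy cantor_space
  (g_sigma_algebraType cantor_open).

Section cantor_metric.
Context {R : realType}.

(* [ex_minn] is the least 0-based index of disagreement, hence the successor. *)
Definition cdist (x y : cantor_space) : R :=
  if pselect (exists k, x k != y k) is left ex then 3%:R ^- (ex_minn ex).+1
  else 0.

Lemma cdist_ltE (x y : cantor_space) (n : nat) :
  cdist x y < 3%:R ^- n <-> forall i, (i < n)%N -> x i = y i.
Proof.
rewrite /cdist; case: pselect => [ex|nex]; last first.
  split=> [_ i _|_]; last by rewrite invr_gt0 exprn_gt0.
  by apply/eqP/negPn/negP => xy; apply: nex; exists i.
case: ex_minnP => m xym minm.
rewrite ltf_pV2 ?posrE ?exprn_gt0// ltr_eXn2l ?ltr1n// ltnS.
split=> [nm i ni|H].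
  apply/eqP/negPn/negP => xyi.
  by have := leq_trans ni (leq_trans nm (minm _ xyi)); rewrite ltnn.
by rewrite leqNgt; apply/negP => /H xyE; rewrite xyE eqxx in xym.
Qed.

(* The topology of [cantor_space] is the one induced by [cdist]. *)
Lemma nbhs_cdistE (x : cantor_space) (A : set cantor_space) :
  nbhs x A <-> exists2 e : R, 0 < e & [set y | cdist x y < e] `<=` A.
Proof.
split=> [|[e e0 eA]].
  pose F := filter_from [set: nat]
    (fun n => [set y : cantor_space | cdist x y < 3%:R ^- n]).
  have FF : Filter F.
    apply: filter_fromT_filter; first by exists 0%N.
    move=> i j; exists (maxn i j) => y /= /cdist_ltE xy.
    by split; apply/cdist_ltE => k ki; apply: xy; rewrite leq_max ki ?orbT.
  suff Fx : F --> x.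
    by move=> /Fx [n _ nA]; exists (3%:R ^- n); rewrite // invr_gt0 exprn_gt0.
  apply/cvg_sup => i U [V] [[W] oW <-] Wx WU.
  by exists i.+1 => // y /= /cdist_ltE /(_ i (ltnSn i)) xyi; apply: WU; rewrite /= -xyi.
have [n ne] : exists n : nat, 3%:R ^- n < e.
  have := @archi_boundP R e^-1; set n := Num.bound _ => bn.
  exists n; rewrite -[e]invrK ltf_pV2 ?posrE ?exprn_gt0 ?invr_gt0//.
  apply: lt_le_trans (bn _) _; first by rewrite invr_ge0 ltW.
  by rewrite -natrX ler_nat ltnW // ltn_expl.
apply: (@filterS _ _ _ [set y | forall i, (i < n)%N -> x i = y i]).
  by move=> y /= /cdist_ltE xy; apply: eA => /=; apply: lt_trans ne.
elim: n {ne} => [|n IH]; first exact: filterS filterT.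
have xn : nbhs x [set y | x n = y n].
  have := @proj_continuous nat (fun=> bool) n x.
  by move=> /(_ [set b | x n = b]); apply; rewrite nbhs_principalE => y ->.
apply: filterS (filterI IH xn) => y [xy xyn] i; rewrite ltnS leq_eqVlt.
by move=> /orP[/eqP->//|]; exact: xy.
Qed.

Definition isometry (g : cantor_space -> cantor_space) :=
  bijective g /\ forall x y, cdist (g x) (g y) = cdist x y.

End cantor_metric.
Arguments isometry : clear implicits.

Section words.
Context {R : realType}.

Definition coords (n : nat) (x : cantor_space) : n.-tuple bool :=
  [tuple x i | i < n].

Definition cyl (n : nat) (v : n.-tuple bool) : set cantor_space :=
  [set x | coords n x = v].

(* c(x, v) for x not in [v]; the value is n.+1 when x is in [v]. *)
Definition first_diff (n : nat) (x : cantor_space) (v : n.-tuple bool) : nat :=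
  (find (fun i => x i != nth false v i) (iota 0 n)).+1.

Definition avg (n : nat) (h : n.-tuple bool -> R) (k : nat)
    (x : cantor_space) : R :=
  2%:R ^- (n - k) * \sum_(v : n.-tuple bool | first_diff x v == k) h v.

Definition operA (gamma theta : R) (n : nat) (h : n.-tuple bool -> R)
    (x : cantor_space) : R :=
  gamma * \sum_(1 <= k < n.+1) theta ^+ k * (avg h k x - h (coords n x)).

(* h only matters on [v]. *)
Definition similarity (n : nat) (v : n.-tuple bool)
    (h : cantor_space -> cantor_space) :=
  set_bij (cyl v) setT h /\
  forall y z, cyl v y -> cyl v z ->
    cdist (h y) (h z) = 3%:R ^+ n * cdist y z :> R.

End words.
Arguments similarity : clear implicits.

Section paths.
Context {R : realType}.

(* In one-sided limits at t >= 0 (and at t > 0 on the left) the argument s is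
   eventually nonnegative, so that `|s| is s. *)
Definition cadlag (w : {nonneg R} -> cantor_space) :=
  forall t : {nonneg R},
    w `|s|%:nng @[s --> (t%:num : R)^'+] --> w t /\
    (0 < t%:num -> cvg (w `|s|%:nng @[s --> (t%:num : R)^'-])).

Record cpath := Path { path_fun :> {nonneg R} -> cantor_space;
                      path_cadlag : cadlag path_fun }.

Lemma cadlag_cst (x : cantor_space) : cadlag (fun=> x).
Proof. by move=> t; split=> [|_]; [exact: cvg_cst | exact: is_cvg_cst]. Qed.

HB.instance Definition _ := gen_eqMixin cpath.
HB.instance Definition _ := gen_choiceMixin cpath.
HB.instance Definition _ := isPointed.Build cpath (Path (cadlag_cst point)).

Definition path_events (I : set {nonneg R}) : set (set cpath) :=
  [set A | exists t B, [/\ I t, measurable B & A = [set w : cpath | B (w t)]]].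

HB.instance Definition _ := Measurable.copy cpath
  (g_sigma_algebraType (path_events setT)).

Definition past (t : {nonneg R}) : set (set cpath) :=
  <<s path_events [set u | u%:num <= t%:num] >>.

End paths.
Arguments cpath : clear implicits.

Section markov.
Context {R : realType}.
Implicit Types (P : {nonneg R} -> R.-pker cantor_space ~> cantor_space)
  (Px : cantor_space -> probability (cpath R) R).

Definition markov_transition P :=
  (forall x B, measurable B -> P 0%:nng x B = \d_x B) /\
  (forall s t x B, measurable B ->
    P (s%:num + t%:num)%:nng x B = (\int[P s x]_y P t y B)%E).

(* The second clause is
   Px[X_(s+t) \in B | sigma(X_u, u <= s)] = P(t, X_s, B), Px-almost surely. *)
Definition markov_family P Px :=
  (forall x, Px x [set w : cpath R | w 0%:nng = x] = 1%E) /\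
  (forall x s t B F, measurable B -> past s F ->
    Px x (F `&` [set w : cpath R | B (w (s%:num + t%:num)%:nng)]) =
    (\int[Px x]_(w in F) P t (w s) B)%E).

Definition stochastically_continuous P :=
  forall (U : set cantor_space) x, open U -> U x ->
    P `|t|%:nng x U @[t --> (0 : R)^'+] --> 1%E.

Definition semigroup P (t : {nonneg R}) (f : cantor_space -> R)
    (x : cantor_space) : R :=
  \int[P t x]_y f y.

Definition feller P :=
  forall t (f : cantor_space -> R), continuous f -> continuous (semigroup P t f).

Definition isometry_invariant P :=
  forall g, isometry R g ->
    forall t x B, measurable B -> P t (g x) (g @` B) = P t x B.

(* f is in the domain of the generator and is mapped to f'. *)
Definition generator P (f f' : cantor_space -> R) :=
  [/\ continuous f, continuous f' &
    {uniform, (fun x => (semigroup P `|t|%:nng f x - f x) / t)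
      @[t --> (0 : R)^'+] --> f'}].

Definition stay (n : nat) (v : n.-tuple bool) (T : {nonneg R}) :
    set (cpath R) :=
  [set w | forall t : {nonneg R}, t%:num <= T%:num -> cyl v (w t)].

(* Q is P_x^v: for every T > 0, its restriction to [0, T] is the law of
   X_[0,T] under P_x conditioned on staying in [v] up to time T. *)
Definition confinement Px (n : nat) (v : n.-tuple bool) (x : cantor_space)
    (Q : probability (cpath R) R) :=
  Q [set w : cpath R | forall t, cyl v (w t)] = 1%E /\
  (forall T : {nonneg R}, 0 < T%:num ->
    (0 < Px x (stay v T))%E /\
    (forall A, past T A ->
      Q A = (Px x (A `&` stay v T) / Px x (stay v T))%E)).

Definition self_similar_with Px (alpha : nat -> {nonneg R}) :=
  forall (n : nat) (v : n.-tuple bool) (x : cantor_space),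
    (0 < n)%N -> cyl v x ->
    exists2 Q, confinement Px v x Q &
      forall h, similarity R n v h ->
      forall (l : nat) (t : 'I_l -> {nonneg R}) (B : 'I_l -> set cantor_space),
        (0 < l)%N -> (forall i, measurable (B i) /\ B i `<=` cyl v) ->
        Q [set w : cpath R | forall i, B i (w (t i))] =
        Px (h x) [set w : cpath R | forall i,
          (h @` B i) (w ((alpha n)%:num * (t i)%:num)%:nng)].

Definition self_similar Px := exists alpha, self_similar_with Px alpha.

Definition SSS Px :=
  exists P, [/\ markov_transition P, markov_family P Px,
    stochastically_continuous P, feller P &
    isometry_invariant P /\ self_similar Px].

(* Px is a Markov family with stochastically continuous Feller transition
   function whose generator extends the operator A on cylindric functions. *)
Definition generated_by (gamma theta : R) Px :=
  exists P, [/\ markov_transition P, markov_family P Px,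
    stochastically_continuous P, feller P &
    forall (n : nat) (h : n.-tuple bool -> R), (0 < n)%N ->
      generator P (h \o coords n) (operA gamma theta h)].

End markov.

(* Main.v *)
Require Import Defs.
From HB Require Import structures.
From mathcomp Require Import all_boot all_order all_algebra.
From mathcomp Require Import interval_inference.
From mathcomp Require Import all_classical all_reals all_analysis.
From mathcomp Require Import measurable_realfun.
From mathcomp Require Import ring lra.

Set Implicit Arguments.
Unset Strict Implicit.
Unset Printing Implicit Defensive.

Import Order.TTheory GRing.Theory Num.Theory.
Import numFieldNormedType.Exports.

Local Open Scope classical_set_scope.
Local Open Scope ring_scope.

(* With 0-based coordinates, the Haar functions distinguishing the coordinate n
   are eigenfunctions of the operator A, with eigenvalue
   - (sum_(1 <= k <= n) gamma theta^k + 2 gamma theta^(n+1)), so the semigroup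
   is explicit on functions of finitely many coordinates.

   Existence: Kolmogorov's theorem (words of length n become subintervals of
   [0, 1[) provides the process at rational times; each coordinate has finitely
   many jumps in bounded time because their expected number on dyadic grids is
   bounded, hence right limits along the dyadics give cadlag paths.  Uniqueness:
   on an eigenfunction the equation u' = - mu u determines a semigroup with
   generator A, and the Markov property determines the law of the paths.

   Isometries commute with the semigroup because an isometry sends the points
   that first differ from x at coordinate n to those that first differ from
   g x there.  Staying in the cylinder [v], v of length n, is staying there on
   all dyadic grids; one step of mesh h of the chain killed outside [v] agrees
   up to O(h^2) with exp (- M h) times the chain run at speed theta^n on the
   remaining coordinates, where M = sum_(1 <= k <= n) gamma theta^k, because
   the decay rates satisfy mu_(n + j) = M + theta^n mu_j.  Hence the
   conditioned process is the rescaled chain embedded in [v]. *)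

(** * Operators on cylinder functions *)

(** All laws are tested on finitely many bits. Events fixing finitely many coordinates at finitely
    many times form a pi-system, and cylinder functions are finite combinations of indicators. Hence
    two laws agree once they have the same start and the same rule for passing from a time s to s +
    t, integrated over bit events before s. Existence, uniqueness, isometry invariance and the
    confined law are all brought to this form, so an image of the chain is recognised by checking
    the rule.

    Confinement is the delicate point. Staying in a cylinder involves uncountably many times, and
    between two grid points the chain may leave the cylinder and come back unseen. Such an excursion
    takes two jumps, which gives the O(h^2) per step; over t / h steps the total is O(t h). It is
    the only source of error, because the indicator of the cylinder passes through the Haar
    decomposition in the later coordinates. In the limit the survival probability is exactly exp (-
    M t) whatever the starting point in the cylinder, so that dividing by it leaves a Markov law. *)

Definition bits (I : Type) (c : seq (I * bool)) (x : I -> bool) : bool :=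
  all (fun p => x p.1 == p.2) c.

Lemma bits_nil (T I : Type) (X : T -> I -> bool) : [set z | bits [::] (X z)] = setT.
Proof. by apply/seteqP; split. Qed.

Lemma bits_cat (I : Type) (c d : seq (I * bool)) x :
  bits (c ++ d) x = bits c x && bits d x.
Proof. exact: all_cat. Qed.

Section cylindric.
Implicit Types (x y : cantor_space) (n k : nat).

Definition agree n x y := forall i, (i < n)%N -> x i = y i.

Definition level (T : Type) n (f : cantor_space -> T) :=
  forall x y, agree n x y -> f x = f y.

Definition setc n (b : bool) x : cantor_space :=
  fun i => if i == n then b else x i.

Definition flip n x := setc n (~~ x n) x.

Lemma agreeW m n x y : (m <= n)%N -> agree n x y -> agree m x y.
Proof. by move=> mn xy i im; apply: xy; exact: leq_trans mn. Qed.

Lemma agree_sym n x y : agree n x y -> agree n y x.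
Proof. by move=> xy i ni; rewrite xy. Qed.

Lemma agree_trans n x y z : agree n x y -> agree n y z -> agree n x z.
Proof. by move=> xy yz i ni; rewrite xy// yz. Qed.

Lemma levelW (T : Type) m n (f : cantor_space -> T) :
  (m <= n)%N -> level m f -> level n f.
Proof. by move=> mn lf x y xy; apply: lf; exact: agreeW xy. Qed.

Lemma setc_id n x : setc n (x n) x = x.
Proof. by apply/funext => i; rewrite /setc; case: eqP => [->|]. Qed.

Lemma setc_eq n b x : setc n b x n = b.
Proof. by rewrite /setc eqxx. Qed.

Lemma agree_setc n b x : agree n (setc n b x) x.
Proof. by move=> i ni; rewrite /setc ltn_eqF. Qed.

Lemma agree_setcS n b x y : agree n x y -> agree n.+1 (setc n b x) (setc n b y).
Proof.
move=> xy i; rewrite ltnS leq_eqVlt => /orP[/eqP->|ni]; first by rewrite !setc_eq.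
by rewrite /setc ltn_eqF// xy.
Qed.

Lemma level_setc (T : Type) n b (f : cantor_space -> T) :
  level n.+1 f -> level n (fun x => f (setc n b x)).
Proof. by move=> lf x y xy; apply: lf; exact: agree_setcS. Qed.

Lemma flipK n : involutive (flip n).
Proof.
move=> x; apply/funext => i; rewrite /flip /setc eqxx negbK.
by case: eqP => [->|].
Qed.

Lemma agree_flip n x : agree n (flip n x) x.
Proof. exact: agree_setc. Qed.

Lemma agree_flip_le n k x y : (k < n)%N -> agree n x y ->
  agree n (flip k x) (flip k y).
Proof.
by move=> kn xy i ni; rewrite /flip /setc (xy k)//; case: ifP => // _; exact: xy.
Qed.

Lemma level_comp2 (T1 T2 T : Type) n (h : T1 -> T2 -> T) f g :
  level n f -> level n g -> level n (fun x => h (f x) (g x)).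
Proof. by move=> lf lg x y xy; rewrite (lf _ _ xy) (lg _ _ xy). Qed.

Definition cylf (T : Type) (f : cantor_space -> T) := exists n, level n f.

Lemma cylf_comp2 (T1 T2 T : Type) (h : T1 -> T2 -> T) f g :
  cylf f -> cylf g -> cylf (fun x => h (f x) (g x)).
Proof.
move=> [n lf] [m lg]; exists (maxn n m); apply: level_comp2.
  by apply: levelW lf; exact: leq_maxl.
by apply: levelW lg; exact: leq_maxr.
Qed.

Lemma level_coords n x y : coords n x = coords n y <-> agree n x y.
Proof.
split=> [xy i ni|xy].
  by have := congr1 (fun v => tnth v (Ordinal ni)) xy; rewrite !tnth_mktuple.
by apply: eq_from_tnth => i; rewrite !tnth_mktuple xy.
Qed.

Lemma cyl_agree n (v : n.-tuple bool) x y : cyl v x -> cyl v y <-> agree n x y.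
Proof.
rewrite /cyl /= => xv; rewrite -level_coords xv; split => [->|<-]//.
Qed.

Lemma cylf_bits (c : seq (nat * bool)) : cylf (bits c : cantor_space -> bool).
Proof.
elim: c => [|[k b] c IH]; first by exists 0.
apply: (@cylf_comp2 _ _ _ andb) IH; exists k.+1 => x y xy.
by rewrite /= xy.
Qed.

End cylindric.

Section levelR.
Context {R : realType}.
Implicit Types (f g : cantor_space -> R) (x y : cantor_space) (n k : nat).

Lemma cylf_bitsR c : cylf (fun x => (bits c x)%:R : R).
Proof. by have [n ln] := cylf_bits c; exists n => x y /ln ->. Qed.

(** Splitting on the value of the last coordinate writes a cylinder function as a finite combination
    of indicators of bit events. Identities linear in a test function are thereby reduced to
    probabilities of such events. *)
Lemma level_lin (P : (cantor_space -> R) -> Prop) :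
  (forall a c, P (fun x => a * (bits c x)%:R)) ->
  (forall f g, cylf f -> cylf g -> P f -> P g -> P (fun x => f x + g x)) ->
  forall f, cylf f -> P f.
Proof.
move=> P1 P2 f [n].
(* The indicator factor collects the coordinate values already split on. *)
suff : forall c, level n f -> P (fun x => (bits c x)%:R * f x).
  move=> /(_ [::]) H /H; congr P; apply/funext => x.
  by rewrite /bits /= mul1r.
elim: n f => [|n IH] f c lf.
  have -> : (fun x => (bits c x)%:R * f x) = (fun x => f point * (bits c x)%:R).
    by apply/funext => x; rewrite mulrC (lf x point).
  exact: P1.
have -> : (fun x => (bits c x)%:R * f x) = (fun x =>
    (bits ((n, true) :: c) x)%:R * f (setc n true x) +
    (bits ((n, false) :: c) x)%:R * f (setc n false x)).
  apply/funext => x; rewrite /bits /= -/(bits c x).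
  have : f x = f (setc n (x n) x) by rewrite setc_id.
  by case: (x n) => <- /=; rewrite ?(mul0r, addr0, add0r).
apply: P2; try by apply: IH; exact: level_setc.
- by apply: (cylf_comp2 *%R (cylf_bitsR _)); exists n; exact: level_setc.
- by apply: (cylf_comp2 *%R (cylf_bitsR _)); exists n; exact: level_setc.
Qed.

Lemma level_bounded n f : level n f -> exists2 b, 0 <= b & forall x, `|f x| <= b.
Proof.
elim: n f => [|n IH] f lf.
  by exists `|f point| => // x; rewrite (lf x point).
have [b b0 fb] := IH _ (level_setc true lf).
have [c c0 fc] := IH _ (level_setc false lf).
exists (b + c); rewrite ?addr_ge0// => x; rewrite -[x](setc_id n).
case: (x n); first by rewrite (le_trans (fb _))// lerDl.
by rewrite (le_trans (fc _))// lerDr.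
Qed.

(** Even and odd parts under [flip n]. For [f] of level [n.+1] the even part is the conditional
    expectation given the first [n] coordinates, and the odd part is the Haar component of
    coordinate [n]. *)
Definition mean n f x := (f x + f (flip n x)) / 2.
Definition hdiff n f x := (f x - f (flip n x)) / 2.

Lemma meanD n f x : mean n f x + hdiff n f x = f x.
Proof. by rewrite /mean /hdiff; field. Qed.

Lemma level_mean n f : level n.+1 f -> level n (mean n f).
Proof.
move=> lf x y xy.
have E z : mean n f z = (f (setc n true z) + f (setc n false z)) / 2.
  have : f z = f (setc n (z n) z) by rewrite setc_id.
  by rewrite /mean /flip; case: (z n) => ->; rewrite // addrC.
by rewrite !E !(level_setc _ lf xy).
Qed.

Lemma level_mean_le n k f : (k < n)%N -> level n f -> level n (mean k f).
Proof.
by move=> kn lf x y xy; rewrite /mean (lf _ _ xy) (lf _ _ (agree_flip_le kn xy)).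
Qed.

Lemma level_hdiff n k f : (k < n)%N -> level n f -> level n (hdiff k f).
Proof.
by move=> kn lf x y xy; rewrite /hdiff (lf _ _ xy) (lf _ _ (agree_flip_le kn xy)).
Qed.

Lemma mean_id n k f : (n <= k)%N -> level n f -> mean k f = f.
Proof.
move=> nk lf; apply/funext => x; rewrite /mean (lf (flip k x) x).
  by field.
by apply: agreeW nk _; exact: agree_flip.
Qed.

Lemma hdiff0 n k f : (n <= k)%N -> level n f -> hdiff k f = fun=> 0.
Proof.
move=> nk lf; apply/funext => x; rewrite /hdiff (lf (flip k x) x) ?subrr ?mul0r//.
by apply: agreeW nk _; exact: agree_flip.
Qed.

Lemma mean_hdiff n f : mean n (hdiff n f) = fun=> 0.
Proof. by apply/funext => x; rewrite /mean /hdiff flipK; field. Qed.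

Lemma hdiff_hdiff n f : hdiff n (hdiff n f) = hdiff n f.
Proof. by apply/funext => x; rewrite /hdiff flipK; field. Qed.

Lemma mean_lin n a f g :
  mean n (fun x => a * f x + g x) = fun x => a * mean n f x + mean n g x.
Proof. by apply/funext => x; rewrite /mean; field. Qed.

Lemma hdiff_lin n a f g :
  hdiff n (fun x => a * f x + g x) = fun x => a * hdiff n f x + hdiff n g x.
Proof. by apply/funext => x; rewrite /hdiff; field. Qed.

Lemma normr_mean n f b : (forall x, `|f x| <= b) -> forall x, `|mean n f x| <= b.
Proof.
move=> fb x; rewrite /mean normf_div (ger0_norm (ler0n R 2)) ler_pdivrMr//.
rewrite (le_trans (ler_normD _ _))// mulr_natr mulr2n lerD//.
Qed.

Lemma normr_hdiff n f b : (forall x, `|f x| <= b) -> forall x, `|hdiff n f x| <= b.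
Proof.
move=> fb x; rewrite /hdiff normf_div (ger0_norm (ler0n R 2)) ler_pdivrMr//.
rewrite (le_trans (ler_normB _ _))// mulr_natr mulr2n lerD//.
Qed.

End levelR.

(** * The semigroup and its generator in the Haar decomposition *)

Section semigroup_operator.
Context {R : realType} (gamma theta : {nonneg R}).
Implicit Types (f g : cantor_space -> R) (x y : cantor_space) (n k : nat).

Definition rate k : R := gamma%:num * theta%:num ^+ k.

(** The total rate of the jumps that change one of the first [n] coordinates, that is, of leaving a
    cylinder of length [n]. *)
Definition total_rate n : R := \sum_(i < n) rate i.+1.

(* The Haar functions distinguishing the coordinate [n] are eigenfunctions of
   the generator, with eigenvalue [- decay n]. *)
Definition decay n : R := total_rate n + 2 * rate n.+1.

(** The exponential of [t] times the generator: the Haar component of the last coordinate is damped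
    by its eigenvalue and the mean is treated recursively. It is total in [f], but has its meaning
    as a semigroup on functions of level [n]. *)
Fixpoint chain_op n (t : R) f x : R :=
  if n is m.+1 then chain_op m t (mean m f) x + expR (- (decay m * t)) * hdiff m f x
  else f x.

Fixpoint chain_gen n f x : R :=
  if n is m.+1 then chain_gen m (mean m f) x - decay m * hdiff m f x else 0.

Local Notation U := chain_op.
Local Notation G := chain_gen.

Lemma rate_ge0 k : 0 <= rate k.
Proof. by rewrite mulr_ge0// exprn_ge0. Qed.

Lemma total_rate_ge0 n : 0 <= total_rate n.
Proof. by apply: sumr_ge0 => i _; exact: rate_ge0. Qed.

Lemma total_rateS n : total_rate n.+1 = total_rate n + rate n.+1.
Proof. by rewrite /total_rate big_ord_recr. Qed.

Lemma decay_ge0 n : 0 <= decay n.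
Proof. by rewrite addr_ge0 ?total_rate_ge0// mulr_ge0// rate_ge0. Qed.

Lemma level_chain_op n k t f : (n <= k)%N -> level k f -> level k (U n t f).
Proof.
elim: n f => [|n IH] f nk lf; first exact: lf.
apply: level_comp2; first by apply: IH (ltnW nk) _; exact: level_mean_le.
apply: (@level_comp2 _ _ _ _ (fun a b => a * b)) => //.
exact: level_hdiff.
Qed.

(** A coordinate on which [f] does not depend has zero Haar component, so the operators of all
    levels glue to one semigroup on cylinder functions. *)
Lemma chain_op_le m n t f : (m <= n)%N -> level m f -> U n t f = U m t f.
Proof.
elim: n => [|n IH]; first by rewrite leqn0 => /eqP ->.
rewrite leq_eqVlt => /orP[/eqP->//|]; rewrite ltnS => mn lf.
apply/funext => x /=; rewrite (mean_id mn lf) (hdiff0 mn lf) mulr0 addr0.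
by rewrite IH.
Qed.

Lemma chain_op_lin n t a f g :
  U n t (fun x => a * f x + g x) = fun x => a * U n t f x + U n t g x.
Proof.
elim: n f g => [//|n IH] f g; apply/funext => x /=.
by rewrite mean_lin hdiff_lin IH; ring.
Qed.

Lemma chain_op_cst n t a : U n t (fun=> a) = fun=> a.
Proof. by rewrite (@chain_op_le 0). Qed.

Lemma chain_op_scale n t a f : U n t (fun x => a * f x) = fun x => a * U n t f x.
Proof.
transitivity (U n t (fun x => a * f x + 0)).
  by congr U; apply/funext => x; rewrite addr0.
by rewrite (chain_op_lin n t a f (fun=> 0)) chain_op_cst; apply/funext => x; rewrite addr0.
Qed.

Lemma chain_op0 n f : U n 0 f = f.
Proof.
elim: n f => [//|n IH] f; apply/funext => x /=.
by rewrite IH mulr0 oppr0 expR0 mul1r meanD.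
Qed.

Lemma chain_opD n s t f : level n f -> U n (s + t) f = U n s (U n t f).
Proof.
elim: n f => [//|n IH] f lf; apply/funext => x /=.
have lm := level_mean lf.
have lU : level n (U n t (mean n f)) by exact: level_chain_op.
have -> : (fun y => U n t (mean n f) y + expR (- (decay n * t)) * hdiff n f y) =
    (fun y => expR (- (decay n * t)) * hdiff n f y + U n t (mean n f) y).
  by apply/funext => y; rewrite addrC.
rewrite mean_lin hdiff_lin mean_hdiff hdiff_hdiff (mean_id _ lU)//.
rewrite (hdiff0 _ lU)// IH// addr0 mulrA mulr0.
have -> : (fun x0 => 0 + U n t (mean n f) x0) = U n t (mean n f).
  by apply/funext => y; rewrite add0r.
by rewrite -expRD mulrDr opprD.
Qed.

(* With probability [expR (- (total_rate n * t))] none of the first [n]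
   coordinates is touched up to time [t]. *)
Lemma chain_op_lower n t f x : 0 <= t -> level n f -> (forall y, 0 <= f y) ->
  expR (- (total_rate n * t)) * f x <= U n t f x.
Proof.
move=> t0; elim: n f => [|n IH] f lf f0 /=.
  by rewrite /total_rate big_ord0 mul0r oppr0 expR0 mul1r.
have lm := level_mean lf.
have m0 y : 0 <= mean n f y by rewrite divr_ge0// addr_ge0.
apply: le_trans (lerD (IH _ lm m0) (lexx _)).
rewrite total_rateS /decay; set a := total_rate n * t.
set e := expR (- (rate n.+1 * t)).
have -> : expR (- ((total_rate n + rate n.+1) * t)) = expR (- a) * e.
  by rewrite -expRD mulrDl opprD.
have -> : expR (- ((total_rate n + 2 * rate n.+1) * t)) = expR (- a) * (e * e).
  by rewrite -!expRD /a; congr expR; ring.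
rewrite -!mulrA -mulrDr ler_pM2l ?expR_gt0//.
have e0 : 0 <= e by rewrite expR_ge0.
have e1 : e <= 1.
  by rewrite /e -expR0 ler_expR lerNl oppr0 mulr_ge0// rate_ge0.
have fx := f0 x; have fy := f0 (flip n x).
rewrite /mean /hdiff -subr_ge0.
(* After the common factor [expR (- a)] is removed, the difference of the two sides has nonnegative
   coefficients at both points, since [e <= 1]. *)
have -> : (f x + f (flip n x)) / 2 + e * (e * ((f x - f (flip n x)) / 2)) - e * f x
  = ((1 - e) * (1 - e) * f x + (1 - e * e) * f (flip n x)) / 2 by field.
rewrite divr_ge0// addr_ge0// mulr_ge0//; first by rewrite -expr2 sqr_ge0.
by rewrite subr_ge0 mulr_ile1.
Qed.

Lemma chain_op_ge0 n t f x : 0 <= t -> level n f -> (forall y, 0 <= f y) -> 0 <= U n t f x.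
Proof.
by move=> t0 lf f0; apply: le_trans (chain_op_lower x t0 lf f0); rewrite mulr_ge0// expR_ge0.
Qed.

Lemma chain_op_mono n t f g x : 0 <= t -> level n f -> level n g ->
  (forall y, f y <= g y) -> U n t f x <= U n t g x.
Proof.
move=> t0 lf lg fg; rewrite -subr_ge0.
have -> : U n t g x - U n t f x = U n t (fun y => -1 * f y + g y) x.
  by rewrite chain_op_lin mulN1r addrC.
apply: chain_op_ge0 => //; first by move=> y z yz; rewrite (lf _ _ yz) (lg _ _ yz).
by move=> y; rewrite mulN1r addrC subr_ge0.
Qed.

Lemma chain_op_norm n t f b x : 0 <= t -> level n f -> (forall y, `|f y| <= b) ->
  `|U n t f x| <= b.
Proof.
move=> t0 lf fb; rewrite ler_norml; apply/andP; split.
  rewrite -[- b](congr1 (fun h => h x) (chain_op_cst n t (- b))).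
  by apply: chain_op_mono => // y; have := fb y; rewrite ler_norml => /andP[].
rewrite -[leRHS](congr1 (fun h => h x) (chain_op_cst n t b)).
by apply: chain_op_mono => // y; have := fb y; rewrite ler_norml => /andP[].
Qed.

Lemma chain_op_continuous n f x : continuous (fun t => U n t f x).
Proof.
elim: n f => [|n IH] f t; first exact: cvg_cst.
apply: cvgD; first exact: IH.
apply: cvgMr_tmp; apply: continuous_comp; last exact: continuous_expR.
by apply: cvgN; apply: cvgMl_tmp; exact: cvg_id.
Qed.

(** For the upper half, invert [1 + u <= expR u]: the product of [1 - u + u^2] and [1 + u] is
    [1 + u^3], which is at least 1. *)
Lemma expRN_taylor (u : R) : 0 <= u -> `|expR (- u) - 1 + u| <= u ^+ 2.
Proof.
move=> u0; rewrite ler_norml; apply/andP; split.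
  have := expR_ge1Dx (- u); have := sqr_ge0 u; lra.
have := expR_ge1Dx u => H; rewrite expRN.
have E0 : 0 < expR u by exact: expR_gt0.
suff : (expR u)^-1 <= 1 - u + u ^+ 2 by lra.
rewrite -[leLHS]mul1r ler_pdivrMr//.
have h : 0 <= 1 - u + u ^+ 2 by nra.
apply: le_trans (ler_wpM2l h H).
have -> : (1 - u + u ^+ 2) * (1 + u) = 1 + u ^+ 3 by ring.
by rewrite lerDl exprn_ge0.
Qed.

(** The constant is the sum of the squared eigenvalues, hence uniform in [f] and [x]. The uniformity
    serves both the generator, a limit in the sup norm, and the excursion probability of the killed
    chain. *)
Lemma chain_op_taylor n : exists2 C : R, 0 <= C & forall f b t x, 0 <= t ->
  (forall y, `|f y| <= b) -> `|U n t f x - f x - t * G n f x| <= C * t ^+ 2 * b.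
Proof.
elim: n => [|n [C C0 IH]].
  exists 0 => // f b t x t0 fb /=.
  by rewrite subrr mulr0 subr0 normr0 !mul0r.
exists (C + decay n ^+ 2) => [|f b t x t0 fb /=].
  by rewrite addr_ge0// sqr_ge0.
have := IH _ _ _ x t0 (normr_mean n fb).
have := normr_hdiff n fb x.
have := expRN_taylor (mulr_ge0 (decay_ge0 n) t0).
set e := expR _; set d := hdiff n f x => H1 H2 H3.
have -> : U n t (mean n f) x + e * d - f x -
    t * (G n (mean n f) x - decay n * d) =
    (U n t (mean n f) x - mean n f x - t * G n (mean n f) x) +
    (e - 1 + decay n * t) * d.
  by rewrite -(meanD n f x) -/d; ring.
have -> : (C + decay n ^+ 2) * t ^+ 2 * b =
  C * t ^+ 2 * b + (decay n * t) ^+ 2 * b by ring.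
by apply: le_trans (ler_normD _ _) _; rewrite lerD// normrM ler_pM.
Qed.

End semigroup_operator.

(** * Topology and Borel sets of the Cantor set and of the path space *)

Lemma bits_event_setI (T I : Type) (X : T -> I -> bool) :
  setI_closed [set A | exists c, A = [set z | bits c (X z)]].
Proof.
move=> _ _ [c ->] [d ->]; exists (c ++ d); apply/seteqP.
by split=> z /=; rewrite bits_cat => /andP.
Qed.

Section cantor_borel.
Implicit Types (x y : cantor_space) (n : nat).

Lemma nbhs_agree x (A : set cantor_space) :
  nbhs x A <-> exists n, forall y, agree n x y -> A y.
Proof.
split=> [|[n nA]].
  pose F := filter_from [set: nat] (fun n => [set y | agree n x y]).
  have FF : Filter F.
    apply: filter_fromT_filter; first by exists 0%N.
    move=> i j; exists (maxn i j) => y /= xy.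
    by split; apply: agreeW xy; rewrite leq_max leqnn ?orbT.
  suff Fx : F --> x by move=> /Fx [n _ nA]; exists n.
  apply/cvg_sup => i V [_ [[W oW <-] /= Wx WV]].
  by exists i.+1 => // y /= /(_ i (ltnSn i)) xyi; apply: WV; rewrite /= -xyi.
apply: (@filterS _ _ _ [set y | agree n x y]) => //.
elim: n {nA} => [|n IH]; first exact: filterS filterT.
have xn : nbhs x [set y : cantor_space | x n = y n].
  have := @proj_continuous nat (fun=> bool) n x.
  by move=> /(_ [set b | x n = b]); apply; rewrite nbhs_principalE => y ->.
apply: filterS (filterI IH xn) => y [xy xyn] i; rewrite ltnS leq_eqVlt.
by move=> /orP[/eqP->//|]; exact: xy.
Qed.

Lemma level_open n (A : set cantor_space) : level n A -> open A.
Proof.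
move=> lA; rewrite openE => x Ax; apply/nbhs_agree; exists n => y xy.
by rewrite -(lA x y xy).
Qed.

Lemma level_measurable n (A : set cantor_space) : level n A -> measurable A.
Proof. by move=> /level_open oA; exact: sub_sigma_algebra. Qed.

Lemma level_continuous n (T : topologicalType) (f : cantor_space -> T) :
  level n f -> continuous f.
Proof.
move=> lf x A fxA; apply/nbhs_agree; exists n => y xy /=.
by rewrite -(lf x y xy); exact: nbhs_singleton.
Qed.

Lemma cylf_measurable d (T : measurableType d) (f : cantor_space -> T) :
  cylf f -> measurable_fun setT f.
Proof.
move=> [n lf] _ B mB; rewrite setTI; apply: (@level_measurable n) => x y xy.
by rewrite /preimage /= (lf x y xy).
Qed.

Definition bit_events : set (set cantor_space) :=
  [set A | exists c : seq (nat * bool), A = [set z | bits c z]].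

Lemma level_bit_events n (A : set cantor_space) : level n A -> <<s bit_events >> A.
Proof.
pose C := g_sigma_algebraType bit_events.
elim: n A => [|n IH] A lA.
  have [A0|nA0] := pselect (A point).
    suff -> : A = setT by exact: (@measurableT _ C).
    by apply/seteqP; split=> // x _; rewrite (lA x point).
  suff -> : A = set0 by exact: (@measurable0 _ C).
  by apply/seteqP; split=> // x; rewrite (lA x point).
pose B b := [set x : cantor_space | x n = b] `&` (fun x => A (setc n b x)).
have mB b : <<s bit_events >> (B b).
  apply: (@measurableI _ C); last by apply: IH; exact: level_setc.
  apply: sub_sigma_algebra; exists [:: (n, b)].
  by apply/seteqP; split=> x; rewrite /bits /= andbT => /eqP.
have -> : A = B true `|` B false.
  apply/seteqP; split=> x.
    by rewrite -{1}(setc_id n x) => Ax; case E : (x n) Ax; [left|right].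
  by move=> [] [] /= xn; rewrite -{2}(setc_id n x) xn.
by apply: (@measurableU _ C); exact: mB.
Qed.

Lemma cantor_measurableE :
  @measurable _ cantor_space = <<s bit_events >>.
Proof.
apply/seteqP; split; last first.
  apply: smallest_sub; first exact: sigma_algebra_measurable.
  move=> _ [c ->]; have [n ln] := cylf_bits c.
  by apply: (@level_measurable n) => x y xy /=; rewrite (ln x y xy).
apply: smallest_sub; first exact: smallest_sigma_algebra.
move=> A; rewrite /cantor_open /= openE => oA.
(* The points whose cylinder of length [n] lies in [A]: an open set is a countable union of sets of
   finite level. *)
pose B n := [set x | forall y, agree n x y -> A y].
have -> : A = \bigcup_n B n.
  apply/seteqP; split=> [x /oA/nbhs_agree[n nA]|x [n _]]; first by exists n.
  exact.
apply: (@bigcup_measurable _ (g_sigma_algebraType bit_events)) => n _.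
apply: (@level_bit_events n) => x y xy; apply/propext; split => H z.
  by move=> yz; apply: H; exact: agree_trans yz.
by move=> xz; apply: H; apply: agree_trans xz; exact: agree_sym.
Qed.

(** Dynkin's pi-lambda theorem for the pi-system of bit events, which generates the Borel sets. *)
Lemma cantor_ind (P : set_system cantor_space) :
  P [set: cantor_space] ->
  (forall c : seq (nat * bool), P [set z | bits c z]) ->
  (forall S, measurable S -> P S -> P (~` S)) ->
  (forall F : (set cantor_space)^nat, (forall n, measurable (F n)) ->
    trivIset [set: nat] F -> (forall n, P (F n)) -> P (\bigcup_k F k)) ->
  forall S, measurable S -> P S.
Proof.
move=> PT Pb PC PU S; rewrite cantor_measurableE.
apply: dynkin_induction => //; first exact: cantor_measurableE.
  exact: (@bits_event_setI _ _ (fun x => x)).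
by move=> _ [c ->].
Qed.

Lemma measurable_fun_cantor d (T : measurableType d) (f : T -> cantor_space) :
  (forall k, measurable [set t | f t k = true]) -> measurable_fun setT f.
Proof.
move=> mf; have mb c : measurable [set t | bits c (f t)].
  elim: c => [|[k b] c IH].
    rewrite (_ : [set _ | _] = setT)//.
    by apply/seteqP; split.
  rewrite (_ : [set _ | _] = (if b then [set t | f t k = true] else
    ~` [set t | f t k = true]) `&` [set t | bits c (f t)]); last first.
    apply/seteqP; split=> t; rewrite /bits /=.
      by move=> /andP[/eqP <-] ?; split=> //; case E : (f t k) => /=; rewrite ?E.
    by case: b => -[] /=; case: (f t k) => //=.
  by apply: measurableI => //; case: b => //; exact: measurableC.
move=> _ B mB; rewrite setTI.
apply: (@cantor_ind (fun B => measurable (f @^-1` B))) mB => //.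
- by rewrite preimage_setT.
- by move=> S _ mS; rewrite preimage_setC; exact: measurableC.
- by move=> F _ _ mF; rewrite preimage_bigcup; exact: bigcup_measurable.
Qed.

End cantor_borel.

(** * The sigma-algebras of the path space *)

Section path_space.
Context {R : realType}.
Implicit Types (w : cpath R) (I : set {nonneg R}).

Definition path_bit w (p : {nonneg R} * nat) : bool := w p.1 p.2.

Definition at_times I (c : seq ({nonneg R} * nat * bool)) :=
  forall p, p \in c -> I p.1.1.

(** Parametrized by a set of times, so that the same pi-system argument serves the past of a time
    and the whole path sigma-algebra. *)
Definition path_bit_events I : set (set (cpath R)) :=
  [set A | exists2 c, at_times I c & A = [set w | bits c (path_bit w)]].

Lemma path_bit_events_setI I : setI_closed (path_bit_events I).
Proof.
move=> _ _ [c Ic ->] [d Id ->]; exists (c ++ d).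
  by move=> p; rewrite mem_cat => /orP[/Ic|/Id].
by apply/seteqP; split=> z /=; rewrite bits_cat => /andP.
Qed.

Lemma path_eventsE I : <<s path_events I >> = <<s path_bit_events I >>.
Proof.
apply/seteqP; split; apply: smallest_sub; try exact: smallest_sigma_algebra.
  move=> _ [t [B [It mB ->]]].
  pose C := g_sigma_algebraType (path_bit_events I).
  apply: (@cantor_ind (fun B => <<s path_bit_events I >> [set w : cpath R | B (w t)])) => //.
  - exact: (@measurableT _ C).
  - move=> c; apply: sub_sigma_algebra; exists [seq (t, p.1, p.2) | p <- c].
      by move=> p /mapP[q _ ->].
    by apply/seteqP; split=> w; rewrite /bits /= all_map.
  - by move=> S _ mS; exact: (@measurableC _ C).
  - move=> F _ _ mF.
    have -> : [set w : cpath R | (\bigcup_k F k) (w t)] =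
        \bigcup_k [set w : cpath R | F k (w t)] by [].
    by apply: (@bigcup_measurable _ C) => n _; exact: mF.
move=> _ [c Ic ->]; pose C := g_sigma_algebraType (path_events I).
elim: c Ic => [|[[t k] b] c IH] Ic.
  rewrite (_ : [set _ | _] = setT); first exact: (@measurableT _ C).
  by apply/seteqP; split.
have -> : [set w | bits ((t, k, b) :: c) (path_bit w)] =
    [set w : cpath R | [set x : cantor_space | x k = b] (w t)] `&`
    [set w | bits c (path_bit w)].
  apply/seteqP; split=> w; rewrite /bits /=; first by move=> /andP[/eqP].
  by move=> [/eqP ? ?]; apply/andP.
apply: (@measurableI _ C).
  apply: sub_sigma_algebra; exists t, [set x : cantor_space | x k = b]; split => //.
    by apply: (Ic (t, k, b)); rewrite inE eqxx.
  by apply: (@level_measurable k.+1) => x y xy /=; rewrite xy.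
by apply: IH => p pc; apply: Ic; rewrite inE pc orbT.
Qed.

Lemma past_ind (I : set {nonneg R}) (P : set_system (cpath R)) :
  P [set: cpath R] ->
  (forall c, at_times I c -> P [set w | bits c (path_bit w)]) ->
  (forall S, <<s path_events I >> S -> P S -> P (~` S)) ->
  (forall F : (set (cpath R))^nat, (forall n, <<s path_events I >> (F n)) ->
    trivIset [set: nat] F -> (forall n, P (F n)) -> P (\bigcup_k F k)) ->
  forall S, <<s path_events I >> S -> P S.
Proof.
rewrite path_eventsE => PT Pb PC PU S.
apply: (@dynkin_induction _ (g_sigma_algebraType (path_bit_events I))) => //.
  exact: path_bit_events_setI.
by move=> _ [c Ic ->]; exact: Pb.
Qed.

Lemma cpath_measurableE : @measurable _ (cpath R) = <<s path_events (@setT {nonneg R}) >>.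
Proof. by []. Qed.

Lemma past_measurable I A : <<s path_events I >> A -> measurable A.
Proof.
rewrite cpath_measurableE; apply: sub_sigma_algebra2.
by move=> _ [t [B [_ mB ->]]]; exists t, B.
Qed.

Local Notation past_space t :=
  (g_sigma_algebraType (path_events [set u : {nonneg R} | u%:num <= t%:num])).

Lemma pastT t : past t (@setT (cpath R)).
Proof. exact: (@measurableT _ (past_space t)). Qed.

Lemma past_setI t (A B : set (cpath R)) : past t A -> past t B -> past t (A `&` B).
Proof. exact: (@measurableI _ (past_space t)). Qed.

Lemma past_bigcap t (A : nat -> set (cpath R)) : (forall i, past t (A i)) -> past t (\bigcap_i A i).
Proof. by move=> pA; apply: (@bigcapT_measurable _ (past_space t)). Qed.

Lemma past_le s t (A : set (cpath R)) : s%:num <= t%:num -> past s A -> past t A.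
Proof.
move=> st; apply: sub_sigma_algebra2 => _ [u [B [us mB ->]]]; exists u, B; split => //.
exact: le_trans us st.
Qed.

Lemma measurable_eval t : measurable_fun setT (fun w : cpath R => w t).
Proof.
by move=> _ B mB; rewrite setTI; apply: sub_sigma_algebra; exists t, B.
Qed.

Lemma measurable_fun_cpath d (T : measurableType d) (f : T -> cpath R) :
  (forall t k, measurable [set z | f z t k = true]) -> measurable_fun setT f.
Proof.
move=> mf.
have mt t : measurable_fun setT (fun z => f z t).
  by apply: measurable_fun_cantor => k; exact: mf.
apply: measurability => // _ [_ [t [B [_ mB ->]]] <-]; rewrite setTI.
by have := mt t measurableT B mB; rewrite setTI.
Qed.

Lemma past_measure_unique (I : set {nonneg R}) (m1 m2 : {measure set (cpath R) -> \bar R}) :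
  (m1 setT < +oo)%E ->
  (forall c, at_times I c -> m1 [set w | bits c (path_bit w)] = m2 [set w | bits c (path_bit w)]) ->
  forall A, <<s path_events I >> A -> m1 A = m2 A.
Proof.
move=> m1oo m12 A; rewrite path_eventsE.
have b0 : path_bit_events I setT by exists [::] => //; apply/seteqP; split.
apply: (@g_sigma_algebra_measure_unique _ _ _ (path_bit_events I) _ (fun=> setT)) => //.
- move=> _ [c Ic ->]; apply: (@past_measurable I); rewrite path_eventsE.
  by apply: sub_sigma_algebra; exists c.
- by rewrite bigcup_const//; exists 0%N.
- exact: path_bit_events_setI.
- by move=> _ [c Ic ->]; exact: m12.
Qed.

Lemma cpath_measure_unique (m1 m2 : {measure set (cpath R) -> \bar R}) :
  (m1 setT < +oo)%E ->
  (forall c, m1 [set w | bits c (path_bit w)] = m2 [set w | bits c (path_bit w)]) ->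
  forall A, measurable A -> m1 A = m2 A.
Proof.
by move=> m1oo m12 A; rewrite cpath_measurableE; apply: past_measure_unique => // c _.
Qed.

End path_space.

(** * Kolmogorov extension *)

Lemma pushforward_probability (R : realType) d d' (T : measurableType d)
    (T' : measurableType d') (m : probability T R) (f : T -> T') :
  measurable_fun setT f ->
  exists Q : probability T' R, forall A, Q A = m (f @^-1` A).
Proof.
move=> mf; pose X : {mfun T >-> T'} := HB.pack f (isMeasurableFun.Build _ _ _ _ _ mf).
by exists (distribution m X).
Qed.

Lemma measure_probability (R : realType) d (T : measurableType d)
    (m : measure T R) : m setT = 1%E ->
  exists Q : probability T R, forall A, Q A = m A.
Proof.
(* Normalizing by a total mass of 1 leaves the values unchanged and yields a bundled probability. *)
move=> m1; exists (mnormalize m (dirac point)) => A.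
by rewrite /= /mnormalize m1 onee_eq0 /= invr1 mule1.
Qed.

Lemma uniform01 (R : realType) : exists Q : probability (measurableTypeR R) R,
  forall A : set R, Q A = lebesgue_measure (A `&` `[0, 1[%classic).
Proof.
have mD : measurable (`[0, 1[%classic : set (measurableTypeR R)) by exact: measurable_itv.
have [|Q QE] := @measure_probability R _ _ (mrestr lebesgue_measure mD).
  by rewrite /= /mrestr setTI lebesgue_measure_itv /= lte_fin ltr01 oppr0 adde0.
by exists Q => A; rewrite QE.
Qed.

(** * A measure on the Cantor set from consistent word probabilities *)

Section word_measure.
Context {R : realType}.
Variable p : seq bool -> R.
Hypothesis p_ge0 : forall w, 0 <= p w.
Hypothesis p_nil : p [::] = 1.
Hypothesis p_cons : forall w, p (false :: w) + p (true :: w) = p w.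

(* Words are read backwards: the last letter of the prefix comes first. *)
Fixpoint rprefix n (z : nat -> bool) : seq bool :=
  if n is m.+1 then z m :: rprefix m z else [::].

(** Each word labels a subinterval of the unit interval, of length [p w]; it is cut into the
    interval of [false :: w] on the left and that of [true :: w] on the right. *)
Fixpoint left_end (w : seq bool) : R :=
  if w is b :: w' then left_end w' + (if b then p (false :: w') else 0) else 0.

Definition turns_right (w : seq bool) (u : R) : bool := left_end w + p (false :: w) <= u.

Fixpoint quantile_word n (u : R) : seq bool :=
  if n is m.+1 then
    turns_right (quantile_word m u) u :: quantile_word m u
  else [::].

(** The address of [u] in these nested intervals; the image of the uniform law under it is the
    measure sought. *)
Definition quantile (u : R) : cantor_space :=
  fun n => turns_right (quantile_word n u) u.

Lemma rprefix_quantile n u : rprefix n (quantile u) = quantile_word n u.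
Proof. by elim: n => //= n ->. Qed.

Lemma quantile_wordP w u : 0 <= u < 1 ->
  (quantile_word (size w) u == w) = (left_end w <= u < left_end w + p w).
Proof.
move=> u01; elim: w => [|b w IH] /=; first by rewrite p_nil add0r u01.
have pf := p_ge0 (false :: w); have pt := p_ge0 (true :: w); have pc := p_cons w.
rewrite eqseq_cons andbC; have [E|NE] := eqVneq (quantile_word (size w) u) w.
  move: IH; rewrite E eqxx /= => /esym /andP[lu ur]; rewrite /turns_right.
  case: b => /=; have [h|h] := leP (left_end w + p (false :: w)) u => /=;
    apply/esym => //; rewrite ?eqxx.
  - by apply/idP; lra.
  - by apply/negP => /andP[]; lra.
  - by apply/andP; split; lra.
move: IH; rewrite (negbTE NE) /= => /esym/negP IH; apply/esym/negP => /andP[h1 h2].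
apply: IH; apply/andP; split; first by case: b h1 h2; lra.
by case: b h1 h2; lra.
Qed.

Lemma measurable_quantile : measurable_fun setT (quantile : measurableTypeR R -> _).
Proof.
apply: measurable_fun_cantor => k; rewrite /quantile.
have mturn w : measurable [set u : measurableTypeR R | turns_right w u].
  rewrite (_ : [set _ | _] = `[left_end w + p (false :: w), +oo[%classic).
    exact: measurable_itv.
  by apply/seteqP; split=> u /=; rewrite in_itv /= andbT.
(* The next threshold depends on the word found so far, so the induction carries a whole family of
   sets indexed by words. *)
suff H : forall n (A : seq bool -> set (measurableTypeR R)), (forall w, measurable (A w)) ->
    measurable [set u : measurableTypeR R | A (quantile_word n u) u].
  exact: (H k (fun w => [set u : measurableTypeR R | turns_right w u])).
elim=> [|n IH] A mA; first exact: mA.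
rewrite (_ : [set _ | _] = [set u : measurableTypeR R |
    (([set v : measurableTypeR R | turns_right (quantile_word n u) v] `&`
       A (true :: quantile_word n u)) `|`
    (~` [set v : measurableTypeR R | turns_right (quantile_word n u) v] `&`
       A (false :: quantile_word n u))) u]).
  pose S w : set (measurableTypeR R) := [set v | turns_right w v].
  apply: (IH (fun w => (S w `&` A (true :: w)) `|` (~` S w `&` A (false :: w)))) => w.
  by apply: measurableU; apply: measurableI => //; try apply: measurableC; exact: mturn.
apply/seteqP; split=> u /=.
  by case: (turns_right _ u) => ?; [left|right]; split.
by move=> [[-> //]|[/negP/negbTE ->]].
Qed.

Lemma word_measure : exists m : probability cantor_space R,
  forall w, m [set z : cantor_space | rprefix (size w) z = w] = (p w)%:E.
Proof.
have [Q QE] := uniform01 R.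
have [m mE] := pushforward_probability Q measurable_quantile.
exists m => w; rewrite mE QE.
rewrite (_ : _ `&` _ = `[left_end w, left_end w + p w[%classic).
  rewrite lebesgue_measure_itv /= lte_fin ltrDl.
  case: ltP => [_|p0]; first by rewrite -EFinD addrAC subrr add0r.
  by congr EFin; apply/eqP; rewrite eq_le p_ge0 p0.
have bounds : 0 <= left_end w /\ left_end w + p w <= 1.
  elim: w => [|b w [h1 h2]] /=; first by rewrite p_nil add0r.
  have pf := p_ge0 (false :: w); have pt := p_ge0 (true :: w); have pc := p_cons w.
  by case: b; split; lra.
apply/seteqP; split=> u /=; rewrite in_itv /= rprefix_quantile.
  move=> [+]; rewrite in_itv /= => /eqP + u01.
  by rewrite quantile_wordP.
move=> luw; have u01 : 0 <= u < 1.
  case: bounds => b1 b2; case/andP: luw => l1 l2.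
  by rewrite (le_trans b1 l1) (lt_le_trans l2 b2).
by rewrite in_itv /= u01; split=> //; apply/eqP; rewrite quantile_wordP.
Qed.

End word_measure.

(** * Extension of consistent finite constraints on a countable index set *)

Section kolmogorov.
Context {R : realType} {I : countType} (i0 : I).
Variable q : seq (I * bool) -> R.
Hypothesis q_ge0 : forall c, 0 <= q c.
Hypothesis q_nil : q [::] = 1.
Hypothesis q_perm : forall c d, perm_eq c d -> q c = q d.
Hypothesis q_cons : forall i c, q ((i, false) :: c) + q ((i, true) :: c) = q c.
Hypothesis q_conflict : forall i c, q ((i, false) :: (i, true) :: c) = 0.

(** Numbers that decode to no index are sent to [i0]. The same index may thus occur at several
    places of a word, which [q_sub] and [q_conflict_in] handle. *)
Definition coordinate (n : nat) : I := odflt i0 (unpickle n).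

Fixpoint word_constraints (w : seq bool) : seq (I * bool) :=
  if w is b :: w' then (coordinate (size w'), b) :: word_constraints w' else [::].

(** By additivity, imposing a constraint again only discards the contradictory half, whose weight is
    0 by [q_conflict]. *)
Lemma q_sub c d : {subset d <= c} -> q (d ++ c) = q c.
Proof.
elim: d => [//|[i b] d IH] dc /=.
have dc' : {subset d <= c} by move=> e ed; apply: dc; rewrite inE ed orbT.
rewrite -[RHS](IH dc') -(q_cons i (d ++ c)).
have ibc : (i, b) \in d ++ c by rewrite mem_cat dc ?inE ?eqxx// orbT.
have q0 : q ((i, ~~ b) :: d ++ c) = 0.
  rewrite (@q_perm _ ((i, ~~ b) :: (i, b) :: rem (i, b) (d ++ c))); last first.
    by rewrite perm_cons perm_to_rem.
  case: b {dc ibc} => /=; first exact: q_conflict.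
  rewrite (@q_perm _ ((i, false) :: (i, true) :: rem (i, false) (d ++ c))).
    exact: q_conflict.
  by rewrite -(perm_catCA [:: _] [:: _]).
by case: b q0 {dc ibc} => /= ->; rewrite ?add0r ?addr0.
Qed.

Lemma q_conflict_in i b c : (i, b) \in c -> (i, ~~ b) \in c -> q c = 0.
Proof.
move=> h1 h2.
have h3 : {subset [:: (i, false); (i, true)] <= c}.
  by move=> e; rewrite !inE => /orP[] /eqP ->; case: b h1 h2.
by rewrite -(q_sub h3) q_conflict.
Qed.

Lemma kolmogorov : exists m : probability cantor_space R,
  forall c, m [set z | bits c (fun i => z (pickle i))] = (q c)%:E.
Proof.
have [w||w|m mE] := @word_measure R (q \o word_constraints).
- exact: q_ge0.
- exact: q_nil.
- exact: q_cons.
exists m => c; pose E := [set z : cantor_space | bits c (fun i => z (pickle i))].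
have mc w : measurable [set z : cantor_space | rprefix (size w) z = w].
  apply: (@level_measurable (size w)) => x y xy /=; congr (_ = _).
  elim: (size w) xy => //= n IH xy; rewrite xy// IH//.
  by move=> i ni; apply: xy; rewrite ltnS ltnW.
have mE' : measurable E.
  suff [n ln] : cylf (fun z : cantor_space => bits c (fun i => z (pickle i))).
    by apply: (@level_measurable n) => x y xy; rewrite /E /= (ln x y xy).
  elim: {E} c => [|[i b] c IH]; first by exists 0%N.
  apply: (@cylf_comp2 _ _ _ andb) IH; exists (pickle i).+1 => x y xy.
  by rewrite /= xy.
(* A word of length [N] fixes every coordinate mentioned in [c]. *)
pose N := (\max_(e <- c) pickle e.1).+1.
have cN e : e \in c -> (pickle e.1 < N)%N.
  by move=> ec; rewrite ltnS; apply: leq_bigmax_seq.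
have memw w k : (k < size w)%N ->
    (coordinate k, nth false (rev w) k) \in word_constraints w.
  elim: w => //= b w IH; rewrite ltnS leq_eqVlt rev_cons nth_rcons size_rev.
  move=> /orP[/eqP ->|kw]; first by rewrite ltnn eqxx inE eqxx.
  by rewrite kw inE IH ?orbT.
have nthrp n (z : cantor_space) k : (k < n)%N -> nth false (rev (rprefix n z)) k = z k.
  elim: n => //= n IH; rewrite ltnS leq_eqVlt rev_cons nth_rcons size_rev.
  have sz j : size (rprefix j z) = j by elim: j => //= j ->.
  rewrite sz => /orP[/eqP ->|kn]; first by rewrite ltnn eqxx.
  by rewrite kn IH.
(* Induction on the number [j] of coordinates still free. With none left, the word either implies
   [c] or contradicts it; otherwise both sides split additively over the next letter. *)
suff H j w : (size w + j)%N = N ->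
    m ([set z : cantor_space | rprefix (size w) z = w] `&` E) = (q (c ++ word_constraints w))%:E.
  by have := H N [::] erefl; rewrite /= cats0 => <-; congr (m _); apply/seteqP; split=> z // [].
elim: j w => [|j IH] w wj.
  rewrite addn0 in wj.
  have [cw|] := boolP (all (fun e => nth false (rev w) (pickle e.1) == e.2) c).
    rewrite q_sub; last first.
      move=> [i b] ec; have /= := allP cw _ ec; move=> /eqP <-.
      by have := memw w (pickle i); rewrite wj /coordinate pickleK; apply; exact: (cN _ ec).
    rewrite -(mE w); congr (m _); apply/seteqP; split=> [z []//|z zw]; split=> //.
    rewrite /E /= /bits (eq_in_all (a2 := fun e => nth false (rev w) (pickle e.1) == e.2))//.
    by move=> e /cN eN /=; rewrite -zw nthrp ?wj.
  move=> /allPn[[i b] ec /= nb].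
  rewrite (@q_conflict_in i b); last 2 first.
  - by rewrite mem_cat ec.
  - rewrite mem_cat; apply/orP; right.
    have := memw w (pickle i); rewrite wj /coordinate pickleK /=.
    by move=> /(_ (cN _ ec)); case: (nth _ _ _) nb; case: b {ec}.
  rewrite (_ : _ `&` _ = set0) ?measure0//.
  apply/seteqP; split=> // z [/= zw /allP /(_ _ ec) /= /eqP zb].
  by move: nb; rewrite -zw nthrp ?wj ?(cN _ ec)// zb eqxx.
have split_w : [set z : cantor_space | rprefix (size w) z = w] `&` E =
    ([set z : cantor_space | rprefix (size (false :: w)) z = false :: w] `&` E) `|`
    ([set z : cantor_space | rprefix (size (true :: w)) z = true :: w] `&` E).
  apply/seteqP; split=> z /=.
    by move=> [-> Ez]; case: (z (size w)); [right|left].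
  by move=> [] [[_ zw] Ez].
rewrite split_w measureU; last 3 first.
- by apply: measurableI => //; exact: mc.
- by apply: measurableI => //; exact: mc.
- by apply/seteqP; split=> // z [[/= [-> _] _] [/= []]].
transitivity ((q (c ++ word_constraints (false :: w)))%:E +
    (q (c ++ word_constraints (true :: w)))%:E)%E.
  by congr adde; apply: IH; rewrite /= addSnnS.
rewrite -EFinD; congr EFin => /=.
have pm b : q (c ++ (coordinate (size w), b) :: word_constraints w) =
    q ((coordinate (size w), b) :: c ++ word_constraints w).
  by apply: q_perm; rewrite -(perm_catCA [:: _]).
by rewrite !pm q_cons.
Qed.

End kolmogorov.

(** * Integrals of bounded functions *)

Section bounded_integration.
Context {R : realType} d (T : measurableType d) (m : probability T R).
Implicit Types (D : set T) (f g : T -> R).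

Definition bounded_on D f := exists b, forall x, D x -> `|f x| <= b.

Lemma integrable_bounded D f : measurable D -> measurable_fun D f ->
  bounded_on D f -> m.-integrable D (EFin \o f).
Proof.
move=> mD mf [b fb]; apply: measurable_bounded_integrable => //.
  by rewrite (le_lt_trans (probability_le1 m mD))// ltry.
by exists b; split; [exact: num_real|move=> c bc x Dx; exact: le_trans (fb x Dx) (ltW bc)].
Qed.

Lemma prob_fin A : measurable A -> m A \is a fin_num.
Proof. exact: fin_num_measure. Qed.

Lemma Rintegral_bool D (P : T -> bool) a : measurable D ->
  measurable [set x | P x] ->
  \int[m]_(x in D) (a * (P x)%:R) = a * fine (m (D `&` [set x | P x])).
Proof.
move=> mD mP; have E x : (P x)%:R = \1_[set x | P x] x :> R.
  by rewrite indicE; case: (boolP (P x)) => h; [rewrite mem_set|rewrite memNset//; exact/negP].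
under eq_Rintegral do rewrite E.
rewrite RintegralZl//; last first.
  apply: integrable_bounded => //.
  by exists 1 => x _; rewrite indicE; case: (_ \in _); rewrite ?normr1 ?normr0.
by rewrite /Rintegral integral_indic// setIC.
Qed.

Lemma Rintegral_bounded_cvg D (f_ : nat -> T -> R) f b : measurable D ->
  (forall n, measurable_fun D (f_ n)) -> measurable_fun D f ->
  (forall n x, D x -> `|f_ n x| <= b) ->
  (forall x, D x -> f_ n x @[n --> \oo] --> f x) ->
  \int[m]_(x in D) f_ n x @[n --> \oo] --> \int[m]_(x in D) f x.
Proof.
move=> mD mf_ mf fb ff.
(* The bound constrains [f_] only on [D], so it can be negative when [D] is empty. *)
have [b0|b0] := leP 0 b; last first.
  suff -> : D = set0 by under eq_fun do rewrite Rintegral_set0;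
    rewrite Rintegral_set0; exact: cvg_cst.
  apply/seteqP; split=> // x Dx; have := le_lt_trans (fb 0%N x Dx) b0.
  by rewrite normr_lt0.
have fbd x : D x -> `|f x| <= b.
  move=> Dx; apply: (@cvgr_to_le _ _ _ _ (fun n => `|f_ n x|) _ _ (cvg_norm (ff x Dx))).
  by apply: nearW => n; exact: fb.
have H : (\int[m]_(x in D) (f_ n x)%:E)%E @[n --> \oo] --> (\int[m]_(x in D) (f x)%:E)%E.
  refine (@dominated_cvg _ _ _ m D mD (fun n => EFin \o f_ n) (EFin \o f)
    (cst b%:E) _ _ _ _ _) => //.
  - by move=> n; apply/measurable_EFinP.
  - by move=> x Dx; apply/fine_cvgP; split; [exact: nearW|exact: ff].
  - apply: (integrable_bounded mD (f := cst b)) => //.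
    by exists b => x _ /=; rewrite ger0_norm.
have E : (\int[m]_(x in D) (f x)%:E)%E = (\int[m]_(x in D) f x)%:E.
  rewrite /Rintegral fineK//; apply: integrable_fin_num => //.
  by apply: integrable_bounded => //; exists b.
by rewrite E in H; exact: (fine_cvg H).
Qed.

Lemma le_Rintegral_norm D f b : measurable D -> measurable_fun D f ->
  (forall x, D x -> `|f x| <= b) -> `|\int[m]_(x in D) f x| <= b * fine (m D).
Proof.
move=> mD mf fb; rewrite -Rintegral_cst//.
apply: le_trans (le_normr_Rintegral mD _) _.
  by apply: integrable_bounded => //; exists b.
apply: le_Rintegral => //.
- apply: integrable_bounded => //; first exact: measurableT_comp.
  by exists b => x Dx; rewrite normr_id fb.
- by apply: integrable_bounded => //; exists `|b|.
Qed.

End bounded_integration.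

Section cylindric_integration.
Context {R : realType} d (T : measurableType d) (m : probability T R).
Implicit Types (D : set T) (X : T -> cantor_space) (g : cantor_space -> R).

Lemma cylf_bounded g : cylf g -> exists2 b, 0 <= b & forall x, `|g x| <= b.
Proof. by move=> [n] /level_bounded. Qed.

Lemma integrable_cylf D X g : measurable D -> measurable_fun setT X -> cylf g ->
  m.-integrable D (EFin \o (g \o X)).
Proof.
move=> mD mX cg; apply: integrable_bounded => //.
  apply: measurable_funTS; apply: measurableT_comp mX; exact: cylf_measurable.
by have [b _ gb] := cylf_bounded cg; exists b => x _; exact: gb.
Qed.

Lemma measurable_bits (c : seq (nat * bool)) :
  measurable [set x : cantor_space | bits c x].
Proof.
by have [n ln] := cylf_bits c; apply: (@level_measurable n) => x y xy /=; rewrite (ln x y xy).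
Qed.

Lemma measurable_bits_comp X (c : seq (nat * bool)) : measurable_fun setT X ->
  measurable [set x | bits c (X x)].
Proof.
by move=> mX; have := mX measurableT _ (measurable_bits c); rewrite setTI.
Qed.

Lemma cylf_RintegralD D X f g : measurable D -> measurable_fun setT X ->
  cylf f -> cylf g ->
  \int[m]_(x in D) (f (X x) + g (X x)) =
  \int[m]_(x in D) f (X x) + \int[m]_(x in D) g (X x).
Proof. by move=> mD mX cf cg; apply: RintegralD => //; exact: integrable_cylf. Qed.

Lemma Rintegral_bits D X a (c : seq (nat * bool)) : measurable D -> measurable_fun setT X ->
  \int[m]_(x in D) (a * (bits c (X x))%:R) = a * fine (m (D `&` [set x | bits c (X x)])).
Proof. by move=> mD mX; apply: Rintegral_bool => //; exact: measurable_bits_comp. Qed.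

End cylindric_integration.

(** * Finite-dimensional distributions *)

Section finite_dimensional.
Context {R : realType} (gamma theta : {nonneg R}).
Local Notation U := (chain_op gamma theta).
Implicit Types (F : R -> cantor_space -> R) (s : seq R) (n : nat) (t : R).

(* [fidi n t s F x] is the expectation of the product of the [F r (X r)] over
   the times [r] in [s], for the chain of level [n] started at time [t] in [x]. *)
Fixpoint fidi n t s F : cantor_space -> R :=
  if s is r :: s' then U n (r - t) (fun y => F r y * fidi n r s' F y)
  else fun=> 1.

Lemma level_fidi n t s F : (forall r, level n (F r)) -> level n (fidi n t s F).
Proof.
move=> lF; elim: s t => [//|r s IH] t /=; apply: level_chain_op => //.
by apply: (@level_comp2 _ _ _ _ *%R) => //; exact: IH.
Qed.

Lemma eq_fidi n t s F F' : {in s, F =1 F'} -> fidi n t s F = fidi n t s F'.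
Proof.
elim: s t => [//|r s IH] t FF' /=; rewrite IH; last first.
  by move=> u us; apply: FF'; rewrite inE us orbT.
by rewrite FF' ?inE ?eqxx.
Qed.

Lemma fidi_le m n t s F : (m <= n)%N -> (forall r, level m (F r)) ->
  fidi n t s F = fidi m t s F.
Proof.
move=> mn lF; elim: s t => [//|r s IH] t /=; rewrite IH; apply: chain_op_le => //.
by apply: (@level_comp2 _ _ _ _ *%R) => //; exact: level_fidi.
Qed.

Lemma fidi_ge0 n t s F x : (forall r, level n (F r)) -> (forall r y, 0 <= F r y) ->
  path <=%R t s -> 0 <= fidi n t s F x.
Proof.
move=> lF F0; elim: s t x => [//|r s IH] t x /= /andP[tr rs].
apply: chain_op_ge0 => [||y]; first by rewrite subr_ge0.
  by apply: (@level_comp2 _ _ _ _ *%R) => //; exact: level_fidi.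
by rewrite mulr_ge0// IH.
Qed.

Lemma fidi_shift n t r s F : (forall u, level n (F u)) ->
  U n (r - t) (fidi n r s F) = fidi n t s F.
Proof.
case: s => [|u s] lF /=; first by rewrite chain_op_cst.
have lf : level n (fun y => F u y * fidi n u s F y).
  by apply: (@level_comp2 _ _ _ _ *%R) => //; exact: level_fidi.
by rewrite -(chain_opD gamma theta _ _ lf) addrC subrKA.
Qed.

(** A time with trivial factor is removed by the semigroup law. This is the consistency of the
    finite-dimensional distributions. *)
Lemma fidi_filter n t s F (p : pred R) : (forall u, level n (F u)) ->
  {in s, forall r, ~~ p r -> F r = fun=> 1} ->
  fidi n t (seq.filter p s) F = fidi n t s F.
Proof.
move=> lF; elim: s t => [//|r s IH] t F1 /=.
have F1' : {in s, forall u, ~~ p u -> F u = fun=> 1}.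
  by move=> u us; apply: F1; rewrite inE us orbT.
case: ifPn => [pr|npr] /=; rewrite IH//.
rewrite (F1 r)// ?inE ?eqxx//.
under eq_fun do rewrite mul1r.
by rewrite fidi_shift.
Qed.

Lemma fidi_zero n t s F r : r \in s -> F r = (fun=> 0) -> fidi n t s F = fun=> 0.
Proof.
move=> + F0; elim: s t => [//|u s IH] t; rewrite inE => /orP[/eqP <-|rs] /=.
  by rewrite F0; under eq_fun do rewrite mul0r; rewrite chain_op_cst.
by rewrite IH//; under eq_fun do rewrite mulr0; rewrite chain_op_cst.
Qed.

(** The product is affine in the factor at a single time, which requires that the time occur only
    once. *)
Lemma fidi_lin n t s F F0 F1 r e : uniq s -> r \in s ->
  (forall y, F r y = e * F0 r y + F1 r y) ->
  {in s, forall u, u != r -> F0 u = F u /\ F1 u = F u} ->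
  fidi n t s F = fun x => e * fidi n t s F0 x + fidi n t s F1 x.
Proof.
move=> + + Fr; elim: s t => [//|u s IH] t /= /andP[us uqs].
rewrite inE => /orP[/eqP ru|rs] Fs; rewrite -chain_op_lin.
  rewrite -ru in us *.
  have Es b : fidi n r s (if b then F0 else F1) = fidi n r s F.
    apply: eq_fidi => v vs; have vr : v != r by apply: contraNneq us => <-.
    by have := Fs v; rewrite inE vs orbT => /(_ isT vr)[h0 h1]; case: b.
  have /= -> := Es true; have /= -> := Es false.
  by congr chain_op; apply/funext => y; rewrite Fr mulrDl mulrA.
have ur : u != r by apply: contraNneq us => ->.
have [-> ->] := Fs u (mem_head _ _) ur.
rewrite (IH u)//; last by move=> v vs; apply: Fs; rewrite inE vs orbT.
by congr chain_op; apply/funext => y; rewrite mulrDr mulrCA.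
Qed.

(** Integrating out the last time moves its factor to the time before: the Markov property at the
    level of finite-dimensional distributions. *)
Lemma fidi_last n t s F F' r r' : (forall u, level n (F u)) ->
  {in s, forall u, F' u = F u} ->
  (forall y, F' r y = F r y * U n (r' - r) (F r') y) ->
  fidi n t (s ++ [:: r; r']) F = fidi n t (s ++ [:: r]) F'.
Proof.
move=> lF + Fr; elim: s t => [|u s IH] t /= FF'.
  congr chain_op; apply/funext => y; rewrite Fr mulr1; congr (_ * _).
  by under eq_fun do rewrite mulr1.
rewrite FF' ?inE ?eqxx// IH// => v vs.
by apply: FF'; rewrite inE vs orbT.
Qed.

End finite_dimensional.

(** * The law of the chain at rational times *)

Section rational_times.
Context {R : realType} (gamma theta : {nonneg R}) (x0 : cantor_space).
Local Notation U := (chain_op gamma theta).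
Local Notation fidi := (fidi gamma theta).
Implicit Types (c : seq (rat * nat * bool)) (n : nat) (t : R).

(* Negative rationals duplicate the positive ones, so that every rational is a
   valid index. *)
Definition rtime (a : rat) : R := `|ratr a|.

(** Constraints attached to other times hold vacuously, so the product of these indicators over all
    times expresses the whole list [c]. *)
Definition at_time c t (y : cantor_space) : bool :=
  all (fun p => (rtime p.1.1 == t) ==> (y p.1.2 == p.2)) c.

Definition at_timeR c t y : R := (at_time c t y)%:R.

Definition ctimes c := sort <=%R (undup [seq rtime p.1.1 | p <- c]).

Definition clevel c := (\max_(p <- c) p.1.2.+1)%N.

Definition cprob c : R := fidi (clevel c) 0 (ctimes c) (at_timeR c) x0.

Lemma level_at_time c t : level (clevel c) (at_timeR c t).
Proof.
move=> y z yz; rewrite /at_timeR; congr (_%:R); congr nat_of_bool.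
apply: eq_in_all => p pc; rewrite yz//.
exact: (@leq_bigmax_seq _ c xpredT (fun p : rat * nat * bool => p.1.2.+1) p pc).
Qed.

Lemma at_time_ge0 c t y : 0 <= at_timeR c t y.
Proof. exact: ler0n. Qed.

Lemma at_time1 c t : t \notin [seq rtime p.1.1 | p <- c] -> at_timeR c t = fun=> 1.
Proof.
move=> tc; apply/funext => y; rewrite /at_timeR /at_time.
rewrite (_ : all _ _ = true)//; apply/allP => p pc; apply/implyP => /eqP pt.
by move/negP: tc; case; rewrite -pt; exact: (map_f (fun p => rtime p.1.1) pc).
Qed.

Lemma mem_ctimes c t : (t \in ctimes c) = (t \in [seq rtime p.1.1 | p <- c]).
Proof. by rewrite mem_sort mem_undup. Qed.

Lemma sorted_ctimes c : sorted <%R (ctimes c).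
Proof. by rewrite sort_lt_sorted undup_uniq. Qed.

Lemma ctimes_ge0 c : path <=%R 0 (ctimes c).
Proof.
rewrite path_sortedE; last exact: le_trans.
apply/andP; split; last by rewrite sort_le_sorted.
by apply/allP => t; rewrite mem_ctimes => /mapP[p _ ->]; exact: normr_ge0.
Qed.

Lemma cprobE n s c : (forall t, level n (at_timeR c t)) -> sorted <%R s ->
  {subset [seq rtime p.1.1 | p <- c] <= s} ->
  fidi n 0 s (at_timeR c) x0 = cprob c.
Proof.
move=> ln ss cs.
rewrite -(@fidi_le _ _ _ n (maxn n (clevel c)))//; last exact: leq_maxl.
rewrite (@fidi_le _ _ _ (clevel c))//; [|exact: leq_maxr|exact: level_at_time].
rewrite -(@fidi_filter _ _ _ _ _ _ _ (mem [seq rtime p.1.1 | p <- c])).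
- rewrite /cprob; congr (fidi _ _ _ _ _); apply: lt_sorted_eq.
  + exact: lt_sorted_filter.
  + exact: sorted_ctimes.
  + by move=> t; rewrite mem_filter mem_ctimes andb_idr//; exact: cs.
- by move=> u; exact: level_at_time.
- by move=> t ts /= /at_time1.
Qed.

Lemma cprob_ge0 c : 0 <= cprob c.
Proof.
apply: fidi_ge0; [exact: level_at_time|exact: at_time_ge0|exact: ctimes_ge0].
Qed.

Lemma cprob_nil : cprob [::] = 1.
Proof. by []. Qed.

Lemma cprob_perm c d : perm_eq c d -> cprob c = cprob d.
Proof.
move=> cd; have E : at_timeR c = at_timeR d.
  by apply/funext => t; apply/funext => y; rewrite /at_timeR /at_time (perm_all _ cd).
rewrite -(@cprobE (clevel d) (ctimes d) c).
- by rewrite /cprob E.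
- by move=> t; rewrite E; exact: level_at_time.
- exact: sorted_ctimes.
- by move=> t; rewrite mem_ctimes (perm_mem (perm_map _ cd)).
Qed.

Lemma cprob_cons i c : cprob ((i, false) :: c) + cprob ((i, true) :: c) = cprob c.
Proof.
pose n := clevel ((i, false) :: c); pose s := ctimes ((i, false) :: c).
have En b : clevel ((i, b) :: c) = n by rewrite /n /clevel !big_cons.
have Es b : ctimes ((i, b) :: c) = s by [].
rewrite -(@cprobE n s c); last 3 first.
- by move=> t; apply: levelW (@level_at_time c t); rewrite /n /clevel big_cons leq_maxr.
- exact: sorted_ctimes.
- by move=> t tc; rewrite mem_ctimes inE tc orbT.
rewrite /cprob !En !Es.
rewrite (@fidi_lin _ _ _ _ _ _ (at_timeR c) (at_timeR ((i, false) :: c))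
  (at_timeR ((i, true) :: c)) (rtime i.1) 1) ?mul1r//.
- by rewrite (lt_sorted_uniq (sorted_ctimes _)).
- by rewrite mem_ctimes inE eqxx.
- move=> y; rewrite /at_timeR /at_time /= eqxx /=.
  by case: (y i.2); rewrite /= ?mul1r ?add0r ?addr0.
- by move=> u _ ui; rewrite /at_timeR /at_time /= eq_sym (negbTE ui).
Qed.

Lemma cprob_conflict i c : cprob ((i, false) :: (i, true) :: c) = 0.
Proof.
rewrite /cprob (@fidi_zero _ _ _ _ _ _ _ (rtime i.1))//.
  by rewrite mem_ctimes inE eqxx.
apply/funext => y; rewrite /at_timeR /at_time /= eqxx /=.
by case: (y i.2).
Qed.

End rational_times.

(* A point of the Cantor space encodes the values at all rational times. *)
Definition rat_value (z : cantor_space) (a : rat) : cantor_space :=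
  fun k => z (pickle (a, k)).

Definition rat_bit (z : cantor_space) (i : rat * nat) : bool :=
  rat_value z i.1 i.2.

Lemma measurable_rat_value a :
  measurable_fun setT (fun z => rat_value z a).
Proof.
apply: measurable_fun_cantor => k.
by apply: (@level_measurable (pickle (a, k)).+1) => x y xy /=; rewrite /rat_value xy.
Qed.

Lemma measurable_rat_bits (c : seq (rat * nat * bool)) :
  measurable [set z | bits c (rat_bit z)].
Proof.
elim: c => [|[[a k] b] c IH].
  by rewrite bits_nil.
rewrite (_ : [set _ | _] = [set z | bits [:: (k, b)] (rat_value z a)] `&`
  [set z | bits c (rat_bit z)]).
  by apply: measurableI => //; apply: measurable_bits_comp; exact: measurable_rat_value.
apply/seteqP; split=> z; rewrite /bits /= andbT; first by move=> /andP.
by move=> [? ?]; apply/andP.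
Qed.

Section rational_law.
Context {R : realType} (gamma theta : {nonneg R}) (x0 : cantor_space).
Local Notation U := (chain_op gamma theta).
Local Notation fidi := (fidi gamma theta).
Local Notation cprob := (cprob gamma theta x0).
Implicit Types (c : seq (rat * nat * bool)) (n : nat) (t : R).

Lemma rational_law : exists m : probability cantor_space R,
  forall c, m [set z | bits c (rat_bit z)] = (cprob c)%:E.
Proof.
have [m mE] := @kolmogorov R (rat * nat)%type (0, 0%N) cprob
  (cprob_ge0 _ _ _) (cprob_nil _ _ _) (@cprob_perm _ _ _ _)
  (@cprob_cons _ _ _ _) (@cprob_conflict _ _ _ _).
by exists m => c; rewrite -mE; congr (m _).
Qed.

Variable m : probability cantor_space R.
Hypothesis mE : forall c, m [set z | bits c (rat_bit z)] = (cprob c)%:E.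

Lemma Rintegral_fidi c (g : cantor_space -> R) (a : rat) n s :
  level n g -> (forall t, level n (at_timeR c t)) -> sorted <%R s ->
  {subset rtime a :: [seq rtime p.1.1 | p <- c] <= s} ->
  \int[m]_(z in [set z | bits c (rat_bit z)]) g (rat_value z a) =
  fidi n 0 s (fun t y => at_timeR c t y * (if t == rtime a then g y else 1)) x0.
Proof.
move=> lg lc ss cs.
set D := [set z | _]; have mD : measurable D by exact: measurable_rat_bits.
have mX := @measurable_rat_value a.
pose F f (t : R) y : R := at_timeR c t y * (if t == rtime a then f y else 1).
have level_F k f t : level k f -> (forall t, level k (at_timeR c t)) -> level k (F f t).
  by move=> lf l x y xy; rewrite /F (l t x y xy) (lf x y xy).
have as_ : rtime a \in s by apply: cs; rewrite inE eqxx.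
(* The decomposition of [g] into indicators does not bound their level, so the identity is proved at
   all large levels and then brought down to [n]. *)
suff [N HN] : exists N, forall k, (N <= k)%N ->
    \int[m]_(z in D) g (rat_value z a) = fidi k 0 s (F g) x0.
  rewrite (HN (maxn N n) (leq_maxl _ _)).
  by rewrite (@fidi_le _ _ _ n)// ?leq_maxr// => t; exact: level_F.
have cg : cylf g by exists n.
apply: (@level_lin R (fun g => exists N, forall k, (N <= k)%N ->
    \int[m]_(z in D) g (rat_value z a) = fidi k 0 s (F g) x0)) cg.
  move=> e d; pose dd := [seq ((a, p.1), p.2) | p <- d].
  have cdE : D `&` [set z | bits d (rat_value z a)] =
      [set z | bits (dd ++ c) (rat_bit z)].
    apply/seteqP; split=> z; rewrite /D /= bits_cat /bits /dd all_map.
      by move=> [h1 h2]; apply/andP.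
    by move=> /andP[h1 h2].
  exists (clevel (dd ++ c)) => k Nk; rewrite Rintegral_bits// cdE mE /=.
  have lev t : level k (at_timeR (dd ++ c) t) by exact: (levelW Nk (@level_at_time R _ t)).
  rewrite -(@cprobE _ _ _ _ k s)//; last first.
    move=> t; rewrite map_cat mem_cat => /orP[|tc]; last by apply: cs; rewrite inE tc orbT.
    by move=> /mapP[_ /mapP[p _ ->] ->]; exact: as_.
  have atdd t y : at_timeR (dd ++ c) t y =
      at_timeR c t y * (if t == rtime a then (bits d y)%:R else 1).
    rewrite /at_timeR /at_time all_cat -mulnb natrM mulrC /dd all_map.
    congr (_ * _); have [->|ta] := eqVneq t (rtime a).
      by congr ((nat_of_bool _)%:R); apply: eq_all => p /=; rewrite eqxx.
    by rewrite (_ : all _ _ = true)//; apply/allP => p _ /=; rewrite eq_sym (negbTE ta).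
  rewrite (@fidi_lin _ _ _ k 0 s (F _) (at_timeR (dd ++ c)) (fun t y =>
      if t == rtime a then 0 else at_timeR (dd ++ c) t y) (rtime a) e)//.
  - rewrite (@fidi_zero _ _ _ _ _ _ (fun t y => if _ then 0 else _) (rtime a))//.
      by rewrite addr0.
    by apply/funext => y; rewrite eqxx.
  - by rewrite (lt_sorted_uniq ss).
  - by move=> y; rewrite /F eqxx atdd eqxx; ring.
  - move=> u us ua; split; apply/funext => y.
      by rewrite /F atdd (negbTE ua).
    by rewrite (negbTE ua) /F atdd (negbTE ua).
move=> f h cf ch [N1 H1] [N2 H2]; exists (maxn N1 N2) => k Nk.
rewrite cylf_RintegralD// (H1 k) ?(leq_trans (leq_maxl _ _) Nk)//.
rewrite (H2 k) ?(leq_trans (leq_maxr _ _) Nk)//.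
rewrite (@fidi_lin _ _ _ k 0 s (F (fun x => f x + h x)) (F f) (F h) (rtime a) 1) ?mul1r//.
- by rewrite (lt_sorted_uniq ss).
- by move=> y; rewrite /F eqxx; ring.
- by move=> u us ua; split; apply/funext => y; rewrite /F (negbTE ua).
Qed.

Lemma rational_markov c (g : cantor_space -> R) (a a' : rat) n :
  level n g -> rtime a <= rtime a' :> R ->
  (forall p, p \in c -> rtime p.1.1 <= rtime a :> R) ->
  \int[m]_(z in [set z | bits c (rat_bit z)]) g (rat_value z a') =
  \int[m]_(z in [set z | bits c (rat_bit z)])
    U n (rtime a' - rtime a) g (rat_value z a).
Proof.
move=> lg aa' ca.
pose N := maxn n (clevel c).
have lc t : level N (at_timeR c t) by apply: levelW (@level_at_time R c t); exact: leq_maxr.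
have lgN : level N g by apply: levelW lg; exact: leq_maxl.
have lUN : level N (U n (rtime a' - rtime a) g).
  by apply: levelW (level_chain_op gamma theta _ (leqnn n) lg); exact: leq_maxl.
(* The grids used are [s0] followed by the time of [a], and then by that of [a']. The time of [a] is
   appended separately because [c] need not mention it. *)
pose s0 := seq.filter (fun t => t < rtime a) (ctimes c).
have s0l l : sorted <%R (rtime a :: l) -> sorted <%R (s0 ++ rtime a :: l).
  have lt_tr : transitive (<%R : rel R) by exact: lt_trans.
  move=> sl; rewrite (sorted_pairwise lt_tr) pairwise_cat; apply/and3P; split.
  - apply/allrelP => u v; rewrite mem_filter => /andP[ua _].
    move: sl; rewrite /= (path_sortedE lt_tr) => /andP[/allP al _].
    by rewrite inE => /orP[/eqP ->//|/al]; exact: lt_trans.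
  - by rewrite -(sorted_pairwise lt_tr) lt_sorted_filter// sorted_ctimes.
  - by rewrite -(sorted_pairwise lt_tr).
have s0a : sorted <%R (s0 ++ [:: rtime a]) by exact: s0l.
have cs0 : {subset rtime a :: [seq rtime p.1.1 | p <- c] <= s0 ++ [:: rtime a]}.
  move=> t; rewrite inE mem_cat mem_seq1 => /orP[->|tc]; first by rewrite orbT.
  rewrite mem_filter mem_ctimes tc andbT orbC -le_eqVlt.
  by case/mapP: tc => p pc ->; exact: ca.
(* Grids are strictly increasing, so two distinct rationals with the same time form a separate
   case. *)
move: aa'; rewrite le_eqVlt => /orP[/eqP aa'|aa'].
  rewrite -aa' subrr chain_op0 (@Rintegral_fidi _ _ _ N (s0 ++ [:: rtime a]))//.
    by rewrite (@Rintegral_fidi _ _ _ N (s0 ++ [:: rtime a]))// aa'.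
  by rewrite -aa'.
rewrite (@Rintegral_fidi _ _ _ N (s0 ++ [:: rtime a]) lUN)//.
rewrite (@Rintegral_fidi _ _ _ N (s0 ++ [:: rtime a; rtime a']) lgN)//; last 2 first.
- by apply: s0l; rewrite /= aa'.
- move=> t; rewrite inE => /orP[/eqP ->|tc]; first by rewrite mem_cat !inE eqxx !orbT.
  have := cs0 t; rewrite inE tc orbT => /(_ isT).
  by rewrite !mem_cat !inE orbA => ->.
congr (_ x0); apply: fidi_last => [u|u|y].
- by move=> x y xy; rewrite (lc u x y xy) (lgN x y xy).
- rewrite mem_filter => /andP[ua _]; apply/funext => y.
  by rewrite !lt_eqF// (lt_trans ua).
- rewrite eqxx (lt_eqF aa') mulr1 eqxx; congr (_ * _).
  rewrite -(@chain_op_le _ _ _ n N)//; last exact: leq_maxl.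
  congr (chain_op _ _ _ _ _ y); apply/funext => z.
  rewrite at_time1 ?mul1r//; apply/negP => /mapP[p pc pa].
  by have := ca _ pc; rewrite -pa leNgt aa'.
Qed.

End rational_law.

(** * Regularization of the process on dyadic times *)

Section dyadic_variation.
Implicit Types (f : rat -> bool) (m i j n : nat).

Definition dyadic m i : rat := i%:R / 2 ^+ m.

Definition changes f m n : nat :=
  \sum_(0 <= i < n) (f (dyadic m i) != f (dyadic m i.+1)).

Definition bounded_changes f :=
  forall T, exists K, forall m, (changes f m (T * 2 ^ m) <= K)%N.

Lemma dyadic_refine m i j : dyadic (m + j) (i * 2 ^ j) = dyadic m i.
Proof.
by rewrite /dyadic natrM natrX exprD -mulf_div divff ?mulr1// expf_neq0.
Qed.

Lemma dyadicS m i : dyadic m.+1 (2 * i) = dyadic m i.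
Proof. by rewrite -addn1 mulnC -[X in (i * X)%N]expn1 dyadic_refine. Qed.

Lemma changes_refine1 f m n : (changes f m n <= changes f m.+1 (2 * n))%N.
Proof.
rewrite /changes; elim: n => [|n IH]; first by rewrite big_geq.
have E : (2 * n.+1 = (2 * n).+2)%N by rewrite mulnS.
rewrite E !big_nat_recr//= -addnA leq_add//.
rewrite -[dyadic m n]dyadicS -[dyadic m n.+1]dyadicS E.
by case: (f _); case: (f _); case: (f _).
Qed.

Lemma changes_refine f m n j : (changes f m n <= changes f (m + j) (n * 2 ^ j))%N.
Proof.
elim: j => [|j IH]; first by rewrite addn0 muln1.
by apply: leq_trans IH _; rewrite addnS expnS mulnCA; exact: changes_refine1.
Qed.

Lemma changes_leq f m n n' : (n <= n')%N -> (changes f m n <= changes f m n')%N.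
Proof. by move=> nn'; rewrite /changes [leqRHS](big_cat_nat (leq0n _) nn')//= leq_addr. Qed.

Lemma changes_jump f m n n' : (n <= n')%N ->
  (changes f m n + (f (dyadic m n) != f (dyadic m n')) <= changes f m n')%N.
Proof.
move=> nn'; rewrite -(subnKC nn'); elim: (n' - n)%N => [|j IH].
  by rewrite addn0 eqxx addn0.
rewrite addnS {2}/changes big_nat_recr//=.
apply: leq_trans (leq_add IH (leqnn _)); rewrite -/(changes _ _ _) -addnA leq_add2l.
by case: (f _); case: (f _); case: (f _).
Qed.

Variables (f : rat -> bool) (bf : bounded_changes f).

Lemma variation_exists (p : nat * nat) :
  exists K, `[< forall j, (changes f (p.1 + j) (p.2 * 2 ^ j) <= K)%N >].
Proof.
have [K HK] := bf p.2; exists K; apply/asboolP => j.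
apply: leq_trans (HK (p.1 + j)%N); apply: changes_leq.
by rewrite leq_mul2l leq_exp2l// leq_addl orbT.
Qed.

(** The number of changes up to the dyadic time [p], as a supremum over all finer grids. It is an
    integer, grows with time, and rises at every change of value; this forces one-sided limits. *)
Definition variation (p : nat * nat) := ex_minn (variation_exists p).

Lemma variationP p j : (changes f (p.1 + j) (p.2 * 2 ^ j) <= variation p)%N.
Proof. by rewrite /variation; case: ex_minnP => K /asboolP. Qed.

Lemma variation_attained p :
  exists j, (variation p <= changes f (p.1 + j) (p.2 * 2 ^ j))%N.
Proof.
rewrite /variation; case: ex_minnP => K /asboolP HK minK.
apply: contrapT => /forallNP H; case: K => [|K] in HK minK H *.
  by case: (H 0%N).
have /minK : `[< forall j, (changes f (p.1 + j) (p.2 * 2 ^ j) <= K)%N >].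
  by apply/asboolP => j; rewrite leqNgt; apply/negP => /H.
by rewrite ltnn.
Qed.

Lemma variation_jump p q : (dyadic p.1 p.2 <= dyadic q.1 q.2) ->
  (variation p + (f (dyadic p.1 p.2) != f (dyadic q.1 q.2)) <= variation q)%N.
Proof.
move=> pq; have [j Hj] := variation_attained p.
apply: leq_trans (variationP q (p.1 + j)).
(* The comparison takes place on a grid finer both than that of [q] and than the one on which [p]
   attains its variation. *)
have E : (q.1 + (p.1 + j) = p.1 + j + q.1)%N by rewrite addnC.
have L : (p.2 * 2 ^ (j + q.1) <= q.2 * 2 ^ (p.1 + j))%N.
  move: pq; rewrite /dyadic ler_pdivrMr ?exprn_gt0// mulrAC ler_pdivlMr ?exprn_gt0//.
  rewrite -!natrX -!natrM ler_nat => pq.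
  by rewrite !expnD [(2 ^ j * _)%N]mulnC !mulnA leq_mul2r pq orbT.
rewrite E; apply: leq_trans (changes_jump f (p.1 + j + q.1) L).
rewrite -addnA dyadic_refine addnA -E dyadic_refine leq_add2r.
apply: leq_trans Hj _; rewrite E expnD mulnA; exact: changes_refine.
Qed.

End dyadic_variation.

(** * One-sided limits along dyadic times *)

Section dyadic_limits.
Context {R : realType}.
Implicit Types (f : rat -> bool) (m i n : nat) (t : R) (p : nat * nat).

Definition dtime p : R := rtime (dyadic p.1 p.2).

Lemma dtimeE p : dtime p = p.2%:R / 2 ^+ p.1.
Proof.
by rewrite /dtime /rtime /dyadic fmorph_div rmorphXn /= !ratr_nat ger0_norm// divr_ge0// exprn_ge0.
Qed.

Lemma dtime_le p q : dtime p <= dtime q -> dyadic p.1 p.2 <= dyadic q.1 q.2.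
Proof.
have d0 r : 0 <= dyadic r.1 r.2 by rewrite divr_ge0// exprn_ge0.
by rewrite /dtime /rtime !ger0_norm ?ler0q// ler_rat.
Qed.

(** The successor makes the grid point strictly later than [t] even when [t] is dyadic, so that
    limits along it are right limits. *)
Definition approx t m : nat * nat := (m, (Num.truncn (t * 2 ^+ m)).+1).

Lemma approx_gt t m : 0 <= t -> t < dtime (approx t m) <= t + 2 ^- m.
Proof.
move=> t0; rewrite dtimeE /=.
have /andP[h1 h2] : (Num.truncn (t * 2 ^+ m))%:R <= t * 2 ^+ m <
    (Num.truncn (t * 2 ^+ m)).+1%:R.
  by apply: truncn_itv; rewrite mulr_ge0// exprn_ge0.
rewrite ltr_pdivlMr ?exprn_gt0// h2 /= ler_pdivrMr ?exprn_gt0//.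
by rewrite mulrDl mulVf ?expf_neq0// -natr1 lerD2r.
Qed.

Lemma approx_mono s t m : 0 <= s -> s <= t -> dtime (approx s m) <= dtime (approx t m).
Proof.
move=> s0 st; rewrite !dtimeE /= ler_pM2r ?invr_gt0 ?exprn_gt0// ler_nat ltnS.
by apply: le_truncn; rewrite ler_pM2r// exprn_gt0.
Qed.

Lemma exp2N_lt (e : R) : 0 < e -> exists M, forall m, (M <= m)%N -> 2 ^- m < e.
Proof.
move=> e0; exists (Num.truncn e^-1).+1 => m Mm.
have h : e^-1 < m%:R.
  apply: lt_le_trans (_ : (Num.truncn e^-1).+1%:R <= _); last by rewrite ler_nat.
  have i0 : 0 <= e^-1 by rewrite invr_ge0 ltW.
  by have /andP[] := truncn_itv i0.
rewrite -[e]invrK ltf_pV2 ?posrE ?invr_gt0 ?exprn_gt0//.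
by apply: lt_trans h _; rewrite -natrX ltr_nat ltn_expl.
Qed.

Lemma approx_cvg t : 0 <= t -> dtime (approx t m) @[m --> \oo] --> t.
Proof.
move=> t0; apply/cvgrPdist_lt => e e0; have [M HM] := exp2N_lt e0.
exists M => // m /HM h /=; have /andP[h1 h2] := approx_gt m t0.
rewrite ltr_distlC (lt_le_trans _ (ltW h1)) /=; last by rewrite ltrBlDr ltrDl.
by apply: le_lt_trans h2 _; rewrite ltrD2l.
Qed.

Section one_path.
Variables (f : rat -> bool) (bf : bounded_changes f).

(** Take a dyadic time after [t] of least variation. An earlier one still after [t] cannot have
    less, so by [variation_jump] no change separates the two. *)
Lemma right_dyadic t : 0 <= t -> exists d b, t < d /\
  forall p, t < dtime p < d -> f (dyadic p.1 p.2) = b.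
Proof.
move=> t0; have ex : exists n, `[< exists p, t < dtime p /\ variation bf p = n >].
  exists (variation bf (approx t 0)); apply/asboolP; exists (approx t 0).
  by have /andP[] := approx_gt 0 t0.
case: (ex_minnP ex) => n /asboolP[p [tp pn]] minn.
exists (dtime p), (f (dyadic p.1 p.2)); split=> // q /andP[tq qp].
have /minn : `[< exists p, t < dtime p /\ variation bf p = variation bf q >].
  by apply/asboolP; exists q.
have := variation_jump bf (dtime_le (ltW qp)).
by case: eqVneq => //= _; rewrite addn1 pn => h1 h2; have := leq_trans h1 h2; rewrite ltnn.
Qed.

(** Dually, take a dyadic time before [t] of greatest variation, which exists because the variation
    at a later time is a bound. *)
Lemma left_dyadic t : 0 < t -> exists d b, d < t /\
  forall p, d < dtime p < t -> f (dyadic p.1 p.2) = b.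
Proof.
move=> t0; have ex : exists n, `[< exists p, dtime p < t /\ variation bf p = n >].
  exists (variation bf (0, 0)%N); apply/asboolP; exists (0, 0)%N.
  by rewrite dtimeE mul0r.
have ub n : `[< exists p, dtime p < t /\ variation bf p = n >] ->
    (n <= variation bf (approx t 0))%N.
  move=> /asboolP[p [pt <-]]; have /andP[tq _] := approx_gt 0 (ltW t0).
  have := variation_jump bf (dtime_le (ltW (lt_trans pt tq))).
  exact: leq_trans (leq_addr _ _).
case: (ex_maxnP ex ub) => n /asboolP[p [tp pn]] maxn.
exists (dtime p), (f (dyadic p.1 p.2)); split=> // q /andP[pq qt].
have /maxn : `[< exists p, dtime p < t /\ variation bf p = variation bf q >].
  by apply/asboolP; exists q.
have := variation_jump bf (dtime_le (ltW pq)).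
case: eqVneq => [->//|_]; rewrite addn1 pn => h1 h2.
by have := leq_trans h1 h2; rewrite ltnn.
Qed.

End one_path.

Definition rlimit f t : bool :=
  `[< exists M, forall m, (M <= m)%N -> f (dyadic (approx t m).1 (approx t m).2) = true >].

Lemma rlimit_eq f (u v : R) b t : 0 <= t ->
  (forall p, u < dtime p < v -> f (dyadic p.1 p.2) = b) -> u <= t < v ->
  exists M, forall m, (M <= m)%N ->
    f (dyadic (approx t m).1 (approx t m).2) = b /\ rlimit f t = b.
Proof.
move=> t0 fb /andP[ut tv]; have vt : 0 < v - t by rewrite subr_gt0.
have [M HM] := exp2N_lt vt.
have H m : (M <= m)%N -> f (dyadic (approx t m).1 (approx t m).2) = b.
  move=> /HM h; apply: fb; have /andP[h1 h2] := approx_gt m t0.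
  by rewrite (le_lt_trans ut h1) (le_lt_trans h2)// -ltrBrDl.
exists M => m Mm; split; first exact: H.
case: b H {fb} => H; first by apply/asboolP; exists M.
apply/asboolPn => -[M' HM'].
by have := H (maxn M M') (leq_maxl _ _); rewrite HM' ?leq_maxr.
Qed.

Lemma rlimit_cvg f t : bounded_changes f -> 0 <= t ->
  exists M, forall m, (M <= m)%N ->
    f (dyadic (approx t m).1 (approx t m).2) = rlimit f t.
Proof.
move=> bf t0; have [d [b [td fb]]] := right_dyadic bf t0.
have [|M HM] := rlimit_eq t0 fb; first by rewrite lexx td.
by exists M => m /HM[-> ->].
Qed.

Lemma rlimit_right f t : bounded_changes f -> 0 <= t ->
  exists2 d, t < d & forall s, t <= s < d -> rlimit f s = rlimit f t.
Proof.
move=> bf t0; have [d [b [td fb]]] := right_dyadic bf t0.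
have E s : t <= s < d -> rlimit f s = b.
  move=> sd; have s0 : 0 <= s by case/andP: sd => /(le_trans t0).
  by have [M HM] := rlimit_eq s0 fb sd; case: (HM M).
by exists d => // s sd; rewrite !E// lexx.
Qed.

Lemma rlimit_left f t : bounded_changes f -> 0 < t ->
  exists b, exists2 d, d < t & forall s, 0 <= s -> d <= s < t -> rlimit f s = b.
Proof.
move=> bf t0; have [d [b [dt fb]]] := left_dyadic bf t0; exists b, d => // s s0 ds.
by have [M HM] := rlimit_eq s0 fb ds; case: (HM M).
Qed.

End dyadic_limits.

Section regularization.
Context {R : realType}.

Definition nabs (s : R) : {nonneg R} := `|s|%:nng.

Lemma nabsE s : (nabs s)%:num = `|s|.
Proof. by []. Qed.

Definition regular (z : cantor_space) :=
  forall k, bounded_changes (fun a => rat_value z a k).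

(** At a rational time this right limit may differ from the recorded value; its law is obtained by
    passing to the limit along later dyadic times. *)
Definition regularize (z : cantor_space) (t : {nonneg R}) : cantor_space :=
  fun k => rlimit (fun a => rat_value z a k) t%:num.

Lemma cadlag_regularize z : regular z -> cadlag (regularize z).
Proof.
move=> rz t; split.
  move=> A /nbhs_agree[n nA].
  change (\forall s \near (t%:num : R)^'+, A (regularize z (nabs s))).
  suff : \forall s \near (t%:num : R)^'+, agree n (regularize z t) (regularize z (nabs s)).
    by move=> H; near=> s; apply: nA; near: s; exact: H.
  elim: n {nA} => [|n IH]; first by apply: nearW => s i; rewrite ltn0.
  have [d td Hd] := rlimit_right (rz n) (ge0 t).
  have : \forall s \near (t%:num : R)^'+, t%:num <= s < d.
    near=> s; apply/andP; split.
      by apply: ltW; near: s; exact: nbhs_right_gt.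
    by near: s; exact: nbhs_right_lt.
  apply: filterS2 IH => s ag /[dup] ts /Hd E k; rewrite ltnS leq_eqVlt => /orP[/eqP ->|/ag//].
  rewrite /regularize nabsE -E ger0_norm//.
  by case/andP: ts => + _; apply: le_trans.
move=> t0; have H k := rlimit_left (rz k) t0.
pose y : cantor_space := fun k => projT1 (cid (H k)).
apply/cvg_ex; exists y => A /nbhs_agree[n nA].
change (\forall s \near (t%:num : R)^'-, A (regularize z (nabs s))).
suff : \forall s \near (t%:num : R)^'-, agree n y (regularize z (nabs s)).
  by move=> H'; near=> s; apply: nA; near: s; exact: H'.
elim: n {nA} => [|n IH]; first by apply: nearW => s i; rewrite ltn0.
have [d dt Hd] := projT2 (cid (H n)).
have : \forall s \near (t%:num : R)^'-, 0 <= s /\ d <= s < t%:num.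
  near=> s; split; first by apply: ltW; near: s; exact: nbhs_left_gt.
  apply/andP; split; first by apply: ltW; near: s; exact: nbhs_left_gt.
  by near: s; exact: nbhs_left_lt.
apply: filterS2 IH => s ag [s0 ds] k; rewrite ltnS leq_eqVlt => /orP[/eqP ->|/ag//].
by rewrite /regularize nabsE ger0_norm// (Hd s s0 ds).
Unshelve. all: by end_near. Qed.

(** Points that are not regular, a null set by [prob_regular], are sent to a constant path. *)
Definition path_of (z : cantor_space) : cpath R :=
  if pselect (regular z) is left rz then Path (cadlag_regularize rz)
  else Path (cadlag_cst point).

Lemma path_ofE z : regular z -> path_of z = regularize z :> ({nonneg R} -> cantor_space).
Proof. by move=> rz; rewrite /path_of; case: pselect. Qed.

Lemma path_of_cvg z (t : {nonneg R}) n : regular z ->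
  \forall m \near \oo, agree n (path_of z t)
    (rat_value z (dyadic (approx t%:num m).1 (approx t%:num m).2)).
Proof.
move=> rz; rewrite path_ofE//; elim: n => [|n IH]; first by apply: nearW => s i; rewrite ltn0.
have [M HM] := rlimit_cvg (rz n) (ge0 t).
have : \forall m \near \oo, (M <= m)%N by exists M.
apply: filterS2 IH => m ag /HM E k; rewrite ltnS leq_eqVlt => /orP[/eqP ->|/ag//].
by rewrite E.
Qed.

Lemma measurable_regular : measurable [set z | regular z].
Proof.
rewrite (_ : [set _ | _] = \bigcap_k \bigcap_T \bigcup_K \bigcap_m
  [set z | (changes (fun a => rat_value z a k) m (T * 2 ^ m) <= K)%N]).
  apply: bigcapT_measurable => k; apply: bigcapT_measurable => T.
  apply: bigcupT_measurable => K; apply: bigcapT_measurable => m.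
  suff [n ln] : cylf (fun z => changes (fun a => rat_value z a k) m (T * 2 ^ m)).
    by apply: (@level_measurable n) => x y xy /=; rewrite (ln x y xy).
  rewrite /changes; elim: (T * 2 ^ m)%N => [|n IH].
    by exists 0%N => x y _; rewrite !big_geq.
  under eq_fun do rewrite big_nat_recr//=.
  apply: (@cylf_comp2 _ _ _ addn) IH _.
  have cv a : cylf (fun z => rat_value z a k).
    by exists (pickle (a, k)).+1 => x y xy; rewrite /rat_value xy.
  exact: (cylf_comp2 (fun a b => nat_of_bool (a != b)) (cv _) (cv _)).
apply/seteqP; split=> z.
  by move=> rz k _ T _; have [K HK] := rz k T; exists K => // m _; exact: HK.
by move=> H k T; have [K _ HK] := H k I T I; exists K => m; exact: (HK m I).
Qed.

Lemma measurable_path_of : measurable_fun setT path_of.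
Proof.
apply: measurable_fun_cpath => t k.
have mV m : measurable
    [set z | rat_value z (dyadic (approx t%:num m).1 (approx t%:num m).2) k = true].
  apply: (@level_measurable (pickle (dyadic (approx t%:num m).1 (approx t%:num m).2, k)).+1) => x y xy /=.
  by rewrite /rat_value xy.
rewrite (_ : [set _ | _] =
  ([set z | regular z] `&` \bigcup_M \bigcap_(m in [set m | (M <= m)%N])
     [set z | rat_value z (dyadic (approx t%:num m).1 (approx t%:num m).2) k = true])
  `|` (~` [set z | regular z] `&` [set z | point k = true])).
  have mr := measurable_regular.
  apply: measurableU; apply: measurableI => //.
  - by apply: bigcupT_measurable => M; apply: bigcap_measurable => [|m _]; [exists M => /=|].
  - exact: measurableC.
  - by apply: (@level_measurable 0).
apply/seteqP; split=> z /=.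
  rewrite /path_of; case: pselect => rz /=; last by right.
  by move=> /asboolP[M HM]; left; split=> //; exists M.
move=> [[rz [M _ HM]]|[rz pk]].
  by rewrite path_ofE//; apply/asboolP; exists M => m /HM.
by rewrite /path_of; case: pselect.
Qed.

End regularization.

(** * Almost sure events, restrictions and image measures *)

Section probability_one.
Context {R : realType} d (T : measurableType d) (m : probability T R).
Implicit Types (D : set T) (f : T -> R).

Lemma prob_setC0 D : measurable D -> m D = 1%E -> m (~` D) = 0%E.
Proof. by move=> mD m1; rewrite probability_setC// m1 subee. Qed.

Lemma prob_setC1 D : measurable D -> m (~` D) = 0%E -> m D = 1%E.
Proof.
by move=> mD m0; rewrite -[D]setCK probability_setC ?m0 ?sube0//; exact: measurableC.
Qed.

Lemma prob_bigcap1 (F : nat -> set T) : (forall k, measurable (F k)) ->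
  (forall k, m (F k) = 1%E) -> m (\bigcap_k F k) = 1%E.
Proof.
move=> mF F1; apply: prob_setC1; first exact: bigcapT_measurable.
rewrite setC_bigcap; apply: measure_negligible.
  by apply: bigcupT_measurable => k; exact: measurableC.
apply: negligible_bigcup => k; apply/negligibleP; first exact: measurableC.
exact: prob_setC0.
Qed.

Lemma Rintegral_full D f : measurable D -> m D = 1%E -> measurable_fun setT f ->
  bounded_on setT f -> \int[m]_x f x = \int[m]_(x in D) f x.
Proof.
move=> mD D1 mf [b fb]; have mDc := measurableC mD.
rewrite -(setUv D) Rintegral_setU//; last 2 first.
- by rewrite setUv; apply: integrable_bounded => //; exists b.
- exact/disj_setPCl.
suff -> : \int[m]_(x in ~` D) f x = 0 by rewrite addr0.
apply/eqP; rewrite -normr_le0.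
have := le_Rintegral_norm m mDc (measurable_funTS mf) (fun x _ => fb x I).
by rewrite (prob_setC0 mD D1) mulr0.
Qed.

Lemma Rintegral_restrict D (P : T -> bool) f :
  \int[m]_(x in D `&` [set x | P x]) f x = \int[m]_(x in D) ((P x)%:R * f x).
Proof.
rewrite Rintegral_mkcondr; apply: eq_Rintegral => x _; rewrite patchE.
by case: (boolP (P x)) => h; [rewrite mem_set// mul1r|rewrite memNset ?mul0r//; exact/negP].
Qed.

Lemma Rintegral_pushforward d' (T' : measurableType d') (Q : {measure set T' -> \bar R})
    (phi : T -> T') (D : set T') (f : T' -> R) :
  measurable_fun setT phi -> (forall A, Q A = m (phi @^-1` A)) ->
  measurable D -> measurable_fun setT f -> bounded_on setT f ->
  \int[Q]_(x in D) f x = \int[m]_(z in phi @^-1` D) f (phi z).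
Proof.
move=> mphi QE mD mf [b fb]; rewrite /Rintegral; congr fine.
rewrite (eq_measure_integral (pushforward m phi)); last by move=> A _ _; exact: QE.
rewrite integral_pushforward//; first exact/measurable_EFinP.
have mpD : measurable (phi @^-1` D) by rewrite -[X in measurable X]setTI; exact: mphi.
apply: (integrable_bounded m mpD (f := f \o phi)).
  by apply: measurable_funTS; exact: measurableT_comp.
by exists b => x _; exact: fb.
Qed.

Lemma ge0_integral_image d' (T' : measurableType d') (Q : {measure set T' -> \bar R})
    (phi : T -> T') (f : T' -> \bar R) :
  measurable_fun setT phi -> (forall A, Q A = m (phi @^-1` A)) ->
  measurable_fun setT f -> (forall y, (0 <= f y)%E) ->
  (\int[Q]_y f y = \int[m]_z f (phi z))%E.
Proof.
move=> mphi QE mf f0.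
rewrite (eq_measure_integral (pushforward m phi)); last by move=> A _ _; exact: QE.
by rewrite ge0_integral_pushforward.
Qed.

End probability_one.

(** * Almost surely each coordinate jumps finitely often in bounded time *)

Section regular_paths.
Context {R : realType} (gamma theta : {nonneg R}) (x0 : cantor_space).
Local Notation U := (chain_op gamma theta).
Local Notation cprob := (cprob gamma theta x0).
Local Notation dtime := (@dtime R).
Implicit Types (c : seq (rat * nat * bool)) (n k : nat).

Variable m : probability cantor_space R.
Hypothesis mE : forall c, m [set z | bits c (rat_bit z)] = (cprob c)%:E.

Let val a k (z : cantor_space) := rat_value z a k.

Lemma cylf_value a k : cylf (val a k).
Proof. by exists (pickle (a, k)).+1 => x y xy; rewrite /val /rat_value xy. Qed.

Lemma measurable_cylf (P : cantor_space -> bool) : cylf P -> measurable [set z | P z].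
Proof. by move=> [n ln]; apply: (@level_measurable n) => x y xy /=; rewrite (ln x y xy). Qed.

(** By the Markov property and [chain_op_lower], coordinate [k] keeps its value with conditional
    probability at least exp (- M dt), and 1 - exp (- u) is at most u. *)
Lemma change_half a a' k b : rtime a <= rtime a' :> R ->
  fine (m [set z | (val a k z == b) && (val a' k z == ~~ b)]) <=
  total_rate gamma theta k.+1 * (rtime a' - rtime a) *
  fine (m [set z | val a k z == b]).
Proof.
move=> aa'; set M := total_rate _ _ _; set dt := rtime a' - rtime a.
pose g (y : cantor_space) : R := (y k == ~~ b)%:R.
have lg : level k.+1 g by move=> x y xy; rewrite /g xy.
have lb : level k.+1 (fun y : cantor_space => (y k == b)%:R : R) by move=> x y ->.
have E : [set z | val a k z == b] = [set z | bits [:: ((a, k), b)] (rat_bit z)].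
  by apply/seteqP; split=> z; rewrite /bits /= andbT.
have mEv : measurable [set z | val a k z == b] by rewrite E; exact: measurable_rat_bits.
have -> : fine (m [set z | (val a k z == b) && (val a' k z == ~~ b)]) =
    \int[m]_(z in [set z | bits [:: ((a, k), b)] (rat_bit z)]) g (rat_value z a').
  rewrite -E; under eq_Rintegral do rewrite /g -[_%:R]mul1r.
  rewrite Rintegral_bool//; last first.
    apply: (@measurable_cylf (fun z => val a' k z == ~~ b)).
    by have [n ln] := cylf_value a' k; exists n => x y xy; rewrite (ln x y xy).
  by rewrite mul1r; congr (fine (m _)); apply/seteqP; split=> z /= => [/andP|[-> ->]].
rewrite (@rational_markov _ _ _ x0 m mE _ _ _ _ _ lg aa'); last first.
  by move=> p; rewrite inE => /eqP ->.
have dt0 : 0 <= dt by rewrite subr_ge0.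
rewrite -E; apply: le_trans (ler_norm _) _; apply: le_Rintegral_norm => //.
  apply: measurable_funTS; apply: measurableT_comp (measurable_rat_value a).
  by apply: cylf_measurable; exists k.+1; exact: level_chain_op.
move=> z vb; have zb : val a k z = b by exact/eqP.
rewrite ger0_norm; last exact: (chain_op_ge0 gamma theta _ dt0 lg (fun y => ler0n _ _)).
have lower := chain_op_lower gamma theta (rat_value z a) dt0 lb (fun y => ler0n _ _).
have -> : g = fun y : cantor_space => -1 * (y k == b)%:R + 1.
  by apply/funext => y; rewrite /g; case: (y k); case: (b); rewrite /=; ring.
rewrite -/dt chain_op_lin chain_op_cst.
move: lower; rewrite -/M (_ : rat_value z a k = b)// eqxx mulr1 => lower.
have := expR_ge1Dx (- (M * dt)); move: lower.
set u := chain_op _ _ _ _ _ _; set e := expR _; lra.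
Qed.

Lemma change_prob a a' k : rtime a <= rtime a' :> R ->
  fine (m [set z | val a k z != val a' k z]) <=
  total_rate gamma theta k.+1 * (rtime a' - rtime a).
Proof.
move=> aa'; set C := _ * _.
have cv b : cylf (fun z => (val a k z == b) && (val a' k z == ~~ b)).
  exact: (cylf_comp2 (fun u v => (u == b) && (v == ~~ b)) (cylf_value a k) (cylf_value a' k)).
have cw b : cylf (fun z => val a k z == b).
  by have [n ln] := cylf_value a k; exists n => x y xy; rewrite (ln x y xy).
have ms b := measurable_cylf (cv b); have mw b := measurable_cylf (cw b).
have -> : [set z | val a k z != val a' k z] =
   [set z | (val a k z == true) && (val a' k z == ~~ true)] `|`
   [set z | (val a k z == false) && (val a' k z == ~~ false)].
  apply/seteqP; split=> z /=; case: (val a k z); case: (val a' k z) => //=; try by [left|right].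
  by move=> [].
  by move=> [].
rewrite measureU//; last first.
  by apply/seteqP; split=> // z /= [/andP[/eqP -> _] /andP[]].
rewrite fineD ?prob_fin//.
apply: le_trans (lerD (change_half k true aa') (change_half k false aa')) _.
rewrite -mulrDr -/C -fineD ?prob_fin// -measureU//; last first.
  by apply/seteqP; split=> // z /= [/eqP -> /eqP].
set mA := (X in _ * fine X); have -> : mA = 1%E.
  rewrite /mA -(probability_setT m); congr (m _); apply/seteqP; split=> // z _ /=.
  by case: (val a k z); [left|right].
by rewrite mulr1.
Qed.

Let N k j n (z : cantor_space) : nat := changes (fun a => rat_value z a k) j n.

Lemma cylf_changes k j n : cylf (N k j n).
Proof.
rewrite /N /changes; elim: n => [|n IH].
  by exists 0%N => x y _; rewrite !big_geq.
under eq_fun do rewrite big_nat_recr//=.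
apply: (@cylf_comp2 _ _ _ addn) IH _.
exact: (cylf_comp2 (fun a b => nat_of_bool (a != b)) (cylf_value _ k) (cylf_value _ k)).
Qed.

(** The probabilities of a change over the single steps add up to a rate times the elapsed time, a
    bound that does not deteriorate as the mesh shrinks. *)
Lemma expected_changes k j n :
  \int[m]_z (N k j n z)%:R <= total_rate gamma theta k.+1 * (n%:R / 2 ^+ j).
Proof.
have cN n' : cylf (fun z => (N k j n' z)%:R : R).
  by have [l ll] := cylf_changes k j n'; exists l => x y /ll ->.
elim: n => [|n IH].
  rewrite mul0r mulr0 /N /changes; under eq_Rintegral do rewrite big_geq//.
  by rewrite Rintegral_cst// mul0r.
have E z : (N k j n.+1 z)%:R = (N k j n z)%:R +
    (val (dyadic j n) k z != val (dyadic j n.+1) k z)%:R :> R.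
  by rewrite /N /changes big_nat_recr//= natrD.
have cb : cylf (fun z => val (dyadic j n) k z != val (dyadic j n.+1) k z).
  exact: (cylf_comp2 (fun a b => a != b) (cylf_value _ k) (cylf_value _ k)).
under eq_Rintegral do rewrite E.
rewrite (@cylf_RintegralD _ _ _ m setT id (fun z => (N k j n z)%:R) (fun z =>
    (val (dyadic j n) k z != val (dyadic j n.+1) k z)%:R))//; last first.
  by have [l ll] := cb; exists l => x y /ll ->.
rewrite -natr1 mulrDl mulrDr lerD//.
have -> : \int[m]_z (val (dyadic j n) k z != val (dyadic j n.+1) k z)%:R =
    fine (m [set z | val (dyadic j n) k z != val (dyadic j n.+1) k z]).
  under eq_Rintegral do rewrite -[_%:R]mul1r.
  by rewrite Rintegral_bool ?mul1r ?setTI//; exact: measurable_cylf.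
have tE i : rtime (dyadic j i) = i%:R / 2 ^+ j :> R by exact: (dtimeE (j, i)).
apply: le_trans (change_prob _ _) _.
  by rewrite !tE ler_pM2r ?invr_gt0 ?exprn_gt0// ler_nat.
by rewrite !tE -natr1 mulrDl addrAC subrr add0r.
Qed.

(** Markov's inequality. *)
Lemma many_changes k j n K :
  fine (m [set z | (K < N k j n z)%N]) <= total_rate gamma theta k.+1 * (n%:R / 2 ^+ j) / K.+1%:R.
Proof.
rewrite ler_pdivlMr ?ltr0n// mulrC; apply: le_trans (expected_changes k j n).
have cN : cylf (fun z => (N k j n z)%:R : R).
  by have [l ll] := cylf_changes k j n; exists l => x y /ll ->.
have cK : cylf (fun z => (K < N k j n z)%N).
  by have [l ll] := cylf_changes k j n; exists l => x y /ll ->.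
have mK := measurable_cylf cK.
rewrite -[X in m X]setTI -Rintegral_bool//; apply: le_Rintegral => //.
- apply: (@integrable_cylf _ _ _ m setT id (fun z => K.+1%:R * (K < N k j n z)%:R)) => //.
  by have [l ll] := cK; exists l => x y /ll ->.
- by apply: (@integrable_cylf _ _ _ m setT id (fun z => (N k j n z)%:R)).
- move=> z _; case: ltnP => h; last by rewrite mulr0.
  by rewrite mulr1 ler_nat.
Qed.

Lemma prob_regular : m [set z | regular z] = 1%E.
Proof.
have -> : [set z | regular z] = \bigcap_k \bigcap_T
    [set z | exists K, forall j, (N k j (T * 2 ^ j) z <= K)%N].
  apply/seteqP; split=> z; first by move=> rz k _ T _; exact: rz.
  by move=> H k T; exact: (H k I T I).
have setE k T : [set z | exists K, forall j, (N k j (T * 2 ^ j) z <= K)%N] =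
    ~` \bigcap_K \bigcup_j [set z | (K < N k j (T * 2 ^ j) z)%N].
  apply/seteqP; split=> z.
    by move=> [K HK] /(_ K I)[j _ /=]; rewrite ltnNge HK.
  move=> H; apply: contrapT => /forallNP H2; apply: H => K _.
  by have /existsNP[j /negP] := H2 K; rewrite -ltnNge => h; exists j.
have mU k T K : measurable (\bigcup_j [set z | (K < N k j (T * 2 ^ j) z)%N]).
  apply: bigcupT_measurable => j; apply: (@measurable_cylf (fun z => (K < N k j (T * 2 ^ j) z)%N)).
  by have [l ll] := cylf_changes k j (T * 2 ^ j); exists l => x y /ll ->.
have mB k T : measurable (\bigcap_K \bigcup_j [set z | (K < N k j (T * 2 ^ j) z)%N]).
  exact: bigcapT_measurable.
apply: prob_bigcap1 => k; first by apply: bigcapT_measurable => T; rewrite setE; exact: measurableC.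
apply: prob_bigcap1 => T; first by rewrite setE; exact: measurableC.
rewrite setE; apply: prob_setC1; [exact: measurableC|rewrite setCK].
set B := \bigcap_K _; have mBkT : measurable B by exact: mB.
set M := total_rate gamma theta k.+1 * T%:R.
have bound K : fine (m B) <= M / K.+1%:R.
  rewrite -lee_fin fineK ?prob_fin//.
  apply: le_trans (_ : (m (\bigcup_j [set z | (K < N k j (T * 2 ^ j) z)%N]) <= _)%E).
    apply: le_measure; rewrite ?inE; [exact: mB|exact: mU|].
    by move=> z Bz; exact: (Bz K I).
  have mj j : measurable [set z | (K < N k j (T * 2 ^ j) z)%N].
    apply: (@measurable_cylf (fun z => (K < N k j (T * 2 ^ j) z)%N)).
    by have [l ll] := cylf_changes k j (T * 2 ^ j); exists l => x y /ll ->.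
  (* Refining the grid only adds changes, so these events increase with [j], while the bound on
     their probabilities is free of [j]. *)
  apply: cvge_to_le (nondecreasing_cvg_mu mj (mU k T K) _) _.
    move=> i j ij; apply/subsetPset => z /= h; apply: leq_trans h _.
    rewrite /N -(subnKC ij) [(2 ^ (i + _))%N]expnD mulnA; exact: changes_refine.
  apply: nearW => j /=; rewrite -[leLHS]fineK ?prob_fin// lee_fin.
  apply: le_trans (many_changes _ _ _ _) _.
  by rewrite natrM natrX mulfK// expf_neq0.
have M0 : 0 <= M by rewrite mulr_ge0// total_rate_ge0.
have m0 : 0 <= fine (m B) by exact: fine_ge0.
suff : fine (m B) = 0.
  by move=> h; rewrite -[LHS]fineK ?prob_fin// h.
apply/eqP; rewrite eq_le m0 andbT leNgt; apply/negP => p0.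
(* If [m B] were positive, this index [K] would satisfy M / m B < K + 1, against the bound. *)
have := bound (Num.truncn (M / fine (m B))).
set K := Num.truncn _; rewrite ler_pdivlMr ?ltr0n// mulrC -ler_pdivlMr//.
have /andP[_] : K%:R <= M / fine (m B) < K.+1%:R.
  by apply: truncn_itv; rewrite divr_ge0.
by rewrite ltNge => /negP.
Qed.

End regular_paths.

Lemma nonneg_ge0 (R : realType) (t : {nonneg R}) : 0 <= t%:num.
Proof. by []. Qed.

Lemma eq_cvg_lim (R : realType) (u v : nat -> R) (a b : R) : (forall j, u j = v j) ->
  u j @[j --> \oo] --> a -> v j @[j --> \oo] --> b -> a = b.
Proof. by move=> /funext ->; exact: (cvg_unique (@Rhausdorff R)). Qed.

(** * From dyadic times to the law of the paths *)

Section path_law.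
Context {R : realType} (gamma theta : {nonneg R}) (x0 : cantor_space).
Local Notation U := (chain_op gamma theta).
Local Notation cprob := (cprob gamma theta x0).
Local Notation path_of := (@path_of R).
Implicit Types (c : seq ({nonneg R} * nat * bool)) (n k j : nat) (s t : {nonneg R}).

Definition sum_nonneg s t : {nonneg R} := (s%:num + t%:num)%:nng.

Definition times j t : {nonneg R} := (j%:R * t%:num)%:nng.

Lemma timesS j t : times j.+1 t = sum_nonneg (times j t) t.
Proof. by apply/val_inj; rewrite /= -natr1 mulrDl mul1r. Qed.

Definition dyadic_above t j : rat := dyadic (approx t%:num j).1 (approx t%:num j).2.

Definition constraints_above j c : seq (rat * nat * bool) :=
  [seq ((dyadic_above p.1.1 j, p.1.2), p.2) | p <- c].

Lemma dyadic_above_cvg t : rtime (dyadic_above t j) @[j --> \oo] --> (t%:num : R).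
Proof. exact: approx_cvg (ge0 t). Qed.

Lemma dyadic_above_le s t j : s%:num <= t%:num ->
  rtime (dyadic_above s j) <= rtime (dyadic_above t j) :> R.
Proof. exact: (approx_mono _ (ge0 s)). Qed.

Lemma chain_op_cvg n (u : nat -> R) (r : R) (g : cantor_space -> R) y :
  u j @[j --> \oo] --> r -> U n (u j) g y @[j --> \oo] --> U n r g y.
Proof.
move=> ur; apply: (@cvg_comp _ _ _ u (fun r => U n r g y) _ _ _ ur).
exact: chain_op_continuous.
Qed.

Lemma bits_above z c : regular z -> \forall j \near \oo,
  bits (constraints_above j c) (rat_bit z) = bits c (path_bit (path_of z)).
Proof.
move=> rz; elim: c => [|[[t k] b] c IH]; first exact: nearW.
apply: filterS2 (path_of_cvg t k.+1 rz) IH => j ag; rewrite /bits /= => ->.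
by rewrite /path_bit /= (ag k).
Qed.

Section limit.
Variable m : probability cantor_space R.
Hypothesis mE : forall c : seq (rat * nat * bool), m [set z | bits c (rat_bit z)] = (cprob c)%:E.

Lemma measurable_path_bits c : measurable [set w : cpath R | bits c (path_bit w)].
Proof.
rewrite cpath_measurableE path_eventsE; apply: sub_sigma_algebra.
by exists c => // p _.
Qed.

Lemma measurable_path_of_bits c :
  measurable [set z | bits c (path_bit (path_of z))].
Proof.
by have := @measurable_path_of R measurableT _ (measurable_path_bits c); rewrite setTI.
Qed.

(** Dominated convergence on the regular points, where constraints at later dyadic times eventually
    coincide with those on the path. The test function varies with [j] because, in the Markov
    property, so does the elapsed time between the two approximating dyadics. *)
Lemma Rintegral_above c t n b (g_ : nat -> cantor_space -> R) (g : cantor_space -> R) :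
  (forall j, level n (g_ j)) -> level n g -> (forall j y, `|g_ j y| <= b) ->
  (forall y, g_ j y @[j --> \oo] --> g y) ->
  \int[m]_(z in [set z | bits (constraints_above j c) (rat_bit z)])
     g_ j (rat_value z (dyadic_above t j)) @[j --> \oo] -->
  \int[m]_(z in [set z | bits c (path_bit (path_of z))]) g (path_of z t).
Proof.
move=> lg_ lg gb gcvg.
have mreg := measurable_regular; have preg := prob_regular mE.
have b0 : 0 <= b by apply: le_trans (normr_ge0 _) (gb 0%N point).
have gb' y : `|g y| <= b.
  by apply: (@cvgr_to_le _ _ _ _ (fun j => `|g_ j y|) _ _ (cvg_norm (gcvg y))); exact: nearW.
have bool_mul (P : bool) (v : R) : `|v| <= b -> `|P%:R * v| <= b.
  by case: P; rewrite ?mul1r// mul0r normr0.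
have mind d (T : measurableType d) (P : T -> bool) : measurable [set z | P z] ->
    measurable_fun setT (fun z => (P z)%:R : R).
  move=> mP; rewrite (_ : (fun z => _) = \1_[set z | P z]); first exact: measurable_indic.
  apply/funext => z; rewrite indicE; congr (nat_of_bool _)%:R.
  by apply/idP/idP => [h|]; rewrite inE.
have E1 j : \int[m]_(z in [set z | bits (constraints_above j c) (rat_bit z)])
      g_ j (rat_value z (dyadic_above t j)) =
    \int[m]_(z in [set z | regular z]) ((bits (constraints_above j c) (rat_bit z))%:R *
      g_ j (rat_value z (dyadic_above t j))).
  rewrite -[X in Rintegral _ X]setTI Rintegral_restrict (Rintegral_full mreg preg)//.
    apply: measurable_funM; first by apply: mind; exact: measurable_rat_bits.
    apply: measurableT_comp (measurable_rat_value _).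
    by apply: cylf_measurable; exists n.
  by exists b => z _; exact: bool_mul.
have E2 : \int[m]_(z in [set z | bits c (path_bit (path_of z))]) g (path_of z t) =
    \int[m]_(z in [set z | regular z]) ((bits c (path_bit (path_of z)))%:R * g (path_of z t)).
  rewrite -[X in Rintegral _ X]setTI Rintegral_restrict (Rintegral_full mreg preg)//.
    apply: measurable_funM; first by apply: mind; exact: measurable_path_of_bits.
    apply: (@measurableT_comp _ _ _ _ _ _ g).
      by apply: cylf_measurable; exists n.
    exact: (measurableT_comp (measurable_eval t) (@measurable_path_of R)).
  by exists b => z _; exact: bool_mul.
rewrite E2; under eq_fun do rewrite E1.
apply: (@Rintegral_bounded_cvg _ _ _ m _ _ _ b) => //.
- move=> j; apply: measurable_funTS; apply: measurable_funM; first by apply: mind; exact: measurable_rat_bits.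
  apply: measurableT_comp (measurable_rat_value _).
  by apply: cylf_measurable; exists n.
- apply: measurable_funTS; apply: measurable_funM; first by apply: mind; exact: measurable_path_of_bits.
  apply: (@measurableT_comp _ _ _ _ _ _ g).
    by apply: cylf_measurable; exists n.
  exact: (measurableT_comp (measurable_eval t) (@measurable_path_of R)).
- by move=> j z _; exact: bool_mul.
move=> z rz.
apply: (@cvg_trans _ ((bits c (path_bit (path_of z)))%:R * g_ j (path_of z t) @[j --> \oo])).
  apply: near_eq_cvg; apply: filterS2 (bits_above c rz) (path_of_cvg t n rz) => j -> ag.
  by rewrite (lg_ _ _ _ ag).
by apply: cvgMr; exact: gcvg.
Qed.

Lemma path_of_init n g t : level n g ->
  \int[m]_z g (path_of z t) = U n t%:num g x0.
Proof.
move=> lg; have [b _ gb] := level_bounded lg.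
have gc y : g y @[j --> \oo] --> g y by exact: cvg_cst.
have h1 := @Rintegral_above [::] t n b (fun=> g) g (fun=> lg) lg (fun=> gb) gc.
have E j : \int[m]_(z in [set z | bits (constraints_above j [::]) (rat_bit z)])
    g (rat_value z (dyadic_above t j)) = U n (rtime (dyadic_above t j)) g x0.
  rewrite (@Rintegral_fidi _ _ _ x0 m mE _ _ _ n [:: rtime (dyadic_above t j)])//.
  rewrite /fidi subr0; congr (chain_op _ _ _ _ _ _); apply/funext => y.
  by rewrite eqxx /at_timeR /= mulr1 mul1r.
have T0 := bits_nil (path_bit \o path_of).
rewrite -[X in Rintegral _ X]T0; apply: (eq_cvg_lim E h1).
exact/chain_op_cvg/dyadic_above_cvg.
Qed.

Lemma path_of_markov n g s t c : level n g ->
  (forall p, p \in c -> p.1.1%:num <= s%:num) ->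
  \int[m]_(z in [set z | bits c (path_bit (path_of z))]) g (path_of z (sum_nonneg s t)) =
  \int[m]_(z in [set z | bits c (path_bit (path_of z))]) U n t%:num g (path_of z s).
Proof.
move=> lg cs; have [b _ gb] := level_bounded lg.
have ss : s%:num <= (sum_nonneg s t)%:num by rewrite /= lerDl.
pose delta j := rtime (dyadic_above (sum_nonneg s t) j) - rtime (dyadic_above s j) : R.
have delta0 j : 0 <= delta j by rewrite subr_ge0 dyadic_above_le.
have gc y : g y @[j --> \oo] --> g y by exact: cvg_cst.
have h1 := @Rintegral_above c (sum_nonneg s t) n b (fun=> g) g (fun=> lg) lg (fun=> gb) gc.
have h2 := @Rintegral_above c s n b (fun j => U n (delta j) g) (U n t%:num g)
  (fun j => level_chain_op gamma theta _ (leqnn n) lg) (level_chain_op gamma theta _ (leqnn n) lg)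
  (fun j y => chain_op_norm gamma theta y (delta0 j) lg gb).
have hU y : U n (delta j) g y @[j --> \oo] --> U n t%:num g y.
  have dt : delta j @[j --> \oo] --> t%:num.
    rewrite (_ : t%:num = (sum_nonneg s t)%:num - s%:num); last by rewrite /=; ring.
    by apply: cvgB; exact: dyadic_above_cvg.
  exact: chain_op_cvg.
apply: (eq_cvg_lim _ h1 (h2 hU)) => j.
rewrite (@rational_markov _ _ _ x0 m mE _ _ _ _ _ lg (dyadic_above_le j ss))//.
by move=> p /mapP[q qc ->] /=; exact/dyadic_above_le/cs.
Qed.

End limit.

Lemma path_law : exists Q : probability (cpath R) R,
  (forall n g t, level n g -> \int[Q]_w g (w t) = U n t%:num g x0) /\
  (forall n g s t c, level n g -> (forall p, p \in c -> p.1.1%:num <= s%:num) ->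
    \int[Q]_(w in [set w | bits c (path_bit w)]) g (w (sum_nonneg s t)) =
    \int[Q]_(w in [set w | bits c (path_bit w)]) U n t%:num g (w s)).
Proof.
have [m mE] := rational_law gamma theta x0.
have mpo := @measurable_path_of R.
have [Q QE] := pushforward_probability m mpo; exists Q.
have push n g t (D : set (cpath R)) : level n g -> measurable D ->
    \int[Q]_(w in D) g (w t) = \int[m]_(z in path_of @^-1` D) g (path_of z t).
  move=> lg mD; have [b _ gb] := level_bounded lg.
  apply: (Rintegral_pushforward (f := fun w : cpath R => g (w t)) mpo QE mD).
    apply: (@measurableT_comp _ _ _ _ _ _ g); last exact: measurable_eval.
    by apply: cylf_measurable; exists n.
  by exists b => w _; exact: gb.
split=> [n g t lg|n g s t c lg cs].
  by rewrite (push n)// preimage_setT; exact: path_of_init.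
have mc := measurable_path_bits c.
rewrite (push n)// (push n)//; first exact: path_of_markov.
exact: level_chain_op.
Qed.

End path_law.

(** * Laws of the chain *)

Lemma pker_of (R : realType) d (T : measurableType d) (k : T -> probability T R) :
  (forall B, measurable B -> measurable_fun setT (fun x => k x B)) ->
  exists P : R.-pker T ~> T, forall x B, P x B = k x B.
Proof.
move=> mk; pose k' : T -> {measure set T -> \bar R} := fun x => k x.
have k1 x : k' x setT = 1%E by exact: probability_setT.
pose iK := isKernel.Build _ _ _ _ R k' mk.
pose K : R.-ker T ~> T := HB.pack k' iK.
pose iP := Kernel_isProbability.Build _ _ _ _ _ K k1.
pose P : R.-pker T ~> T := HB.pack k' iK iP.
by exists P.
Qed.

Section path_laws.
Context {R : realType}.
Implicit Types (c : seq ({nonneg R} * nat * bool)) (g : cantor_space -> R)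
  (s t : {nonneg R}) (n : nat).

Definition before c s := forall p, p \in c -> p.1.1%:num <= s%:num.

Lemma before_exists c : exists s, before c s.
Proof.
elim: c => [|p c [s cs]]; first by exists 0%:nng.
exists (sum_nonneg p.1.1 s) => q; rewrite inE => /orP[/eqP ->|/cs qs] /=.
  by rewrite lerDl.
by rewrite (le_trans qs)// lerDr.
Qed.

Lemma sum_nonnegBK s t (st : s%:num <= t%:num) : exists u, t = sum_nonneg s u.
Proof.
have h : 0 <= t%:num - s%:num by rewrite subr_ge0.
by exists (NngNum h); apply/val_inj => /=; ring.
Qed.

(* [J s c g] stands for the integral of [g (w s)] over the event [bits c w],
   possibly restricted further to an event of the past of [s]. *)
Lemma functional_unique
    (J J' : {nonneg R} -> seq ({nonneg R} * nat * bool) -> (cantor_space -> R) -> R) :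
  (forall g, cylf g -> J 0%:nng [::] g = J' 0%:nng [::] g) ->
  (forall s t g, cylf g -> exists2 g', cylf g' & forall c, before c s ->
     J (sum_nonneg s t) c g = J s c g' /\ J' (sum_nonneg s t) c g = J' s c g') ->
  (forall s c k b g, J s ((s, k, b) :: c) g = J s c (fun y => (y k == b)%:R * g y)) ->
  (forall s c k b g, J' s ((s, k, b) :: c) g = J' s c (fun y => (y k == b)%:R * g y)) ->
  (forall s c d g, perm_eq c d -> J s c g = J s d g) ->
  (forall s c d g, perm_eq c d -> J' s c g = J' s d g) ->
  forall s c g, before c s -> cylf g -> J s c g = J' s c g.
Proof.
move=> J0 Jstep Ja Ja' Jp Jp' s c g cs cg.
(* Latest constraint first: the test function is moved back to the time of that constraint, which is
   then absorbed as an indicator factor. *)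
pose r (p q : {nonneg R} * nat * bool) := q.1.1%:num <= p.1.1%:num.
have rtr : transitive r by move=> p q u h1 h2; exact: le_trans h2 h1.
have pe : perm_eq c (sort r c) by rewrite perm_sym perm_sort.
rewrite (Jp _ _ _ _ pe) (Jp' _ _ _ _ pe).
have : sorted r (sort r c) by apply: sort_sorted => p q; rewrite /r orbC; exact: le_total.
have {cs pe} : before (sort r c) s by move=> p; rewrite mem_sort; exact: cs.
elim: (sort r c) s g cg => [|[[t k] b] l IH] s g cg ls.
  have [u ->] : exists u, s = sum_nonneg 0%:nng u by apply: sum_nonnegBK => /=.
  move=> _; have [g' cg' /(_ [::])[|-> ->]] := Jstep 0%:nng u g cg; first by [].
  exact: J0.
rewrite /= (path_sortedE rtr) => /andP[/allP al sl].
have [u ->] : exists u, s = sum_nonneg t u.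
  by apply: sum_nonnegBK; apply: (ls (t, k, b)); rewrite inE eqxx.
have [g' cg' /(_ ((t, k, b) :: l))[|-> ->]] := Jstep t u g cg.
  by move=> p; rewrite inE => /orP[/eqP ->//|/al].
have ck : cylf (fun y : cantor_space => (y k == b)%:R : R) by exists k.+1 => x y ->.
rewrite Ja Ja'; apply: IH => //; exact: (cylf_comp2 *%R ck cg').
Qed.

Lemma cylf_path_measurable g t : cylf g -> measurable_fun setT (fun w : cpath R => g (w t)).
Proof.
move=> cg; apply: (@measurableT_comp _ _ _ _ _ _ g); last exact: measurable_eval.
exact: cylf_measurable.
Qed.

Lemma cylf_path_bounded g t (D : set (cpath R)) : cylf g ->
  bounded_on D (fun w : cpath R => g (w t)).
Proof. by move=> /cylf_bounded[b _ gb]; exists b => w _; exact: gb. Qed.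

Lemma Rintegral_bits_cons (Q : probability (cpath R) R) (S : set (cpath R)) s c k b g :
  \int[Q]_(w in [set w | bits ((s, k, b) :: c) (path_bit w)] `&` S) g (w s) =
  \int[Q]_(w in [set w | bits c (path_bit w)] `&` S) ((w s k == b)%:R * g (w s)).
Proof.
rewrite -(Rintegral_restrict Q _ (fun w : cpath R => w s k == b)).
congr (Rintegral Q _ _); apply/seteqP; split=> w; rewrite /bits /= /path_bit /=.
  by move=> [/andP[h1 h2] h3].
by move=> [[h2 h3] h1]; split=> //; apply/andP.
Qed.

Lemma bits_perm (I : eqType) (c d : seq (I * bool)) (x : I -> bool) :
  perm_eq c d -> bits c x = bits d x.
Proof. exact: perm_all. Qed.

Section chain.
Context (gamma theta : {nonneg R}).
Local Notation U := (chain_op gamma theta).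

(** The Markov property is asked only of cylinder functions and of finitely many past bits: weak
    enough to be verified on an image measure, strong enough to determine the law by
    [functional_unique]. *)
Definition chain_law (x : cantor_space) (Q : probability (cpath R) R) :=
  (forall g, cylf g -> \int[Q]_w g (w 0%:nng) = g x) /\
  (forall n g s t c, level n g -> before c s ->
    \int[Q]_(w in [set w | bits c (path_bit w)]) g (w (sum_nonneg s t)) =
    \int[Q]_(w in [set w | bits c (path_bit w)]) U n t%:num g (w s)).

Lemma chain_law_exists x : exists Q, chain_law x Q.
Proof.
have [Q [Q1 Q2]] := path_law gamma theta x; exists Q; split=> // g [n lg].
by rewrite (Q1 n)// chain_op0.
Qed.

Lemma chain_law_unique x (Q Q' : probability (cpath R) R) :
  chain_law x Q -> chain_law x Q' -> forall A, measurable A -> Q A = Q' A.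
Proof.
move=> [i1 m1] [i2 m2]; apply: cpath_measure_unique.
  by rewrite (le_lt_trans (probability_le1 Q measurableT))// ltry.
move=> c; pose J (Q : probability (cpath R) R) s c g :=
  \int[Q]_(w in [set w | bits c (path_bit w)]) g (w s).
have [s cs] := before_exists c.
have J1 P : J P s c (fun=> 1) =
    fine (P [set w | bits c (path_bit w)]).
  by rewrite /J Rintegral_cst ?mul1r//; exact: measurable_path_bits.
suff : fine (Q [set w | bits c (path_bit w)]) = fine (Q' [set w | bits c (path_bit w)]).
  have mc := measurable_path_bits c.
  move=> E; have h1 := fineK (prob_fin Q mc); have := fineK (prob_fin Q' mc).
  by rewrite -E h1.
rewrite -!J1; apply: (@functional_unique (J Q) (J Q')) (cs) _.
- by move=> g cg; rewrite /J bits_nil i1 ?i2.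
- move=> u t g [n lg]; exists (U n t%:num g); first by exists n; exact: level_chain_op.
  by move=> d ds; split; [exact: m1|exact: m2].
- by move=> u d k b g; have := Rintegral_bits_cons Q setT u d k b g; rewrite !setIT.
- by move=> u d k b g; have := Rintegral_bits_cons Q' setT u d k b g; rewrite !setIT.
- by move=> u d e g de; rewrite /J; under eq_set do rewrite (bits_perm _ de).
- by move=> u d e g de; rewrite /J; under eq_set do rewrite (bits_perm _ de).
- by exists 0%N.
Qed.

End chain.
End path_laws.

Lemma fin_addeI (R : realType) (x y z : \bar R) : (x \is a fin_num -> x + y = x + z -> y = z)%E.
Proof.
by move=> fx xyz; rewrite -[LHS](addeK y fx) -[RHS](addeK z fx) !(addeC _ x) xyz.
Qed.

(** * Closure steps extending the Markov property beyond bit events *)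

Section probability_induction.
Local Open Scope ereal_scope.
Context {R : realType} d (T : measurableType d) (m : probability T R).
Implicit Types (E F D : set T) (f : T -> \bar R).

Lemma measure_splitI E D : measurable E -> measurable D ->
  m D = m (E `&` D) + m (~` E `&` D).
Proof.
move=> mE mD; rewrite -measureU.
- by rewrite -setIUl setUv setTI.
- exact: measurableI.
- by apply: measurableI => //; exact: measurableC.
- by apply/seteqP; split=> // x [[? _] [? _]].
Qed.

Lemma prob_eq_integralC E D f : measurable E -> measurable D -> measurable_fun setT f ->
  (forall x, 0 <= f x) -> m D = \int[m]_x f x ->
  m (E `&` D) = \int[m]_(x in E) f x ->
  m (~` E `&` D) = \int[m]_(x in ~` E) f x.
Proof.
move=> mE mD mf f0 DT DE; have mEc := measurableC mE.
apply: (@fin_addeI _ (m (E `&` D))); first by apply: prob_fin; exact: measurableI.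
rewrite -measure_splitI// DE DT -ge0_integral_setU//; first by rewrite setUv.
- by rewrite setUv.
- exact/disj_setPCl.
Qed.

Lemma prob_eq_integral_bigcup (F : nat -> set T) D f :
  (forall k, measurable (F k)) -> measurable D -> measurable_fun setT f ->
  (forall x, 0 <= f x) -> trivIset setT F ->
  (forall k, m (F k `&` D) = \int[m]_(x in F k) f x) ->
  m (\bigcup_k F k `&` D) = \int[m]_(x in \bigcup_k F k) f x.
Proof.
move=> mF mD mf f0 tF FD; rewrite ge0_integral_bigcup//; last exact: measurable_funTS.
rewrite setI_bigcupl measure_semi_bigcup.
- by apply: eq_eseriesr => k _; exact: FD.
- by move=> k; exact: measurableI.
- exact: trivIset_setIr.
- by apply: bigcupT_measurable => k; exact: measurableI.
Qed.

Section kernel_like.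
Context d' (T' : measurableType d') (phi : T -> T') (k : T -> probability T' R).
Hypothesis mphi : measurable_fun setT phi.
Hypothesis mk : forall B, measurable B -> measurable_fun setT (fun x => k x B).

Lemma kernel_eq_integralC F B : measurable F -> measurable B ->
  m (F `&` phi @^-1` B) = \int[m]_(x in F) k x B ->
  m (F `&` phi @^-1` (~` B)) = \int[m]_(x in F) k x (~` B).
Proof.
move=> mF mB FB; have mBc := measurableC mB.
have mpB : measurable (phi @^-1` B) by rewrite -[X in measurable X]setTI; exact: mphi.
apply: (@fin_addeI _ (m (F `&` phi @^-1` B))); first by apply: prob_fin; exact: measurableI.
rewrite {2}FB -ge0_integralD//; try by apply: measurable_funTS; exact: mk.
rewrite preimage_setC (setIC F) (setIC F) -measure_splitI//.
rewrite (eq_integral (cst 1)); first by rewrite integral_cst// mul1e.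
move=> x _; rewrite -measureU// ?setUv ?setICr//; exact: probability_setT.
Qed.

Lemma kernel_eq_integral_bigcup F (B : nat -> set T') : measurable F ->
  (forall i, measurable (B i)) -> trivIset setT B ->
  (forall i, m (F `&` phi @^-1` (B i)) = \int[m]_(x in F) k x (B i)) ->
  m (F `&` phi @^-1` (\bigcup_i B i)) = \int[m]_(x in F) k x (\bigcup_i B i).
Proof.
move=> mF mB tB FB.
have mpB i : measurable (phi @^-1` B i) by rewrite -[X in measurable X]setTI; exact: mphi.
rewrite preimage_bigcup setI_bigcupr measure_semi_bigcup.
- rewrite (eq_integral (fun x => \sum_(i <oo) k x (B i))); last first.
    by move=> x _; rewrite measure_semi_bigcup//; exact: bigcupT_measurable.
  rewrite integral_nneseries//; first by apply: eq_eseriesr => i _; exact: FB.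
  by move=> i; apply: measurable_funTS; exact: mk.
- by move=> i; exact: measurableI.
- by move=> i j _ _ [x [[_ bi] [_ bj]]]; apply: (tB i j) => //; exists (phi x).
- by apply: bigcupT_measurable => i; exact: measurableI.
Qed.

End kernel_like.
End probability_induction.

(** * The transition function of the chain and its Markov property *)

Section chain_family.
Context {R : realType} (gamma theta : {nonneg R}).
Local Notation U := (chain_op gamma theta).
Implicit Types (c : seq ({nonneg R} * nat * bool)) (g : cantor_space -> R)
  (s t : {nonneg R}) (n : nat) (x : cantor_space) (B : set cantor_space).

Variable Px : cantor_space -> probability (cpath R) R.
Hypothesis HPx : forall x, chain_law gamma theta x (Px x).

Lemma measurable_at t B : measurable B -> measurable [set w : cpath R | B (w t)].
Proof. by move=> mB; apply: sub_sigma_algebra; exists t, B. Qed.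

Lemma chain_integral x n g t : level n g -> \int[Px x]_w g (w t) = U n t%:num g x.
Proof.
move=> lg; have [i m] := HPx x.
have b0 : before [::] (0%:nng : {nonneg R}) by [].
have := m n g 0%:nng t [::] lg b0.
rewrite bits_nil.
rewrite (_ : sum_nonneg 0%:nng t = t); last by apply/val_inj; rewrite /= add0r.
by move=> ->; apply: i; exists n; exact: level_chain_op.
Qed.

Lemma chain_start x : Px x [set w : cpath R | w 0%:nng = x] = 1%E.
Proof.
rewrite (_ : [set w | _] = \bigcap_k [set w : cpath R | w 0%:nng k == x k]); last first.
  apply/seteqP; split=> w; first by move=> /= wx k _ /=; rewrite wx.
  by move=> h; apply/funext => k; apply/eqP; exact: (h k I).
have lk k : level k.+1 (fun y => (y k == x k)%:R : R) by move=> y z yz; rewrite yz.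
have mk k : measurable [set w : cpath R | w 0%:nng k == x k].
  apply: (@measurable_at 0%:nng [set y : cantor_space | y k == x k]).
  by apply: (@level_measurable k.+1) => y z yz /=; rewrite yz.
apply: prob_bigcap1 => // k.
have : \int[Px x]_w (1 * (w 0%:nng k == x k)%:R) = 1.
  under eq_Rintegral do rewrite mul1r.
  by rewrite (chain_integral x 0%:nng (lk k)) chain_op0 eqxx.
rewrite Rintegral_bool// setTI mul1r => E.
by rewrite -[LHS]fineK ?prob_fin// E.
Qed.

Lemma chain_bits x n t (d : seq (nat * bool)) : level n (fun y => (bits d y)%:R : R) ->
  Px x [set w : cpath R | bits d (w t)] = (U n t%:num (fun y => (bits d y)%:R) x)%:E.
Proof.
move=> ld; rewrite -(chain_integral x t ld).
have mb : measurable [set w : cpath R | bits d (w t)].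
  exact: (measurable_at t (measurable_bits d)).
under eq_Rintegral do rewrite -[_%:R]mul1r.
by rewrite Rintegral_bool// setTI mul1r fineK// prob_fin.
Qed.

Lemma level_bitsR (d : seq (nat * bool)) : exists n, level n (fun y => (bits d y)%:R : R).
Proof. by have [n ln] := @cylf_bitsR R d; exists n. Qed.

Lemma measurable_chain t B : measurable B ->
  measurable_fun setT (fun x => Px x [set w : cpath R | B (w t)]).
Proof.
move: B; apply: cantor_ind.
- rewrite (_ : (fun x => _) = cst 1%E)//.
  by apply/funext => x; exact: probability_setT.
- move=> d; have [n ln] := level_bitsR d.
  under eq_fun do rewrite (chain_bits _ _ ln).
  by apply/measurable_EFinP; apply: cylf_measurable; exists n; exact: level_chain_op.
- move=> B mB IH; under eq_fun => x.
    rewrite (_ : [set w | _] = ~` [set w : cpath R | B (w t)])//.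
    rewrite probability_setC; last exact: measurable_at.
    over.
  by apply: emeasurable_funB.
- move=> F mF tF IH; under eq_fun => x.
    rewrite (_ : [set w | _] = \bigcup_k [set w : cpath R | F k (w t)])//.
    rewrite measure_semi_bigcup; last 3 first.
    + by move=> k; exact: measurable_at.
    + by move=> i j _ _ [w [wi wj]]; apply: (tF i j) => //; exists (w t).
    + by apply: bigcupT_measurable => k; exact: measurable_at.
    over.
  apply: (@ge0_emeasurable_sum _ _ _ _
    (fun k x => Px x [set w : cpath R | F k (w t)]) xpredT) => k *.
    exact: measure_ge0.
  exact: IH.
Qed.

Definition chain_marginal t x : probability cantor_space R :=
  projT1 (cid (pushforward_probability (Px x) (measurable_eval t))).

Lemma chain_marginalE t x B : chain_marginal t x B = Px x [set w : cpath R | B (w t)].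
Proof. by rewrite /chain_marginal; case: cid => Q /= ->. Qed.

Lemma chain_kernel_exists t :
  exists P : R.-pker cantor_space ~> cantor_space,
    forall x B, P x B = Px x [set w : cpath R | B (w t)].
Proof.
have [B mB|P PE] := @pker_of R _ _ (chain_marginal t).
  by under eq_fun do rewrite chain_marginalE; exact: measurable_chain.
by exists P => x B; rewrite PE chain_marginalE.
Qed.

Definition chain_kernel t : R.-pker cantor_space ~> cantor_space :=
  projT1 (cid (chain_kernel_exists t)).

Lemma chain_kernelE t x B : chain_kernel t x B = Px x [set w : cpath R | B (w t)].
Proof. by rewrite /chain_kernel; case: cid. Qed.

Lemma chain_semigroup n g t : level n g -> semigroup chain_kernel t g = U n t%:num g.
Proof.
move=> lg; apply/funext => x; rewrite -(chain_integral x t lg).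
have cg : cylf g by exists n.
apply: (Rintegral_pushforward (m := Px x) (phi := fun w => w t)) => //.
- exact: measurable_eval.
- by move=> B; rewrite chain_kernelE.
- exact: cylf_measurable.
- by have [b _ gb] := cylf_bounded cg; exists b => y _; exact: gb.
Qed.

Lemma chain_markov_bits x s t c (d : seq (nat * bool)) : before c s ->
  Px x ([set w | bits c (path_bit w)] `&`
        [set w : cpath R | bits d (w (sum_nonneg s t))]) =
  (\int[Px x]_(w in [set w | bits c (path_bit w)]) chain_kernel t (w s) [set y | bits d y])%E.
Proof.
move=> cs; have [n ln] := level_bitsR d; have [_ m] := HPx x.
have mc := @measurable_path_bits R c.
under eq_integral do rewrite chain_kernelE (chain_bits _ _ ln).
have int : (Px x).-integrable [set w | bits c (path_bit w)]
    (EFin \o ((fun w : cpath R => U n t%:num (fun y => (bits d y)%:R) (w s)))).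
  apply: (@integrable_cylf _ _ _ (Px x) _ (fun w : cpath R => w s)) => //.
    exact: measurable_eval.
  by exists n; exact: level_chain_op.
have := m n _ s t c ln cs.
have mb : measurable [set w : cpath R | bits d (w (sum_nonneg s t))].
  exact: (measurable_at _ (measurable_bits d)).
have -> : \int[Px x]_(w in [set w | bits c (path_bit w)]) (bits d (w (sum_nonneg s t)))%:R =
    fine (Px x ([set w | bits c (path_bit w)] `&`
        [set w : cpath R | bits d (w (sum_nonneg s t))])).
  by under eq_Rintegral do rewrite -[_%:R]mul1r; rewrite Rintegral_bool// mul1r.
move=> E; rewrite -[LHS]fineK; last by apply: prob_fin; exact: measurableI.
by rewrite E /Rintegral fineK//; exact: integrable_fin_num.
Qed.

Lemma chain_markov x s t B F : measurable B -> past s F ->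
  Px x (F `&` [set w : cpath R | B (w (s%:num + t%:num)%:nng)]) =
  (\int[Px x]_(w in F) chain_kernel t (w s) B)%E.
Proof.
rewrite -/(sum_nonneg s t) => mB pF.
have mF := past_measurable pF.
have mk A : measurable A -> measurable_fun setT (fun w : cpath R => chain_marginal t (w s) A).
  move=> mA; have h : measurable_fun setT (fun y => chain_marginal t y A).
    by under eq_fun do rewrite chain_marginalE; exact: measurable_chain.
  exact: (measurableT_comp h (measurable_eval s)).
have kE A w : chain_kernel t (w s) A = chain_marginal t (w s) A.
  by rewrite chain_kernelE chain_marginalE.
under eq_integral do rewrite kE.
have meas := measurable_eval (sum_nonneg s t).
(* Two nested Dynkin arguments: over the target set, and, when the target is a bit event, over the
   event of the past. *)
move: B mB; apply: cantor_ind.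
- rewrite (_ : [set w | _] = setT)// setIT.
  under eq_integral do rewrite probability_setT.
  by rewrite integral_cst// mul1e.
- move=> d; have base c : before c s ->
      Px x ([set w | bits c (path_bit w)] `&` [set w : cpath R | bits d (w (sum_nonneg s t))]) =
      (\int[Px x]_(w in [set w | bits c (path_bit w)]) chain_marginal t (w s) [set y | bits d y])%E.
    by move=> cs; rewrite (chain_markov_bits _ _ _ cs); apply: eq_integral => w _.
  have baseT : Px x [set w : cpath R | bits d (w (sum_nonneg s t))] =
      (\int[Px x]_w chain_marginal t (w s) [set y | bits d y])%E.
    have := base [::]; rewrite (_ : [set w | bits [::] _] = setT); last first.
      by apply/seteqP; split.
    by rewrite setTI; apply.
  move: F pF {mF}; apply: past_ind.
  + by rewrite setTI.
  + by move=> c cs; exact: base.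
  + move=> F pF; have mF := past_measurable pF; apply: prob_eq_integralC => //.
    * exact: (measurable_at _ (measurable_bits d)).
    * by apply: mk; exact: measurable_bits.
  + move=> F pF tF FE; apply: prob_eq_integral_bigcup => //.
    * by move=> k; exact: past_measurable (pF k).
    * exact: (measurable_at _ (measurable_bits d)).
    * by apply: mk; exact: measurable_bits.
- by move=> B mB; exact: (kernel_eq_integralC meas mk mF mB).
- by move=> B mB tB; exact: (kernel_eq_integral_bigcup meas mk mF mB tB).
Qed.

Lemma chain_markov_family : markov_family chain_kernel Px.
Proof.
by split=> [x|x s t B F mB pF]; [exact: chain_start|exact: chain_markov].
Qed.

Lemma chain_markov_transition : markov_transition chain_kernel.
Proof.
split=> [x B mB|s t x B mB].
  rewrite chain_kernelE diracE.
  have m0 : measurable [set w : cpath R | w 0%:nng = x].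
    apply: (@measurable_at 0%:nng [set x]).
    rewrite (_ : [set x] = \bigcap_k [set y : cantor_space | y k = x k]).
      by apply: bigcapT_measurable => k; apply: (@level_measurable k.+1) => y z yz /=; rewrite yz.
    by apply/seteqP; split=> [y -> k _//|y h]; apply/funext => k; exact: (h k I).
  have mB0 := measurable_at 0%:nng mB.
  case: (boolP (x \in B)) => xB.
    apply/eqP; rewrite eq_le probability_le1//= -(chain_start x) le_measure ?inE//.
    by move=> w /= ->; exact: set_mem.
  apply/eqP; rewrite eq_le measure_ge0 andbT.
  have <- : Px x (~` [set w : cpath R | w 0%:nng = x]) = (false%:R)%:E.
    exact: prob_setC0 m0 (chain_start x).
  rewrite le_measure ?inE//; first exact: measurableC.
  by move=> w /= Bw wx; move/negP: xB; apply; rewrite inE -wx.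
(* The Chapman-Kolmogorov equation is the Markov property on the full event, transported to the law
   at time [s]. *)
have := @chain_markov x s t B setT mB.
rewrite setTI -/(sum_nonneg s t) chain_kernelE => ->.
  apply/esym/(ge0_integral_image (m := Px x) (measurable_eval s)) => //.
    by move=> A; rewrite chain_kernelE.
  by under eq_fun do rewrite chain_kernelE; exact: measurable_chain.
exact: pastT.
Qed.

Lemma chain_stochastically_continuous : stochastically_continuous chain_kernel.
Proof.
move=> A x oA Ax; have /nbhs_agree[n nA] : nbhs x A by exact: open_nbhs_nbhs.
pose d := [seq (i, x i) | i <- iota 0 n].
have dE y : bits d y -> agree n x y.
  move=> /allP h i ni; have := h (i, x i); rewrite /= => /(_ _)/eqP->//.
  by apply/mapP; exists i => //; rewrite mem_iota.
have dx : bits d x by apply/allP => p /mapP[i _ ->] /=.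
have [k lk] := level_bitsR d.
have mA : measurable A by exact: sub_sigma_algebra.
(* The probability of [A] is squeezed between 1 and the lower bound for the cylinder described by
   [d], which contains [x] and lies in [A]. *)
have low t : expR (- (total_rate gamma theta k * t%:num)) <= fine (chain_kernel t x A).
  apply: (@le_trans _ _ (U k t%:num (fun y => (bits d y)%:R) x)).
    have := chain_op_lower gamma theta x (nonneg_ge0 t) lk (fun y => ler0n _ _).
    by rewrite [bits d x]dx mulr1.
  rewrite -lee_fin -(chain_bits x t lk) chain_kernelE fineK; last first.
    by apply: prob_fin; exact: measurable_at.
  rewrite le_measure ?inE//; first exact: (measurable_at _ (measurable_bits d)).
    exact: measurable_at.
  by move=> w /= /dE; exact: nA.
have up t : fine (chain_kernel t x A) <= 1.
  rewrite -lee_fin chain_kernelE fineK; last by apply: prob_fin; exact: measurable_at.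
  by apply: probability_le1; exact: measurable_at.
pose e (r : R) := expR (- (total_rate gamma theta k * `|r|)).
have e0 : e 0 = 1 by rewrite /e normr0 mulr0 oppr0 expR0.
have ecv : e r @[r --> (0 : R)^'+] --> (1 : R).
  rewrite -e0; apply: cvg_at_right_filter.
  apply: (@cvg_comp _ _ _ (fun r : R => - (total_rate gamma theta k * `|r|)) expR).
    apply: cvgN; apply: cvgMl_tmp; apply: cvg_norm; exact: cvg_id.
  exact: continuous_expR.
have near_e : \forall r \near (0 : R)^'+, e r <= fine (chain_kernel (nabs r) x A) <= cst 1 r.
  by apply: nearW => r; apply/andP; split; [exact: (low (nabs r))|exact: (up (nabs r))].
have cv : fine (chain_kernel (nabs r) x A) @[r --> (0 : R)^'+] --> (1 : R).
  exact: (squeeze_cvgr near_e ecv (cvg_cst _)).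
have fin t : chain_kernel t x A = (fine (chain_kernel t x A))%:E.
  by rewrite fineK// chain_kernelE prob_fin//; exact: measurable_at.
change (chain_kernel (nabs r) x A @[r --> (0 : R)^'+] --> 1%E).
rewrite (_ : (fun r => _) = fun r => (fine (chain_kernel (nabs r) x A))%:E); last first.
  by apply/funext => r; exact: fin.
by apply: cvg_EFin; [exact: nearW|exact: cv].
Qed.

End chain_family.

(** * General transition functions and uniqueness *)

Section general_kernel.
Context {R : realType}.
Variable P : {nonneg R} -> R.-pker cantor_space ~> cantor_space.
Implicit Types (f g : cantor_space -> R) (s t : {nonneg R}) (x : cantor_space).

Definition kernel_prob t x : probability cantor_space R :=
  projT1 (cid (measure_probability (@prob_kernel _ _ _ _ _ (P t) x))).

Lemma kernel_probE t x A : kernel_prob t x A = P t x A.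
Proof. by rewrite /kernel_prob; case: cid => Q /= ->. Qed.

Lemma semigroupE t f x : semigroup P t f x = \int[kernel_prob t x]_y f y.
Proof.
rewrite /semigroup /Rintegral; congr fine; apply: eq_measure_integral => A _ _.
exact: (esym (kernel_probE _ _ _)).
Qed.

Lemma semigroup_add t f g : cylf f -> cylf g ->
  semigroup P t (fun y => f y + g y) = fun x => semigroup P t f x + semigroup P t g x.
Proof.
move=> cf cg; apply/funext => x; rewrite !semigroupE.
by rewrite (cylf_RintegralD (kernel_prob t x) measurableT (@measurable_id _ _ _) cf cg).
Qed.

Lemma semigroup_scale t a f : cylf f ->
  semigroup P t (fun y => a * f y) = fun x => a * semigroup P t f x.
Proof.
move=> cf; apply/funext => x; rewrite !semigroupE RintegralZl//.
exact: (integrable_cylf (kernel_prob t x) measurableT (@measurable_id _ _ _) cf).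
Qed.

Lemma semigroup_bits t a (d : seq (nat * bool)) x :
  semigroup P t (fun y => a * (bits d y)%:R) x = a * fine (P t x [set y | bits d y]).
Proof.
rewrite semigroupE (Rintegral_bits (kernel_prob t x) a d measurableT (@measurable_id _ _ _)).
by rewrite setTI kernel_probE.
Qed.

Lemma semigroup_norm t f b x : measurable_fun setT f -> (forall y, `|f y| <= b) ->
  `|semigroup P t f x| <= b.
Proof.
move=> mf fb; rewrite semigroupE.
apply: le_trans (le_Rintegral_norm (kernel_prob t x) measurableT mf (fun y _ => fb y)) _.
rewrite (_ : fine _ = 1) ?mulr1//.
by have := probability_setT (kernel_prob t x) => /= ->.
Qed.

Lemma measurable_semigroup t f : cylf f -> measurable_fun setT (semigroup P t f).
Proof.
move=> cf; apply: (level_lin (P := fun f => measurable_fun setT (semigroup P t f))) cf.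
  move=> a d; rewrite (funext (semigroup_bits t a d)).
  apply: measurable_funM => //; apply: measurableT_comp => //.
  exact: measurable_kernel (measurable_bits d).
move=> g h cg ch mg mh; rewrite semigroup_add//; exact: measurable_funD.
Qed.

Lemma bounded_semigroup t f : cylf f -> exists b, forall x, `|semigroup P t f x| <= b.
Proof.
move=> cf; have [b _ fb] := cylf_bounded cf; exists b => x.
by apply: semigroup_norm => //; exact: cylf_measurable.
Qed.

Lemma markov_int (Px : cantor_space -> probability (cpath R) R) x s t F g :
  markov_family P Px -> past s F -> cylf g ->
  \int[Px x]_(w in F) g (w (sum_nonneg s t)) =
  \int[Px x]_(w in F) semigroup P t g (w s).
Proof.
move=> [_ mP] pF cg; have mF := past_measurable pF.
have msg f : cylf f -> (Px x).-integrable F (EFin \o (fun w : cpath R => semigroup P t f (w s))).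
  move=> cf; apply: integrable_bounded => //.
    apply: measurable_funTS.
    exact: (measurableT_comp (measurable_semigroup t cf) (measurable_eval s)).
  by have [b fb] := bounded_semigroup t cf; exists b => w _; exact: fb.
have me := @measurable_eval R (sum_nonneg s t).
apply: (level_lin (P := fun g => \int[Px x]_(w in F) g (w (sum_nonneg s t)) =
  \int[Px x]_(w in F) semigroup P t g (w s))) cg.
  move=> a d; have mb := measurable_bits d.
  rewrite (Rintegral_bits (Px x) a d mF me) (mP x s t _ F mb pF).
  have mk : measurable_fun setT (fun w : cpath R => P t (w s) [set y | bits d y]).
    exact: (measurableT_comp (measurable_kernel (P t) _ mb) (measurable_eval s)).
  have kE y : P t y [set y | bits d y] = (fine (P t y [set y | bits d y]))%:E.
    by rewrite fineK// -kernel_probE prob_fin.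
  under [RHS]eq_Rintegral do rewrite semigroup_bits.
  rewrite RintegralZl//; last first.
    have := msg _ (cylf_bitsR d); congr (integrable _ _ _); apply/funext => w /=.
    have := semigroup_bits t 1 d (w s); rewrite mul1r => <-.
    by congr (_ %:E); congr (semigroup P t _ _); apply/funext => y; rewrite mul1r.
  by congr (_ * _); rewrite /Rintegral; congr fine; apply: eq_integral => w _; exact: kE.
move=> f h cf ch Ef Eh.
rewrite (cylf_RintegralD (Px x) mF me cf ch) Ef Eh semigroup_add//.
by rewrite -RintegralD//; exact: msg.
Qed.

Lemma chapman_kolmogorov s t g : markov_transition P -> cylf g ->
  semigroup P (sum_nonneg s t) g = semigroup P s (semigroup P t g).
Proof.
move=> [_ CK] cg; apply/funext => x; rewrite [RHS]semigroupE.
have int f : cylf f -> (kernel_prob s x).-integrable setT (EFin \o semigroup P t f).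
  move=> cf; apply: integrable_bounded => //; first exact: measurable_semigroup.
  by have [b fb] := bounded_semigroup t cf; exists b => w _; exact: fb.
apply: (level_lin (P := fun g => semigroup P (sum_nonneg s t) g x =
  \int[kernel_prob s x]_y semigroup P t g y)) cg.
  move=> a d; have mb := measurable_bits d.
  rewrite semigroup_bits (CK s t x _ mb).
  under [RHS]eq_Rintegral do rewrite semigroup_bits.
  rewrite RintegralZl//; last first.
    have := int _ (cylf_bitsR d); congr (integrable _ _ _); apply/funext => y /=.
    have := semigroup_bits t 1 d y; rewrite mul1r => <-.
    by congr (_ %:E); congr (semigroup P t _ _); apply/funext => z; rewrite mul1r.
  congr (_ * _); rewrite /Rintegral; congr fine.
  rewrite (eq_measure_integral (kernel_prob s x)); last first.
    by move=> A _ _; exact: (esym (kernel_probE _ _ _)).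
  by apply: eq_integral => y _; rewrite fineK// -kernel_probE prob_fin.
move=> f h cf ch Ef Eh.
by rewrite !semigroup_add// Ef Eh RintegralD//; exact: int.
Qed.

End general_kernel.

(** * Continuous functions as uniform limits of cylinder functions *)

Section uniform_approximation.
Context {R : realType}.
Implicit Types (f : cantor_space -> R) (x y : cantor_space) (n : nat).

(** Uniform continuity, from compactness in its near-covering form. *)
Lemma agree_uniform f e : continuous f -> 0 < e ->
  exists n, forall x y, agree n x y -> `|f x - f y| < e.
Proof.
move=> cf e0; have /compact_near_coveringP ncov := cantor_space_compact.
have [n _ /(_ n (leqnn n)) Hn] : \forall n \near \oo, [set: cantor_space] `<=`
    (fun x => forall y, agree n x y -> `|f x - f y| < e).
  apply: ncov => x _.
  have e2 : 0 < e / 2 by rewrite divr_gt0.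
  have /nbhs_agree[k Hk] : nbhs x [set y | `|f x - f y| < e / 2].
    by have /cvgrPdist_lt/(_ _ e2) := cf x.
  have near_k : \forall n \near \oo, (k <= n)%N by exists k.
  have near_x : \forall x' \near x, agree k x x' by apply/nbhs_agree; exists k.
  exists ([set x' | agree k x x'], [set n | (k <= n)%N]); first by split.
  move=> [x' n] /= [xx' kn] y x'y.
  have h1 := Hk _ xx'; have h2 := Hk _ (agree_trans xx' (agreeW kn x'y)).
  rewrite /= in h1 h2.
  rewrite (_ : f x' - f y = (f x - f y) - (f x - f x')); last by ring.
  by apply: le_lt_trans (ler_normB _ _) _; rewrite [e]splitr addrC ltrD.
by exists n => x y; exact: Hn.
Qed.

Definition truncate n x : cantor_space := fun i => if (i < n)%N then x i else false.

Lemma agree_truncate n x : agree n x (truncate n x).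
Proof. by move=> i ni; rewrite /truncate ni. Qed.

Lemma level_truncate (T : Type) n (f : cantor_space -> T) : level n (f \o truncate n).
Proof.
move=> x y xy /=; congr f; apply/funext => i; rewrite /truncate.
by case: ltnP => // /xy.
Qed.

Lemma continuous_measurable f : continuous f -> measurable_fun setT f.
Proof.
move=> cf; apply: (@measurable_fun_cvg _ _ _ _ (fun n => f \o truncate n)).
  by move=> n; apply: cylf_measurable; exists n; exact: level_truncate.
move=> x _; apply/cvgrPdist_lt => e e0; have [n Hn] := agree_uniform cf e0.
by exists n => // m nm; apply: Hn; exact: (agreeW nm (@agree_truncate m x)).
Qed.

Lemma continuous_bounded f : continuous f -> exists b, forall x, `|f x| <= b.
Proof.
move=> cf; have [n Hn] := agree_uniform cf ltr01.
have [b b0 Hb] := level_bounded (level_truncate f (n := n)).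
exists (b + 1) => x; rewrite -(subrK (f (truncate n x)) (f x)) addrC.
apply: le_trans (ler_normD _ _) _; rewrite lerD ?Hb// ltW// Hn//.
exact: agree_truncate.
Qed.

Lemma generatorP (P : {nonneg R} -> R.-pker cantor_space ~> cantor_space) f f' :
  generator P f f' <-> [/\ continuous f, continuous f' &
    forall e, 0 < e -> \forall t \near (0 : R)^'+,
      forall x, `|(semigroup P (nabs t) f x - f x) / t - f' x| < e].
Proof.
split=> -[cf cf' H]; split => //.
  move=> e e0; pose E := [set ab : R * R | ball ab.1 e ab.2].
  have entE : entourage E by exact: (@entourage_ball _ R (PosNum e0)).
  have nb : nbhs (f' : {uniform cantor_space -> R}) [set h | forall y, E (f' y, h y)].
    by apply/uniform_nbhs; exists E; split => // h Hh y; exact: Hh.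
  have H1 : \forall t \near (0 : R)^'+, forall y,
      E (f' y, (semigroup P (nabs t) f y - f y) / t) := H _ nb.
  by apply: (filterS _ H1) => t Ht x; have := Ht x; rewrite /E /= /ball /= distrC.
move=> A /uniform_nbhs[E [entE EA]].
have [e /= e0 eE] : exists2 e : R, 0 < e & [set ab : R * R | ball ab.1 e ab.2] `<=` E.
  by move: entE; rewrite -entourage_ballE => -[e e0 eE]; exists e.
change (\forall t \near (0 : R)^'+, A (fun x => (semigroup P (nabs t) f x - f x) / t)).
apply: (filterS _ (H e e0)) => t Ht; apply: EA => x _; apply: eE.
by rewrite /= /ball /= distrC.
Qed.

End uniform_approximation.

(** * The operator A in the Haar decomposition *)

Section operA_recursion.
Context {R : realType} (gamma theta : {nonneg R}).
Local Notation G := (chain_gen gamma theta).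
Local Notation first_diff := Defs.first_diff.
Implicit Types (x : cantor_space) (n k : nat) (b : bool).

Definition snoc n (u : n.-tuple bool) b : n.+1.-tuple bool := [tuple of rcons u b].

Lemma nth_snoc n (u : n.-tuple bool) b i :
  nth false (snoc u b) i = if (i < n)%N then nth false u i else if i == n then b else false.
Proof. by rewrite /snoc /= nth_rcons size_tuple. Qed.

Lemma nth_coords n x i : (i < n)%N -> nth false (coords n x) i = x i.
Proof. by move=> ni; exact: (nth_mktuple (fun i : 'I_n => x i) false (Ordinal ni)). Qed.

Lemma coords_snoc n x : coords n.+1 x = snoc (coords n x) (x n).
Proof.
apply: eq_from_tnth => i; rewrite tnth_mktuple (tnth_nth false) nth_snoc.
have := ltn_ord i; rewrite ltnS leq_eqVlt => /orP[/eqP ->|ni].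
  by rewrite ltnn eqxx.
by rewrite ni nth_coords.
Qed.

Lemma sum_snoc n (F : n.+1.-tuple bool -> R) :
  \sum_v F v = \sum_(u : n.-tuple bool) (F (snoc u false) + F (snoc u true)).
Proof.
rewrite (reindex (fun p : n.-tuple bool * bool => snoc p.1 p.2)) /=.
  rewrite -(pair_bigA _ (fun u b => F (snoc u b))) /=.
  by apply: eq_bigr => u _; rewrite big_bool addrC.
exists (fun v : n.+1.-tuple bool => ([tuple nth false v i | i < n], nth false v n)).
  move=> [u b] _; congr pair; last by rewrite nth_snoc ltnn eqxx.
  apply: eq_from_tnth => i; rewrite tnth_mktuple nth_snoc ltn_ord.
  by rewrite -tnth_nth.
move=> v _; apply: eq_from_tnth => i; rewrite !(tnth_nth false) nth_snoc.
have := ltn_ord i; rewrite ltnS leq_eqVlt => /orP[/eqP ->|ni].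
  by rewrite ltnn eqxx.
by rewrite ni; exact: (nth_mktuple (fun i : 'I_n => nth false v i) false (Ordinal ni)).
Qed.

(** The added letter matters only for the word that agrees with [x] so far; there [n.+2] is the
    value for no difference at all. *)
Lemma first_diff_snoc n x (u : n.-tuple bool) b :
  first_diff x (snoc u b) =
  if u == coords n x then (if b == x n then n.+2 else n.+1) else first_diff x u.
Proof.
have iE : iota 0 n.+1 = iota 0 n ++ [:: n] by rewrite -addn1 iotaD.
rewrite /first_diff iE find_cat.
have -> : has (fun i => x i != nth false (snoc u b) i) (iota 0 n) =
    has (fun i => x i != nth false u i) (iota 0 n).
  apply: eq_in_has => i; rewrite mem_iota add0n => /andP[_ ni].
  by rewrite nth_snoc ni.
have -> : find (fun i => x i != nth false (snoc u b) i) (iota 0 n) =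
    find (fun i => x i != nth false u i) (iota 0 n).
  apply: eq_in_find => i; rewrite mem_iota add0n => /andP[_ ni].
  by rewrite nth_snoc ni.
have -> : has (fun i => x i != nth false u i) (iota 0 n) = (u != coords n x).
  apply/hasP/idP.
    move=> [i]; rewrite mem_iota add0n => /andP[_ ni] /eqP xi; apply/eqP => uE; apply: xi.
    by rewrite uE nth_coords.
  move=> /eqP uE; apply: contrapT => H; apply: uE; apply: eq_from_tnth => i.
  rewrite tnth_mktuple (tnth_nth false); apply/eqP/negPn/negP => ui; apply: H.
  by exists (i : nat); rewrite ?mem_iota ?add0n ?ltn_ord// eq_sym.
case: eqP => //= _; rewrite nth_snoc ltnn eqxx size_iota eq_sym.
by case: eqP => _ /=; rewrite ?addn0 ?addn1.
Qed.

Definition mean_last n (h : n.+1.-tuple bool -> R) (u : n.-tuple bool) : R :=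
  (h (snoc u false) + h (snoc u true)) / 2.

Lemma mean_coords n (h : n.+1.-tuple bool -> R) :
  mean n (h \o coords n.+1) = mean_last h \o coords n.
Proof.
apply/funext => x; rewrite /mean /= /mean_last !coords_snoc.
have -> : coords n (flip n x) = coords n x by apply/level_coords; exact: agree_flip.
by rewrite /flip setc_eq; case: (x n) => //=; rewrite addrC.
Qed.

Lemma first_diff_self n x : first_diff x (coords n x) = n.+1.
Proof.
elim: n => [//|n IH]; by rewrite coords_snoc first_diff_snoc !eqxx.
Qed.

(** Words that differ from [x] before the last letter come in pairs; the extra factor 1/2 in the
    normalization turns each pair into its mean. *)
Lemma avg_le n (h : n.+1.-tuple bool -> R) k x : (k <= n)%N ->
  avg h k x = avg (mean_last h) k x.
Proof.
move=> kn; rewrite /avg big_mkcond sum_snoc [in RHS]big_mkcond subSn// exprS invfM.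
rewrite -mulrA mulrCA; congr (_ * _); rewrite mulr_sumr; apply: eq_bigr => u _.
rewrite !first_diff_snoc; have [->|un] := eqVneq u (coords n x).
  have nk : (n.+1 == k) = false by rewrite gtn_eqF// ltnS.
  have nk2 : (n.+2 == k) = false by rewrite gtn_eqF// ltnS leqW.
  by rewrite first_diff_self nk; case: (x n); rewrite /= ?nk ?nk2 addr0 mulr0.
by case: eqP => _; rewrite /mean_last ?addr0 ?mulr0// mulrC.
Qed.

Lemma avg_last n (h : n.+1.-tuple bool -> R) x :
  avg h n.+1 x = h (coords n.+1 (flip n x)).
Proof.
rewrite /avg subnn invr1 mul1r big_mkcond sum_snoc (bigD1 (coords n x))//= big1.
  rewrite !first_diff_snoc eqxx coords_snoc addr0.
  have -> : coords n (flip n x) = coords n x by apply/level_coords; exact: agree_flip.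
  rewrite /flip setc_eq; case: (x n) => /=;
    by rewrite !eqxx /= gtn_eqF ?addr0 ?add0r.
move=> u ux; rewrite !first_diff_snoc (negbTE ux).
suff -> : (first_diff x u == n.+1) = false by rewrite addr0.
apply/negP => /eqP E; move/negP: ux; apply; apply/eqP.
apply: eq_from_tnth => i; rewrite tnth_mktuple (tnth_nth false).
move: E; rewrite /first_diff => -[] fE.
have := before_find 0%N (i := i) (a := fun i => x i != nth false u i) (s := iota 0 n).
by rewrite fE ltn_ord => /(_ isT); rewrite nth_iota// add0n => /negbFE/eqP.
Qed.

(** This explains the eigenvalues. A jump at k <= n randomizes the last coordinate and kills its
    Haar component, at total rate [total_rate n]; the jump at n + 1 is the flip and changes the sign
    of that component, which counts its rate twice. *)
Lemma operAE n (h : n.-tuple bool -> R) x :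
  operA gamma%:num theta%:num h x = G n (h \o coords n) x.
Proof.
elim: n h x => [|n IH] h x; first by rewrite /operA big_geq// mulr0.
rewrite /= mean_coords -IH /operA big_nat_recr//= mulrDr.
set f := h (coords n.+1 x).
have -> : \sum_(1 <= k < n.+1) theta%:num ^+ k * (avg h k x - f) =
    \sum_(1 <= k < n.+1) theta%:num ^+ k * (avg (mean_last h) k x - mean_last h (coords n x)) +
    (mean_last h (coords n x) - f) * \sum_(1 <= k < n.+1) theta%:num ^+ k.
  rewrite mulr_sumr -big_split /=; apply: eq_big_nat => k /andP[_ kn].
  by rewrite avg_le// ; ring.
rewrite mulrDr -addrA; congr (_ + _).
have mE : mean_last h (coords n x) = mean n (h \o coords n.+1) x by rewrite mean_coords.
have fE : f = mean n (h \o coords n.+1) x + hdiff n (h \o coords n.+1) x by rewrite meanD.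
have -> : gamma%:num * ((mean_last h (coords n x) - f) * \sum_(1 <= k < n.+1) theta%:num ^+ k) =
    (mean_last h (coords n x) - f) * total_rate gamma theta n.
  rewrite mulrCA; congr (_ * _); rewrite /total_rate big_add1 /= big_mkord mulr_sumr.
  by apply: eq_bigr.
rewrite avg_last mE /decay /rate.
have -> : h (coords n.+1 (flip n x)) - f = - 2 * hdiff n (h \o coords n.+1) x.
  by rewrite /hdiff /f /=; field.
by rewrite fE; ring.
Qed.

End operA_recursion.

(** * Semigroups determined by their generator on cylinder functions *)

Section generator_semigroup.
Context {R : realType}.
Variable P : {nonneg R} -> R.-pker cantor_space ~> cantor_space.
Implicit Types (f g : cantor_space -> R) (s t : {nonneg R}) (x : cantor_space).

Lemma semigroup_dist t f g b x : measurable_fun setT f -> measurable_fun setT g ->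
  (exists c, forall y, `|f y| <= c) -> (exists c, forall y, `|g y| <= c) ->
  (forall y, `|f y - g y| <= b) ->
  `|semigroup P t f x - semigroup P t g x| <= b.
Proof.
move=> mf mg [c fc] [c' gc] fg; rewrite !semigroupE -RintegralB//; last 2 first.
- by apply: integrable_bounded => //; exists c => y _; exact: fc.
- by apply: integrable_bounded => //; exists c' => y _; exact: gc.
rewrite -semigroupE; apply: semigroup_norm => //; exact: measurable_funB.
Qed.

(** The semigroup is a sup-norm contraction, so a uniform approximation of [f] by a cylinder
    function is inherited by the images, and the image of the cylinder function is locally
    constant. *)
Lemma semigroup_feller t f : continuous f ->
  (forall n g, level n g -> level n (semigroup P t g)) -> continuous (semigroup P t f).
Proof.
move=> cf lev x; apply/cvgrPdist_lt => e e0.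
have e3 : 0 < e / 3 by rewrite divr_gt0.
have [n Hn] := agree_uniform cf e3.
have lfn := level_truncate f (n := n).
have cfn : cylf (f \o truncate n) by exists n.
have close y : `|semigroup P t f y - semigroup P t (f \o truncate n) y| <= e / 3.
  apply: semigroup_dist.
  - exact: continuous_measurable.
  - exact: cylf_measurable.
  - exact: continuous_bounded.
  - by have [b _ Hb] := cylf_bounded cfn; exists b.
  - by move=> z; apply/ltW/Hn; exact: agree_truncate.
apply/nbhs_agree; exists n => y xy /=.
have := close x; have := close y; rewrite (lev _ _ lfn _ _ xy).
set a := semigroup P t f x; set b := semigroup P t f y; set c := semigroup _ _ _ y.
move=> h1 h2; rewrite (_ : a - b = (a - c) - (b - c)); last by ring.
apply: le_lt_trans (ler_normB _ _) _; apply: le_lt_trans (lerD h2 h1) _; lra.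
Qed.

Lemma semigroup0 g : markov_transition P -> cylf g -> semigroup P 0%:nng g = g.
Proof.
move=> [P0 _] cg; apply/funext => x.
apply: (level_lin (P := fun g => semigroup P 0%:nng g x = g x)) cg.
  move=> a d; rewrite semigroup_bits P0 ?diracE; last exact: measurable_bits.
  by have -> : (x \in [set y | bits d y]) = bits d x by apply/idP/idP; rewrite inE.
by move=> f h cf ch Ef Eh; rewrite semigroup_add// Ef Eh.
Qed.

End generator_semigroup.

Section generated_semigroup.
Context {R : realType} (gamma theta : {nonneg R}).
Local Notation U := (chain_op gamma theta).
Local Notation G := (chain_gen gamma theta).
Implicit Types (f g : cantor_space -> R) (s t : {nonneg R}) (x : cantor_space) (n : nat).

(** A section of [coords n], padding with [false]; it presents a function of level [n] as a function
    of words. *)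
Definition extend n (v : n.-tuple bool) : cantor_space := fun i => nth false v i.

Lemma level_factor (T : Type) n (f : cantor_space -> T) : level n f ->
  f = (f \o @extend n) \o coords n.
Proof.
move=> lf; apply/funext => x /=; apply: lf => i ni.
by rewrite /extend nth_coords.
Qed.

Lemma level_chain_gen n f : level n f -> level n (G n f).
Proof.
suff H : forall k, (n <= k)%N -> level k f -> level k (G n f) by exact: H.
elim: n f => [//|n IH] f k nk lf x y xy /=.
rewrite (IH _ _ (ltnW nk) (level_mean_le nk lf) _ _ xy).
by rewrite (level_hdiff nk lf xy).
Qed.

Lemma chain_gen0 n : G n (fun=> 0) = fun=> 0.
Proof.
elim: n => [//|n IH]; apply/funext => x /=.
rewrite (_ : mean n _ = fun=> 0); last by apply/funext => y; rewrite /mean addr0 mul0r.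
by rewrite IH /hdiff subrr mul0r mulr0 subr0.
Qed.

Section one_kernel.
Variable P : {nonneg R} -> R.-pker cantor_space ~> cantor_space.
Hypothesis mP : markov_transition P.
Hypothesis genP : forall n (h : n.-tuple bool -> R), (0 < n)%N ->
  generator P (h \o coords n) (operA gamma%:num theta%:num h).

(** Only the derivative at time 0 is given, uniformly in the point. One short step [h] then agrees
    with the exponential up to [e h], and by the semigroup law [t / h] steps agree up to [e t], with
    [e] arbitrary. *)
Lemma eigenfunction_semigroup n f t : level n.+1 f ->
  semigroup P t (hdiff n f) = fun x => expR (- (decay gamma theta n * t%:num)) * hdiff n f x.
Proof.
move=> lf; set psi := hdiff n f; set mu := decay gamma theta n.
have lpsi : level n.+1 psi by exact: level_hdiff.
have cpsi : cylf psi by exists n.+1.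
have mpsi : measurable_fun setT psi by exact: cylf_measurable.
have [b b0 psib] := cylf_bounded cpsi.
have mu0 : 0 <= mu by exact: decay_ge0.
have /generatorP[_ _ gen] : generator P psi (fun x => - (mu * psi x)).
  have := genP (psi \o @extend n.+1) (ltn0Sn n).
  rewrite -(level_factor lpsi); congr (generator P _ _); apply/funext => x.
  rewrite operAE -(level_factor lpsi) /= mean_hdiff hdiff_hdiff chain_gen0.
  by rewrite sub0r.
have step e : 0 < e -> exists2 d, 0 < d & forall h, 0 < h%:num < d -> forall x,
    `|semigroup P h psi x - expR (- (mu * h%:num)) * psi x| <= e * h%:num.
  move=> e0; have e2 : 0 < e / 2 by rewrite divr_gt0.
  (* [mu ^+ 2 * b] bounds the second-order error of the exponential and 1 keeps [K] positive. One
     half of [e] pays for this error, the other for the limit defining the generator. *)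
  pose K := mu ^+ 2 * b + 1; have K0 : 0 < K by rewrite ltr_wpDl// mulr_ge0// sqr_ge0.
  have [d /= d0 Hd] : exists2 d : R, 0 < d & forall r, 0 < r < d ->
      forall x, `|(semigroup P (nabs r) psi x - psi x) / r - - (mu * psi x)| < e / 2.
    have := gen _ e2; rewrite /at_right /within /= near_withinE near_simpl.
    move=> /nbhs_ballP[d /= d0 Hd]; exists d => // r /andP[r0 rd]; apply: Hd => //.
    by rewrite /ball /= sub0r normrN gtr0_norm.
  exists (Num.min d (e / 2 / K)) => [|h]; first by rewrite lt_min d0 /= divr_gt0.
  rewrite lt_min => /and3P[h0 hd hK] x.
  have := Hd _ (introT andP (conj h0 hd)) x.
  have -> : nabs h%:num = h by apply/val_inj; rewrite /= ger0_norm.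
  set S := semigroup P h psi x => HS.
  have HS' : `|S - psi x + h%:num * (mu * psi x)| <= e / 2 * h%:num.
    rewrite (_ : S - psi x + _ = ((S - psi x) / h%:num - - (mu * psi x)) * h%:num).
      by rewrite normrM (gtr0_norm h0) ler_pM2r// ltW.
    by field; exact: lt0r_neq0.
  have HE : `|(expR (- (mu * h%:num)) - 1 + mu * h%:num) * psi x| <= e / 2 * h%:num.
    rewrite normrM; apply: (@le_trans _ _ ((mu * h%:num) ^+ 2 * b)).
      by apply: ler_pM => //; apply: expRN_taylor; rewrite mulr_ge0.
    rewrite (_ : (mu * h%:num) ^+ 2 * b = (mu ^+ 2 * b * h%:num) * h%:num); last by ring.
    rewrite ler_pM2r//; move: hK; rewrite ltr_pdivlMr// => hK.
    apply: le_trans (ltW hK); rewrite mulrC ler_pM2l// /K lerDl.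
    exact: ler01.
  rewrite (_ : S - _ = (S - psi x + h%:num * (mu * psi x)) -
      (expR (- (mu * h%:num)) - 1 + mu * h%:num) * psi x); last by ring.
  by apply: le_trans (ler_normB _ _) _; apply: le_trans (lerD HS' HE) _; rewrite -mulrDl -splitr.
(* The semigroup contracts and the exponential factor is at most 1, so earlier errors do not grow
   and [j] steps cost at most [j] times one step. *)
have iterate e h :
    (forall x, `|semigroup P h psi x - expR (- (mu * h%:num)) * psi x| <= e * h%:num) ->
    forall j x, `|semigroup P (times j h) psi x -
      expR (- (mu * (j%:R * h%:num))) * psi x| <= e * (j%:R * h%:num).
  move=> Hh; elim=> [|j IH] x.
    have -> : times 0 h = 0%:nng by apply/val_inj; rewrite /= mul0r.
    by rewrite semigroup0// mul0r !mulr0 oppr0 expR0 mul1r subrr normr0.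
  rewrite timesS.
  rewrite chapman_kolmogorov//.
  have mSh : measurable_fun setT (semigroup P h psi) by exact: measurable_semigroup.
  have mE : measurable_fun setT (fun y => expR (- (mu * h%:num)) * psi y) by exact: measurable_funM.
  have bE : exists c, forall y, `|expR (- (mu * h%:num)) * psi y| <= c.
    exists (expR (- (mu * h%:num)) * b) => y.
    by rewrite normrM ger0_norm ?expR_ge0// ler_wpM2l// expR_ge0.
  have := semigroup_dist P (times j h) x mSh mE (bounded_semigroup P h cpsi) bE Hh.
  rewrite semigroup_scale//; have := IH x.
  set A := semigroup P _ psi x; set B := semigroup P _ (semigroup P h psi) x.
  have eh : expR (- (mu * h%:num)) <= 1.
    by rewrite -expR0 ler_expR oppr_le0 mulr_ge0.
  have -> : expR (- (mu * (j.+1%:R * h%:num))) =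
      expR (- (mu * h%:num)) * expR (- (mu * (j%:R * h%:num))).
    by rewrite -expRD; congr expR; rewrite -natr1; ring.
  set E1 := expR (- (mu * h%:num)); set E2 := expR _ => HA HB.
  rewrite (_ : B - _ = (B - E1 * A) + E1 * (A - E2 * psi x)); last by ring.
  apply: le_trans (ler_normD _ _) _; rewrite -natr1 mulrDl mul1r mulrDr addrC lerD//.
  rewrite normrM ger0_norm ?expR_ge0//; apply: le_trans HA.
  by rewrite ler_piMl.
apply/funext => x; apply/eqP; rewrite -subr_eq0 -normr_le0.
have [t0|t0] := eqVneq t%:num 0.
  have -> : t = 0%:nng by apply/val_inj.
  by rewrite semigroup0//= mulr0 oppr0 expR0 mul1r subrr normr0.
have tpos : 0 < t%:num by rewrite lt_def t0 /=.
apply/ler_addgt0Pl => e e0; rewrite addr0.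
have et : 0 < e / t%:num by rewrite divr_gt0.
have [d d0 Hd] := step _ et.
pose N := (Num.truncn (t%:num / d)).+1.
have tN : t%:num / N%:R < d.
  rewrite ltr_pdivrMr ?ltr0n// mulrC -ltr_pdivrMr//.
  by have /andP[] := truncn_itv (divr_ge0 (ltW tpos) (ltW d0)).
have hge : 0 <= t%:num / N%:R by rewrite divr_ge0.
pose h : {nonneg R} := NngNum hge.
have h0 : 0 < h%:num < d by rewrite /= tN divr_gt0// ltr0n.
have := iterate _ _ (Hd h h0) N x.
have -> : times N h = t by apply/val_inj => /=; rewrite mulrC mulfVK// pnatr_eq0.
have -> : N%:R * h%:num = t%:num by rewrite /= mulrC mulfVK// pnatr_eq0.
by move=> H; apply: le_trans H _; rewrite mulfVK.
Qed.

Lemma generated_semigroupE n f t : level n f -> semigroup P t f = U n t%:num f.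
Proof.
elim: n f => [|n IH] f lf.
  have -> : f = fun y => f point * (bits [::] y)%:R.
    by apply/funext => y; rewrite mulr1; exact: lf.
  apply/funext => x; rewrite semigroup_bits -kernel_probE.
  rewrite (_ : [set y | _] = setT); last by apply/seteqP; split.
  by have -> : kernel_prob P t x setT = 1%E by exact: probability_setT.
have lm := level_mean lf; have lh := level_hdiff (ltnSn n) lf.
have -> : f = fun y => mean n f y + hdiff n f y by apply/funext => y; rewrite meanD.
rewrite semigroup_add; [|by exists n|by exists n.+1].
rewrite IH// eigenfunction_semigroup//.
by apply/funext => x /=; under [in RHS]eq_fun do rewrite meanD.
Qed.

(** Uniqueness follows: every admissible family satisfies the conditions that determine the law of
    the chain. *)
Lemma generated_chain_law Px x : markov_family P Px -> chain_law gamma theta x (Px x).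
Proof.
move=> mF; split=> [g cg|n g s t c lg cs].
  have m0 : measurable [set w : cpath R | w 0%:nng = x].
    have := @measurable_at R 0%:nng [set x]; apply.
    rewrite (_ : [set x] = \bigcap_k [set y : cantor_space | y k = x k]).
      by apply: bigcapT_measurable => k; apply: (@level_measurable k.+1) => y z yz /=; rewrite yz.
    by apply/seteqP; split=> [y -> k _//|y h]; apply/funext => k; exact: (h k I).
  rewrite (Rintegral_full m0 (proj1 mF x)); last 2 first.
  - exact: cylf_path_measurable.
  - exact: cylf_path_bounded.
  rewrite (@eq_Rintegral _ _ _ _ _ (fun=> g x)); last by move=> w; rewrite inE /= => ->.
  by rewrite Rintegral_cst// [X in fine X](proj1 mF x) mulr1.
rewrite (@markov_int R P Px x s t _ g mF) ?(generated_semigroupE _ lg)//; last by exists n.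
by rewrite /past path_eventsE; apply: sub_sigma_algebra; exists c.
Qed.

End one_kernel.
End generated_semigroup.

(** * Generator and isometries *)

Section chain_generator.
Context {R : realType} (gamma theta : {nonneg R}).
Local Notation U := (chain_op gamma theta).
Local Notation G := (chain_gen gamma theta).
Variable Px : cantor_space -> probability (cpath R) R.
Hypothesis HPx : forall x, chain_law gamma theta x (Px x).

Lemma chain_feller : feller (chain_kernel HPx).
Proof.
move=> t f cf; apply: semigroup_feller => // n g lg.
by rewrite (chain_semigroup HPx _ lg); exact: level_chain_op.
Qed.

Lemma chain_generator n (h : n.-tuple bool -> R) :
  generator (chain_kernel HPx) (h \o coords n) (operA gamma%:num theta%:num h).
Proof.
set f := h \o coords n.
have lf : level n f by move=> x y xy; rewrite /f /=; congr h; exact/level_coords.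
rewrite (_ : operA _ _ _ = G n f); last by apply/funext => x; exact: operAE.
apply/generatorP; split;
  [exact: level_continuous lf|exact: (level_continuous (level_chain_gen _ _ lf))|].
move=> e e0; have [b b0 fb] := level_bounded lf.
have [C C0 HC] := chain_op_taylor gamma theta n.
(* Since the Taylor error divided by [t] is at most [C t b], times below e / (C b + 1) suffice. *)
have K0 : 0 < C * b + 1 by rewrite ltr_wpDl// mulr_ge0.
near=> t => x.
have t0 : 0 < t by near: t; exact: nbhs_right_gt.
have te : t < e / (C * b + 1) by near: t; apply: nbhs_right_lt; rewrite divr_gt0.
rewrite (chain_semigroup HPx _ lf) nabsE (gtr0_norm t0).
rewrite (_ : _ / t - _ = (U n t f x - f x - t * G n f x) / t); last first.
  by field; exact: lt0r_neq0.
rewrite normrM [X in _ * X]gtr0_norm ?invr_gt0// ltr_pdivrMr//.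
apply: le_lt_trans (HC f b t x (ltW t0) fb) _.
rewrite ltr_pdivlMr// in te.
apply: (@le_lt_trans _ _ (t * (t * (C * b + 1)))); last by rewrite mulrC ltr_pM2r.
by rewrite expr2; nra.
Unshelve. all: by end_near. Qed.

End chain_generator.

(** * Image of a path under a nonexpansive map and a change of time scale *)

Section scaled_paths.
Context {R : realType}.
Implicit Types (x y : cantor_space) (w : cpath R).

Definition nonexpansive (phi : cantor_space -> cantor_space) :=
  forall n x y, agree n x y -> agree n (phi x) (phi y).

Lemma nonexpansive_continuous phi : nonexpansive phi -> continuous phi.
Proof.
move=> ne x A /nbhs_agree[n nA]; apply/nbhs_agree; exists n => y xy /=.
by apply: nA; exact: ne.
Qed.

Lemma nonexpansive_measurable phi : nonexpansive phi -> measurable_fun setT phi.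
Proof.
move=> ne; apply: measurable_fun_cantor => k; apply: (@level_measurable k.+1) => x y xy /=.
by rewrite (ne k.+1 x y xy).
Qed.

Definition prod_nonneg (a t : {nonneg R}) : {nonneg R} := (a%:num * t%:num)%:nng.

Definition one_nonneg : {nonneg R} := 1%:nng.

Lemma prod_1nonneg t : prod_nonneg one_nonneg t = t.
Proof. by apply/val_inj; rewrite /= mul1r. Qed.

Definition scale_path (phi : cantor_space -> cantor_space) (a : {nonneg R}) w (t : {nonneg R}) :
  cantor_space := phi (w (prod_nonneg a t)).

Lemma cvg_scale (a t : R) : 0 < a ->
  (a * s @[s --> t^'+] --> (a * t)^'+) /\ (a * s @[s --> t^'-] --> (a * t)^'-).
Proof.
move=> a0; split=> A; rewrite /at_right /at_left /within /= => /nbhs_ballP[e /= e0 He];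
  (have ea : 0 < e / a by rewrite divr_gt0);
  apply/nbhs_ballP; exists (e / a) => // s /= ts lts; (apply: He; last by rewrite /= ltr_pM2l);
  move: ts; rewrite /ball /= => ts; rewrite -mulrBr normrM gtr0_norm// mulrC;
  by rewrite -ltr_pdivlMr.
Qed.

Lemma prod_nonneg_nabs a s : prod_nonneg a (nabs s) = nabs (a%:num * s).
Proof. by apply/val_inj; rewrite /= normrM (ger0_norm (nonneg_ge0 a)). Qed.

Lemma cadlag_scale_path phi a w : nonexpansive phi -> cadlag (scale_path phi a w).
Proof.
(* A zero scale, which occurs for [theta] equal to 0, freezes the path at its starting point;
   one-sided limits are not transported by such a scaling and the path is constant instead. *)
move=> /nonexpansive_continuous cphi t; have [a0|a0] := eqVneq a%:num 0.
  have E u : scale_path phi a w u = phi (w 0%:nng).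
    by rewrite /scale_path; congr (phi (w _)); apply/val_inj; rewrite /= a0 mul0r.
  rewrite (_ : scale_path phi a w = fun=> phi (w 0%:nng)); last by apply/funext.
  exact: cadlag_cst.
have apos : 0 < a%:num by rewrite lt_def a0 nonneg_ge0.
have [wr wl] := path_cadlag w (prod_nonneg a t); split.
  change (phi (w (prod_nonneg a (nabs s))) @[s --> (t%:num : R)^'+] --> phi (w (prod_nonneg a t))).
  under eq_fun do rewrite prod_nonneg_nabs.
  apply: (@cvg_comp _ _ _ (fun s => w (nabs (a%:num * s))) phi _ (nbhs (w (prod_nonneg a t)))).
    exact: (cvg_comp _ _ (cvg_scale t%:num apos).1 wr).
  exact: cphi.
move=> t0; have at0 : 0 < (prod_nonneg a t)%:num by rewrite /= mulr_gt0.
have /cvg_ex[l wl'] := wl at0; apply/cvg_ex; exists (phi l).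
change (phi (w (prod_nonneg a (nabs s))) @[s --> (t%:num : R)^'-] --> phi l).
under eq_fun do rewrite prod_nonneg_nabs.
apply: (@cvg_comp _ _ _ (fun s => w (nabs (a%:num * s))) phi _ (nbhs l)).
  exact: (cvg_comp _ _ (cvg_scale t%:num apos).2 wl').
exact: cphi.
Qed.

Section scaled_path.
Variables (phi : cantor_space -> cantor_space) (ne : nonexpansive phi) (a : {nonneg R}).

Definition scaled_path w : cpath R := Path (@cadlag_scale_path phi a w ne).

Lemma measurable_scaled_path : measurable_fun setT scaled_path.
Proof.
apply: measurable_fun_cpath => t k.
have mk : measurable [set x : cantor_space | x k = true].
  by apply: (@level_measurable k.+1) => x y xy /=; rewrite xy.
have := nonexpansive_measurable ne measurableT mk; rewrite setTI => mphi.
exact: (measurable_at (prod_nonneg a t) mphi).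
Qed.

Lemma past_scaled_path c s : before c s ->
  past (prod_nonneg a s) [set w | bits c (path_bit (scaled_path w))].
Proof.
elim: c => [|[[t k] b] c IH] cs.
  rewrite bits_nil.
  exact: pastT.
rewrite (_ : [set w | _] =
    [set w : cpath R | (phi @^-1` [set x | x k == b]) (w (prod_nonneg a t))] `&`
    [set w | bits c (path_bit (scaled_path w))]); last first.
  apply/seteqP; split=> w; rewrite /bits /=; first by move=> /andP.
  by move=> [h1 h2]; apply/andP.
apply: past_setI.
  apply: sub_sigma_algebra; exists (prod_nonneg a t), (phi @^-1` [set x | x k == b]); split => //.
    by rewrite /= ler_wpM2l//; apply: (cs (t, k, b)); rewrite inE eqxx.
  have mk : measurable [set x : cantor_space | x k == b].
    by apply: (@level_measurable k.+1) => x y xy /=; rewrite xy.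
  by have := nonexpansive_measurable ne measurableT mk; rewrite setTI.
by apply: IH => p pc; apply: cs; rewrite inE pc orbT.
Qed.

End scaled_path.
End scaled_paths.

(** * Isometries preserve the chain *)

Section isometries.
Context {R : realType}.
Implicit Types (x y : cantor_space) (g : cantor_space -> cantor_space).

Lemma agree_cdist n x y : agree n x y <-> cdist x y < 3%:R ^- n :> R.
Proof. by split=> [|/cdist_ltE//]; move=> h; apply/cdist_ltE. Qed.

Definition agree_isometry g := forall n x y, agree n (g x) (g y) <-> agree n x y.

Lemma isometry_agree g : (forall x y, cdist (g x) (g y) = cdist x y :> R) -> agree_isometry g.
Proof. by move=> ig n x y; rewrite !agree_cdist ig. Qed.

(** With two letters, to differ at coordinate [n] is to have the opposite value there. Later
    coordinates may disagree, but a function of level [n.+1] does not see them. *)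
Lemma isometry_flip g n x : agree_isometry g ->
  agree n.+1 (g (flip n x)) (flip n (g x)).
Proof.
move=> ig i; rewrite ltnS leq_eqVlt => /orP[/eqP ->|ni].
  rewrite /flip setc_eq; apply/eqP; rewrite -[_ == _]negbK; apply/negP => h.
  suff : agree n.+1 (g (flip n x)) (g x).
    move=> /ig /(_ n (ltnSn n)).
    by rewrite /flip setc_eq; case: (x n).
  move=> j; rewrite ltnS leq_eqVlt => /orP[/eqP ->|nj].
    by rewrite /flip; move: h; case: (g _ n); case: (g x n).
  have : agree n (g (flip n x)) (g x) by apply/ig; exact: agree_flip.
  exact.
rewrite /flip /setc ltn_eqF//.
have : agree n (g (flip n x)) (g x) by apply/ig; exact: agree_flip.
exact.
Qed.

Lemma isometry_nonexpansive g : agree_isometry g ->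
  nonexpansive g.
Proof. by move=> ig n x y /ig. Qed.

Lemma level_isometry (T : Type) g n (f : cantor_space -> T) :
  agree_isometry g -> level n f -> level n (f \o g).
Proof. by move=> ig lf x y xy; apply: lf; exact: isometry_nonexpansive. Qed.

Lemma chain_op_isometry (gamma theta : {nonneg R}) g n t (f : cantor_space -> R) :
  agree_isometry g -> level n f ->
  chain_op gamma theta n t (f \o g) = chain_op gamma theta n t f \o g.
Proof.
move=> ig; elim: n f => [//|n IH] f lf; apply/funext => x /=.
have fE y : f (g (flip n y)) = f (flip n (g y)) by apply: lf; exact: isometry_flip.
have mE : mean n (f \o g) = mean n f \o g by apply/funext => y; rewrite /mean /= fE.
have hE : hdiff n (f \o g) x = hdiff n f (g x) by rewrite /hdiff /= fE.
by rewrite mE hE IH//; exact: level_mean.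
Qed.

End isometries.

Section chain_isometry.
Context {R : realType} (gamma theta : {nonneg R}).
Local Notation U := (chain_op gamma theta).
Variable Px : cantor_space -> probability (cpath R) R.
Hypothesis HPx : forall x, chain_law gamma theta x (Px x).
Implicit Types (s t : {nonneg R}) (x : cantor_space) (f : cantor_space -> R).

Lemma chain_past_int x n f s t F : past s F -> level n f ->
  \int[Px x]_(w in F) f (w (sum_nonneg s t)) = \int[Px x]_(w in F) U n t%:num f (w s).
Proof.
move=> pF lf; have cf : cylf f by exists n.
by rewrite (markov_int x t (chain_markov_family HPx) pF cf) (chain_semigroup HPx _ lf).
Qed.

Lemma path_pushforward x (phi : cantor_space -> cantor_space) (ne : nonexpansive phi) a
    (Q : probability (cpath R) R) :
  (forall A, Q A = Px x (scaled_path ne a @^-1` A)) ->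
  forall D f t, measurable D -> cylf f ->
  \int[Q]_(w in D) f (w t) =
  \int[Px x]_(w in scaled_path ne a @^-1` D) f (phi (w (prod_nonneg a t))).
Proof.
move=> QE D f t mD cf.
rewrite (Rintegral_pushforward (m := Px x) (measurable_scaled_path ne a) QE mD) //.
  exact: cylf_path_measurable.
exact: cylf_path_bounded.
Qed.

(** Stated for maps that preserve agreement, so that it also covers a similarity of a cylinder
    composed with the embedding of the Cantor set into that cylinder. *)
Lemma isometry_law g (ig : agree_isometry g) x A : measurable A ->
  Px (g x) A = Px x (scaled_path (isometry_nonexpansive ig) one_nonneg @^-1` A).
Proof.
set psi := scaled_path _ _ => mA.
have [Q QE] := pushforward_probability (Px x)
  (measurable_scaled_path (isometry_nonexpansive ig) one_nonneg).
rewrite -QE; apply: (@chain_law_unique R gamma theta (g x)) => //.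
have cg f : cylf f -> cylf (f \o g) by move=> [n lf]; exists n; exact: level_isometry.
split=> [f cf|n f s t c lf cs].
  by rewrite (path_pushforward QE)// preimage_setT prod_1nonneg; exact: ((HPx x).1 _ (cg _ cf)).
have cf : cylf f by exists n.
have cU : cylf (U n t%:num f) by exists n; exact: level_chain_op.
have mc := @measurable_path_bits R c.
rewrite (path_pushforward QE)// (path_pushforward QE)// !prod_1nonneg.
have pF := @past_scaled_path R g (isometry_nonexpansive ig) one_nonneg c s cs.
rewrite prod_1nonneg in pF.
rewrite (@chain_past_int x n (f \o g) s t _ pF); last exact: level_isometry.
by rewrite chain_op_isometry.
Qed.

Lemma chain_isometry_invariant : isometry_invariant (chain_kernel HPx).
Proof.
move=> g [[h gh hg] ig] t x B mB.
have ag : agree_isometry g := isometry_agree ig.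
have ah : nonexpansive h.
  by move=> n y z yz; apply/ag; rewrite !hg.
have imE : g @` B = h @^-1` B.
  apply/seteqP; split=> y; first by move=> [z Bz <-]; rewrite /preimage /= gh.
  by move=> Bhy; exists (h y).
have mgB : measurable (g @` B).
  by rewrite imE; have := nonexpansive_measurable ah measurableT mB; rewrite setTI.
rewrite !chain_kernelE (isometry_law ag); last exact: measurable_at.
congr (Px x _); apply/funext => w; rewrite imE /preimage /= gh.
by rewrite prod_1nonneg.
Qed.

End chain_isometry.

(** * One step of the chain killed outside a cylinder *)

Section confined_operator.
Context {R : realType} (gamma theta : {nonneg R}) (n : nat) (x0 : cantor_space).
Local Notation U := (chain_op gamma theta).
Local Notation G := (chain_gen gamma theta).
Local Notation M := (total_rate gamma theta n).
Implicit Types (x y z : cantor_space) (f : cantor_space -> R) (j : nat).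

Definition same_word k x y : bool := coords k y == coords k x.

Lemma same_wordP k x y : same_word k x y <-> agree k x y.
Proof.
rewrite /same_word; split; first by move=> /eqP/level_coords/agree_sym.
by move=> xy; apply/eqP/level_coords/agree_sym.
Qed.

Lemma level_same_word k x : level k (same_word k x).
Proof. by move=> y z yz; rewrite /same_word; congr (_ == _); exact/level_coords. Qed.

(** The standard similarity from the Cantor set onto the cylinder of the first [n] letters of [x0];
    [shift] is its inverse there. *)
Definition prefix_with z : cantor_space := fun i => if (i < n)%N then x0 i else z (i - n)%N.

Definition shift y : cantor_space := fun i => y (n + i)%N.

Lemma shift_prefix z : shift (prefix_with z) = z.
Proof.
by apply/funext => i; rewrite /shift /prefix_with ltnNge leq_addr /= addKn.
Qed.

Lemma prefix_shift y : agree n x0 y -> prefix_with (shift y) = y.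
Proof.
move=> xy; apply/funext => i; rewrite /shift /prefix_with; case: ltnP => [/xy//|ni].
by rewrite subnKC.
Qed.

Lemma agree_prefix z : agree n x0 (prefix_with z).
Proof. by move=> i ni; rewrite /prefix_with ni. Qed.

Lemma agree_prefixD k y z : agree (n + k) (prefix_with y) (prefix_with z) <-> agree k y z.
Proof.
split=> yz i ik.
  have := yz (n + i)%N; rewrite ltn_add2l ik => /(_ isT).
  by rewrite /prefix_with ltnNge leq_addr /= addKn.
rewrite /prefix_with; case: ltnP => // ni; apply: yz.
by rewrite ltn_subLR.
Qed.

Lemma prefix_nonexpansive : nonexpansive prefix_with.
Proof.
move=> k y z yz; apply: (@agreeW _ (n + k)); first exact: leq_addl.
exact/agree_prefixD.
Qed.

Lemma level_prefix (T : Type) j (f : cantor_space -> T) :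
  level (n + j) f -> level j (f \o prefix_with).
Proof. by move=> lf y z yz; apply: lf; exact/agree_prefixD. Qed.

Lemma level_shift (T : Type) j (f : cantor_space -> T) :
  level j f -> level (n + j) (f \o shift).
Proof. by move=> lf y z yz; apply: lf => i ij; apply: yz; rewrite ltn_add2l. Qed.

Lemma flip_prefix j z : prefix_with (flip j z) = flip (n + j) (prefix_with z).
Proof.
apply/funext => i; rewrite /flip /setc /prefix_with.
rewrite [(n + j < n)%N]ltnNge leq_addr /= addKn.
have [ni|ni] := ltnP i n.
  by rewrite ltn_eqF// (leq_trans ni)// leq_addr.
by rewrite -[i in RHS](subnKC ni) eqn_add2l subnKC.
Qed.

Definition confine f y : R := (same_word n x0 y)%:R * f y.

Lemma mean_prefix j f : mean (n + j) f \o prefix_with = mean j (f \o prefix_with).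
Proof. by apply/funext => z; rewrite /mean /= flip_prefix. Qed.

Lemma confine_flip j f y : confine f (flip (n + j) y) =
  (same_word n x0 y)%:R * f (flip (n + j) y).
Proof.
rewrite /confine; congr (_%:R * _); congr nat_of_bool; apply: level_same_word.
by apply: (@agreeW n (n + j)) => //; [exact: leq_addr|exact: agree_flip].
Qed.

Lemma mean_confine j f : mean (n + j) (confine f) = confine (mean (n + j) f).
Proof.
by apply/funext => y; rewrite /mean confine_flip /confine; field.
Qed.

Lemma confine_prefix f z : confine f (prefix_with z) = f (prefix_with z).
Proof.
have -> : confine f (prefix_with z) = true%:R * f (prefix_with z).
  by congr (_%:R * _); congr nat_of_bool; apply/same_wordP; exact: agree_prefix.
by rewrite mul1r.
Qed.

Lemma hdiff_confine j f z : hdiff (n + j) (confine f) (prefix_with z) =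
  hdiff j (f \o prefix_with) z.
Proof. by rewrite /hdiff -flip_prefix !confine_prefix flip_prefix /= flip_prefix. Qed.

Lemma level_confine j f : level (n + j) f -> level (n + j) (confine f).
Proof.
move=> lf y z yz; rewrite /confine (lf _ _ yz).
by rewrite (@level_same_word n x0 y z)//; apply: agreeW yz; exact: leq_addr.
Qed.

Lemma norm_confine f b : (forall y, `|f y| <= b) -> forall y, `|confine f y| <= b.
Proof.
move=> fb y; rewrite /confine; case: (same_word _ _ _); rewrite ?mul1r// mul0r normr0.
exact: le_trans (normr_ge0 _) (fb y).
Qed.

(** The rates are geometric: those of the coordinates after the word are [theta ^ n] times those of
    the original chain, the origin of the scaling parameter. *)
Lemma total_rate_prefix j :
  total_rate gamma theta (n + j) = M + theta%:num ^+ n * total_rate gamma theta j.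
Proof.
elim: j => [|j IH].
  by rewrite addn0 /total_rate [X in _ * X]big_ord0 mulr0 addr0.
rewrite addnS !total_rateS IH mulrDr addrA; congr (_ + _).
by rewrite /rate -addnS exprD; ring.
Qed.

Lemma decay_prefix j :
  decay gamma theta (n + j) = M + theta%:num ^+ n * decay gamma theta j.
Proof. by rewrite /decay total_rate_prefix /rate -addnS exprD; ring. Qed.

Definition return_prob (t : R) : R := U n t (fun y => (same_word n x0 y)%:R) x0.

Lemma return_prob_prefix t z :
  U n t (fun y => (same_word n x0 y)%:R) (prefix_with z) = return_prob t.
Proof.
rewrite /return_prob; apply: (@level_chain_op _ gamma theta n n) => //.
  by move=> y y' yy'; rewrite (level_same_word x0 yy').
exact/agree_sym/agree_prefix.
Qed.

Lemma return_prob_ge t : 0 <= t -> expR (- (M * t)) <= return_prob t.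
Proof.
move=> t0; have ls : level n (fun y => (same_word n x0 y)%:R : R).
  by move=> y z yz; rewrite (level_same_word x0 yz).
have := chain_op_lower gamma theta x0 t0 ls (fun y => ler0n _ _).
by rewrite (_ : same_word n x0 x0 = true) ?mulr1//; exact/same_wordP.
Qed.

Lemma chain_op_confine j f b t z : 0 <= t -> level (n + j) f -> (forall y, `|f y| <= b) ->
  `|U (n + j) t (confine f) (prefix_with z) -
    expR (- (M * t)) * U j (theta%:num ^+ n * t) (f \o prefix_with) z| <=
  (return_prob t - expR (- (M * t))) * b.
Proof.
move=> t0; elim: j f => [|j IH] f lf fb.
  rewrite addn0 in lf *.
  have -> : confine f = fun y => f (prefix_with z) * (same_word n x0 y)%:R.
    apply/funext => y; rewrite /confine mulrC.
    have [xy|] := boolP (same_word n x0 y); last by rewrite !mulr0.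
    congr (_ * _); apply: lf; apply: agree_trans (agree_prefix z).
    exact/agree_sym/same_wordP.
  rewrite chain_op_scale return_prob_prefix /=.
  rewrite (_ : _ - _ = (return_prob t - expR (- (M * t))) * f (prefix_with z)); last by ring.
  rewrite normrM ger0_norm ?subr_ge0 ?return_prob_ge// ler_wpM2l//.
  by rewrite subr_ge0 return_prob_ge.
rewrite addnS in lf *.
have lm : level (n + j) (mean (n + j) f) by exact: level_mean.
have := IH _ lm (normr_mean _ fb).
rewrite /= mean_confine hdiff_confine mean_prefix decay_prefix.
have -> : expR (- ((M + theta%:num ^+ n * decay gamma theta j) * t)) =
    expR (- (M * t)) * expR (- (decay gamma theta j * (theta%:num ^+ n * t))).
  by rewrite -expRD; congr expR; ring.
set A := chain_op _ _ _ _ _ _; set B := chain_op _ _ _ _ _ _.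
by congr (`|_| <= _); ring.
Qed.

Lemma chain_gen_lin k a f g :
  G k (fun x => a * f x + g x) = fun x => a * G k f x + G k g x.
Proof.
elim: k f g => [|k IH] f g; apply/funext => x /=; first by rewrite mulr0 addr0.
by rewrite mean_lin hdiff_lin IH; ring.
Qed.

Lemma chain_gen_same_word k x : G k (fun y => (same_word k x y)%:R) x = - total_rate gamma theta k.
Proof.
elim: k => [|k IH]; first by rewrite /= /total_rate big_ord0 oppr0.
have swS y : same_word k.+1 x y = same_word k x y && (y k == x k).
  apply/idP/andP.
    by move=> /same_wordP xy; split; [apply/same_wordP; exact: agreeW xy|rewrite xy].
  move=> [/same_wordP xy /eqP yk]; apply/same_wordP => i; rewrite ltnS leq_eqVlt.
  by move=> /orP[/eqP ->|/xy].
have swf y : same_word k x (flip k y) = same_word k x y.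
  by apply: level_same_word; exact: agree_flip.
have sw1 : same_word k x x by exact/same_wordP.
have mE : mean k (fun y => (same_word k.+1 x y)%:R : R) =
    fun y => 2^-1 * (same_word k x y)%:R + 0.
  apply/funext => y; rewrite /mean !swS swf /flip setc_eq.
  by case: (same_word k x y); case: (y k); case: (x k); rewrite /=; field.
have hE : hdiff k (fun y => (same_word k.+1 x y)%:R : R) x = 2^-1.
  rewrite /hdiff !swS swf /flip setc_eq sw1 eqxx /=.
  by case: (x k); rewrite /=; field.
change (G k (mean k (fun y => (same_word k.+1 x y)%:R)) x -
  decay gamma theta k * hdiff k (fun y => (same_word k.+1 x y)%:R) x =
  - total_rate gamma theta k.+1).
rewrite mE hE (chain_gen_lin k 2^-1 (fun y => (same_word k x y)%:R) (fun=> 0)) chain_gen0 IH.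
by rewrite total_rateS /decay; field.
Qed.

(** Leaving the word and coming back takes two jumps. Formally, [return_prob t] is 1 - M t up to
    second order, by [chain_gen_same_word], and the exponential is at least 1 - M t. *)
Lemma return_prob_le : exists2 C : R, 0 <= C &
  forall t : R, 0 <= t -> return_prob t - expR (- (M * t)) <= C * t ^+ 2.
Proof.
have [C C0 HC] := chain_op_taylor gamma theta n; exists C => // t t0.
have sb y : `|(same_word n x0 y)%:R : R| <= 1.
  by case: (same_word _ _ _); rewrite ?normr1 ?normr0.
have := HC _ 1 t x0 t0 sb; rewrite -/(return_prob t) chain_gen_same_word mulr1.
rewrite (_ : same_word n x0 x0 = true); last exact/same_wordP.
have := expR_ge1Dx (- (M * t)) => h1 /ler_normlW; rewrite mulr1n => h2.
have -> : return_prob t - expR (- (M * t)) =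
  (return_prob t - 1 - t * - M) + (1 - M * t - expR (- (M * t))) by ring.
by apply: (le_trans _ h2); rewrite gerDl subr_le0.

Qed.

End confined_operator.

(** * Confinement *)

Section confined_chain.
Context {R : realType} (gamma theta : {nonneg R}) (n : nat) (x0 : cantor_space).
Local Notation U := (chain_op gamma theta).
Local Notation M := (total_rate gamma theta n).
Local Notation pre := (prefix_with n x0).
Implicit Types (h s t : {nonneg R}) (f : cantor_space -> R) (j k : nat) (w : cpath R).

Definition killed_step j (h : R) f : cantor_space -> R := U (n + j) h (confine n x0 f).

Lemma level_iter_killed_step j k (h : R) f :
  level (n + j) f -> level (n + j) (iter k (killed_step j h) f).
Proof. by move=> lf; elim: k => //= k IH; apply: level_chain_op => //; exact: level_confine. Qed.

Lemma norm_iter_killed_step j k (h : R) f b : 0 <= h -> level (n + j) f ->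
  (forall y, `|f y| <= b) -> forall y, `|iter k (killed_step j h) f y| <= b.
Proof.
move=> h0 lf fb; elim: k => //= k IH y; apply: chain_op_norm => //.
  by apply: level_confine; exact: level_iter_killed_step.
exact: norm_confine.
Qed.

(** Each step adds an error of at most [C h^2 b] and earlier errors are contracted, so they merely
    add up. *)
Lemma iter_killed_step_approx : exists2 C : R, 0 <= C & forall j k (h : R) f b z,
  0 <= h -> level (n + j) f -> (forall y, `|f y| <= b) ->
  `|iter k (killed_step j h) f (pre z) -
    expR (- (M * (k%:R * h))) * U j (theta%:num ^+ n * (k%:R * h)) (f \o pre) z| <=
  k%:R * (C * h ^+ 2 * b).
Proof.
have [C C0 HC] := return_prob_le gamma theta n x0; exists C => // j k h f b z h0 lf fb.
have b0 : 0 <= b := le_trans (normr_ge0 _) (fb z).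
elim: k z => [|k IH] z.
  by rewrite /= !mul0r !mulr0 oppr0 expR0 chain_op0 mul1r subrr normr0.
set g := iter k (killed_step j h) f.
have lg : level (n + j) g by exact: level_iter_killed_step.
have gb := norm_iter_killed_step k h0 lf fb.
have gz := chain_op_confine gamma theta x0 z h0 lg gb.
rewrite iterS -/g; change (killed_step j h g (pre z)) with (U (n + j) h (confine n x0 g) (pre z)).
set t := k%:R * h in IH *; set V := U j (theta%:num ^+ n * t) (f \o pre) in IH *.
have lV : level j V by apply: level_chain_op => //; exact: level_prefix.
(* The accumulated error, as a function on the rescaled space; the rescaled semigroup preserves its
   bound. *)
pose r z := g (pre z) - expR (- (M * t)) * V z.
have lr : level j r.
  move=> y y' yy'; rewrite /r (lV _ _ yy').
  by rewrite (lg (pre y) (pre y'))//; exact/agree_prefixD.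
have gE : g \o pre = fun z => expR (- (M * t)) * V z + r z.
  by apply/funext => y; rewrite /r /=; ring.
have kE : k.+1%:R * h = h + t by rewrite -natr1 mulrDl mul1r addrC.
rewrite kE [_ ^+ n * (h + t)]mulrDr (@chain_opD _ gamma theta j); last exact: level_prefix.
rewrite -/V.
have tn0 : 0 <= theta%:num ^+ n * h by rewrite mulr_ge0// exprn_ge0.
have rb := @chain_op_norm _ gamma theta j (theta%:num ^+ n * h) r _ z tn0 lr IH.
rewrite gE chain_op_lin in gz.
have eh : expR (- (M * h)) <= 1 by rewrite -expR0 ler_expR oppr_le0 mulr_ge0// total_rate_ge0.
have e0 := expR_ge0 (- (M * h)).
have -> : expR (- (M * (h + t))) = expR (- (M * h)) * expR (- (M * t)).
  by rewrite -expRD; congr expR; ring.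
set A := chain_op _ _ _ _ _ (pre z) in gz *; set B := chain_op _ _ _ _ V z in gz *.
set D := chain_op _ _ _ _ r z in gz rb.
have -> : A - expR (- (M * h)) * expR (- (M * t)) * B =
    (A - expR (- (M * h)) * (expR (- (M * t)) * B + D)) + expR (- (M * h)) * D by ring.
apply: le_trans (ler_normD _ _) _; rewrite -natr1 mulrDl mul1r addrC; apply: lerD.
  rewrite normrM (ger0_norm e0).
  by apply: le_trans rb; rewrite ler_piMl.
apply: le_trans gz _; apply: ler_wpM2r => //; exact: HC.
Qed.

Variable Px : cantor_space -> probability (cpath R) R.
Hypothesis HPx : forall x, chain_law gamma theta x (Px x).

Definition in_word (t : {nonneg R}) : set (cpath R) := [set w | same_word n x0 (w t)].

Lemma past_in_word s t : s%:num <= t%:num -> past t (in_word s).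
Proof.
move=> st; apply: sub_sigma_algebra; exists s, (same_word n x0); split => //.
by apply: (@level_measurable n) => y z yz; rewrite (level_same_word x0 yz).
Qed.

Definition grid_stay s h k : set (cpath R) :=
  [set w | forall i, (i <= k)%N -> in_word (sum_nonneg s (times i h)) w].

Lemma past_grid_stay s h k : past (sum_nonneg s (times k h)) (grid_stay s h k).
Proof.
rewrite (_ : grid_stay s h k =
  \bigcap_i (if (i <= k)%N then in_word (sum_nonneg s (times i h)) else setT)); last first.
  apply/seteqP; split=> w; first by move=> H i _; case: ifP => // /H.
  by move=> H i ik; have := H i I; rewrite ik.
apply: past_bigcap => i; case: ifP => ik.
  by apply: past_in_word; rewrite /= lerD2l ler_wpM2r// ler_nat.
exact: pastT.
Qed.

(** Being in the word at time s + h is merged into the past event, which shortens the grid by one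
    step; the Markov property at [s] then produces one killed step. *)
Lemma grid_integral x j f h k s F : level (n + j) f -> past s F -> F `<=` in_word s ->
  \int[Px x]_(w in F `&` grid_stay s h k) f (w (sum_nonneg s (times k h))) =
  \int[Px x]_(w in F) iter k (killed_step j h%:num) f (w s).
Proof.
move=> lf; elim: k s F => [|k IH] s F pF Fs.
  have s0 : sum_nonneg s (times 0 h) = s by apply/val_inj; rewrite /= mul0r addr0.
  rewrite s0; congr (Rintegral _ _ _); apply/seteqP; split=> w; first by case.
  move=> Fw; split=> // i; rewrite leqn0 => /eqP ->; rewrite s0; exact: Fs.
have shE i : sum_nonneg s (times i.+1 h) = sum_nonneg (sum_nonneg s h) (times i h).
  by apply/val_inj; rewrite /= -natr1; ring.
rewrite shE.
have -> : F `&` grid_stay s h k.+1 =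
    (F `&` in_word (sum_nonneg s h)) `&` grid_stay (sum_nonneg s h) h k.
  apply/seteqP; split=> w.
    move=> [Fw gw]; split; last by move=> i ik; rewrite -shE; apply: gw.
    split=> //; have := gw 1%N isT; rewrite shE.
    rewrite (_ : sum_nonneg _ (times 0 h) = sum_nonneg s h)//.
    by apply/val_inj; rewrite /= mul0r addr0.
  move=> [[Fw _] gw]; split=> // -[_|i ik]; last by rewrite shE; exact: gw.
  by rewrite (_ : sum_nonneg _ (times 0 h) = s); [exact: Fs|apply/val_inj; rewrite /= mul0r addr0].
rewrite IH; last 2 first.
- apply: past_setI; last exact: past_in_word.
  by apply: past_le pF; rewrite /= lerDl.
- by move=> w [].
rewrite (Rintegral_restrict (Px x) F (fun w : cpath R => same_word n x0 (w (sum_nonneg s h)))).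
rewrite -(chain_past_int HPx x h pF)//.
by apply: level_confine; exact: level_iter_killed_step.
Qed.

End confined_chain.

Section decreasing_events.
Context d (T : measurableType d) (R : realType) (m : probability T R).

Lemma Rintegral_decreasing_cvg D (E : nat -> set T) (f : T -> R) :
  measurable D -> (forall i, measurable (E i)) -> (forall i, E i.+1 `<=` E i) ->
  measurable_fun setT f -> bounded_on setT f ->
  \int[m]_(x in D `&` E i) f x @[i --> \oo] --> \int[m]_(x in D `&` \bigcap_i E i) f x.
Proof.
move=> mD mE dE mf [b fb].
have restrictE A : \int[m]_(x in D `&` A) f x = \int[m]_(x in D) ((x \in A)%:R * f x).
  rewrite -(Rintegral_restrict m D (fun x => x \in A)); congr (Rintegral _ _ _).
  by congr (D `&` _); apply/seteqP; split=> x /=; [move/mem_set|move/set_mem].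
have mA A : measurable A -> measurable_fun D (fun x => (x \in A)%:R * f x).
  move=> mA; apply: measurable_funM; last exact: measurable_funS mf.
  by have := @measurable_indic _ T R D A mA; apply: eq_measurable_fun => x _; rewrite indicE.
under eq_cvg do rewrite restrictE; rewrite restrictE.
apply: (@Rintegral_bounded_cvg _ _ _ m D _ _ b) => //.
- by move=> i; exact: mA.
- by apply: mA; exact: bigcapT_measurable.
- move=> i x _; rewrite normrM; case: (_ \in _); rewrite ?normr1 ?mul1r ?fb// normr0 mul0r.
  exact: le_trans (normr_ge0 _) (fb x I).
move=> x _; have [xE|xE] := pselect ((\bigcap_i E i) x).
  rewrite (mem_set xE); apply: cvg_near_cst; apply: nearW => i.
  by rewrite (mem_set (xE i I)).
rewrite (memNset xE); apply: cvg_near_cst.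
have [i0 nE] : exists i, ~ E i x.
  by apply: contrapT => h; apply: xE => i _; apply: contrapT => ?; apply: h; exists i.
exists i0 => // i /= i0i; rewrite memNset// => Ei; apply: nE.
elim: i i0i Ei => [|i IH]; first by rewrite leqn0 => /eqP ->.
by rewrite leq_eqVlt => /orP[/eqP ->//|]; rewrite ltnS => h /dE /(IH h).
Qed.

End decreasing_events.

(** * From grids to staying at all times *)

Section confined_integral.
Context {R : realType} (gamma theta : {nonneg R}) (n : nat) (x0 : cantor_space).
Local Notation U := (chain_op gamma theta).
Local Notation M := (total_rate gamma theta n).
Local Notation pre := (prefix_with n x0).
Local Notation in_word := (@in_word R n x0).
Implicit Types (h s t : {nonneg R}) (f : cantor_space -> R) (j k : nat) (w : cpath R).

Definition window s t : set (cpath R) :=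
  [set w | forall u : {nonneg R}, s%:num <= u%:num <= s%:num + t%:num -> in_word u w].

Definition dyadic_part t m : {nonneg R} := (t%:num / 2 ^+ m)%:nng.

Local Notation grid s t m := (grid_stay n x0 s (dyadic_part t m) (2 ^ m)).

Lemma times_dyadic_part t m : times (2 ^ m) (dyadic_part t m) = t.
Proof. by apply/val_inj; rewrite /= natrX mulrC divfK// expf_neq0. Qed.

Lemma grid_decreasing s t m : grid s t m.+1 `<=` grid s t m.
Proof.
move=> w gw i im; have := gw (2 * i)%N; rewrite expnS leq_mul2l im orbT => /(_ isT).
rewrite (_ : times (2 * i) _ = times i (dyadic_part t m))//; apply/val_inj.
by rewrite /= natrM exprS; field; rewrite expf_neq0.
Qed.

Lemma right_neighbour w u : exists2 e : R, 0 < e & forall r : {nonneg R},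
  u%:num < r%:num < u%:num + e -> agree n (w u) (w r).
Proof.
have [/(_ [set y | agree n (w u) y]) wr _] := path_cadlag w u.
have : nbhs (w u) [set y | agree n (w u) y] by apply/nbhs_agree; exists n.
move=> /wr /nbhs_ballP[e /= e0 He]; exists e => // r /andP[ur re].
have := He r%:num; rewrite /ball /= => /(_ _ ur).
have -> : (`|r%:num|%:nng : {nonneg R}) = r by apply/val_inj; rewrite /= ger0_norm.
by apply; rewrite ltr_distlC; apply/andP; split; lra.
Qed.

(** By right continuity the first [n] coordinates at any time before the end agree with those at
    fine grid points just after it. *)
Lemma windowE s t : window s t = \bigcap_m grid s t m.
Proof.
apply/seteqP; split=> w.
  move=> W m _ i im; apply: W; rewrite /= lerDl lerD2l; apply/andP; split.
    by rewrite mulr_ge0// divr_ge0// exprn_ge0.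
  rewrite mulrA ler_pdivrMr ?exprn_gt0// mulrC ler_wpM2l//.
  by rewrite -natrX ler_nat.
move=> gw u /andP[su ust].
(* The right end has no later grid point in the window but belongs to every grid, in particular to
   that of index 0. *)
have [ust'|ust'] := eqVneq u%:num (s%:num + t%:num).
  have := gw 0 I 1%N (leqnn _); congr (in_word _ _).
  by apply/val_inj; rewrite /= ust' mul1r expr0 divr1.
have {}ust : u%:num < s%:num + t%:num by rewrite lt_def eq_sym ust'.
have t0 : 0 < t%:num by lra.
have [e e0 He] := right_neighbour w u.
pose e' := Num.min e (s%:num + t%:num - u%:num).
have e'0 : 0 < e' by rewrite lt_min e0 subr_gt0.
have [m Hm] := @exp2N_lt R (e' / t%:num) (divr_gt0 e'0 t0).
have {}Hm : t%:num / 2 ^+ m < e' by have := Hm m (leqnn m); rewrite ltr_pdivlMr// mulrC.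
have d0 : 0 < t%:num / 2 ^+ m by rewrite divr_gt0// exprn_gt0.
pose q := (u%:num - s%:num) / (t%:num / 2 ^+ m).
have q0 : 0 <= q by rewrite divr_ge0 ?subr_ge0// ltW.
(* [i.+1] is the index of the first grid point strictly after [u]; the choice of [e'] keeps it both
   close to [u] and inside the window. *)
have /andP[q1 q2] := truncn_itv q0; set i := Num.truncn q in q1 q2.
have r1 : u%:num < s%:num + i.+1%:R * (t%:num / 2 ^+ m).
  by rewrite -ltrBlDl -ltr_pdivrMr.
have r2 : s%:num + i.+1%:R * (t%:num / 2 ^+ m) < u%:num + e'.
  rewrite -natr1 mulrDl mul1r addrA ler_ltD//.
  by rewrite -lerBrDl -ler_pdivlMr.
have e'1 : e' <= e by rewrite ge_min lexx.
have e'2 : e' <= s%:num + t%:num - u%:num by rewrite ge_min lexx orbT.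
have im : (i.+1 <= 2 ^ m)%N.
  rewrite -(ler_nat R) natrX -(ler_pM2r d0) [leRHS]mulrC divfK ?expf_neq0//.
  by rewrite -(lerD2l s%:num) ltW//; lra.
have /same_wordP xr := gw m I i.+1 im.
apply/same_wordP; apply: (agree_trans xr); apply/agree_sym; apply: He => /=.
by apply/andP; split=> //; apply: lt_le_trans r2 _; rewrite lerD2l.
Qed.

Lemma past_window s t : past (sum_nonneg s t) (window s t).
Proof.
rewrite windowE; apply: past_bigcap => m.
by rewrite -{1}(times_dyadic_part t m); exact: past_grid_stay.
Qed.

(** The semigroup of the rescaled chain, transported to the cylinder. *)
Definition confined_op j (t : R) f y : R :=
  U j (theta%:num ^+ n * t) (f \o pre) (shift n y).

Lemma level_confined_op j (t : R) f : level (n + j) f -> level (n + j) (confined_op j t f).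
Proof. by move=> lf; apply: level_shift; apply: level_chain_op => //; exact: level_prefix. Qed.

Variable Px : cantor_space -> probability (cpath R) R.
Hypothesis HPx : forall x, chain_law gamma theta x (Px x).

Lemma confined_integral x j f s t F : level (n + j) f -> past s F -> F `<=` in_word s ->
  \int[Px x]_(w in F `&` window s t) f (w (sum_nonneg s t)) =
  \int[Px x]_(w in F) (expR (- (M * t%:num)) * confined_op j t%:num f (w s)).
Proof.
move=> lf pF Fs; have mF : measurable F := past_measurable pF.
have cf : cylf f by exists (n + j)%N.
have [b b0 fb] := level_bounded lf.
have [C C0 HC] := iter_killed_step_approx gamma theta n x0.
set L := LHS; set L' := RHS.
have c1 : \int[Px x]_(w in F `&` grid s t m) f (w (sum_nonneg s t)) @[m --> \oo] --> L.
  rewrite /L windowE; apply: Rintegral_decreasing_cvg => //.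
  - by move=> m; apply: past_measurable; exact: past_grid_stay.
  - exact: grid_decreasing.
  - exact: cylf_path_measurable.
  - exact: cylf_path_bounded.
suff c2 : \int[Px x]_(w in F `&` grid s t m) f (w (sum_nonneg s t)) @[m --> \oo] --> L'.
  exact: (cvg_unique _ c1 c2).
(* The error of 2^m steps of mesh t / 2^m, each at most C (t / 2^m)^2 b, is K / 2^m. *)
set K := C * t%:num ^+ 2 * b.
have K0 : 0 <= K by rewrite !mulr_ge0// sqr_ge0.
apply/cvgrPdist_lt => e e0.
have [m0 Hm0] := @exp2N_lt R (e / (K + 1)) (divr_gt0 e0 (ltr_wpDl K0 ltr01)).
exists m0 => // m /= /Hm0 mm0.
rewrite -{2}(times_dyadic_part t m).
rewrite (grid_integral HPx x (dyadic_part t m) _ lf pF Fs).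
have lk := level_iter_killed_step gamma theta x0 (2 ^ m) (dyadic_part t m)%:num lf.
have lc : level (n + j) (fun y => expR (- (M * t%:num)) * confined_op j t%:num f y).
  by move=> y y' yy'; rewrite (level_confined_op _ lf yy').
set k := iter _ _ _ in lk *.
have ck : cylf k by exists (n + j)%N.
have cc : cylf (fun y => expR (- (M * t%:num)) * confined_op j t%:num f y) by exists (n + j)%N.
rewrite /L' -RintegralB//; last 2 first.
- exact: (integrable_cylf (Px x) mF (measurable_eval s) cc).
- exact: (integrable_cylf (Px x) mF (measurable_eval s) ck).
have t2 : t%:num = (2 ^ m)%:R * (dyadic_part t m)%:num.
  by rewrite -[in LHS](times_dyadic_part t m).
apply: (@le_lt_trans _ _ (K / 2 ^+ m * fine (Px x F))).
  apply: le_Rintegral_norm => //.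
    apply: measurable_funB; apply: (measurable_funS measurableT) => //.
      exact: (cylf_path_measurable s cc).
    exact: (cylf_path_measurable s ck).
  move=> w /Fs/same_wordP xw; rewrite distrC.
  have := HC j (2 ^ m)%N (dyadic_part t m)%:num f b (shift n (w s)) (nonneg_ge0 _) lf fb.
  rewrite -/k -t2 prefix_shift// /confined_op => /le_trans; apply.
  rewrite le_eqVlt; apply/orP; left; apply/eqP.
  by rewrite /K /= natrX; field; rewrite expf_neq0.
apply: (@le_lt_trans _ _ (K / 2 ^+ m)).
  rewrite ler_piMr//; first by rewrite divr_ge0// exprn_ge0.
  by rewrite -lee_fin fineK; [exact: probability_le1|exact: prob_fin].
rewrite ltr_pdivlMr ?ltr_wpDl// in mm0.
apply: le_lt_trans mm0; rewrite mulrC ler_wpM2l//; lra.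
Qed.

End confined_integral.

(** * The conditioned law is an embedded rescaled chain *)

Section confined_law.
Context {R : realType} (gamma theta : {nonneg R}) (n : nat) (x : cantor_space).
Local Notation U := (chain_op gamma theta).
Local Notation M := (total_rate gamma theta n).
Local Notation pre := (prefix_with n x).
Variable Px : cantor_space -> probability (cpath R) R.
Hypothesis HPx : forall x, chain_law gamma theta x (Px x).
Implicit Types (s t : {nonneg R}) (f : cantor_space -> R) (j k : nat) (w : cpath R)
  (c : seq ({nonneg R} * nat * bool)).

Definition word_scale : {nonneg R} := (theta%:num ^+ n)%:nng.

Definition embed_path : cpath R -> cpath R :=
  scaled_path (@prefix_nonexpansive n x) word_scale.

Definition stays s : set (cpath R) := window n x 0%:nng s.

Lemma word_window s : stays s `<=` [set w | same_word n x (w s)].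
Proof. by move=> w; apply; rewrite /= add0r nonneg_ge0 lexx. Qed.

Lemma windowD s t : stays (sum_nonneg s t) = stays s `&` window n x s t.
Proof.
apply/seteqP; split=> w.
  move=> W; split=> u /= /andP[h1 h2]; apply: W => /=.
    by rewrite h1 add0r (le_trans h2)// add0r lerDl.
  by rewrite nonneg_ge0 add0r.
move=> [W1 W2] u /= /andP[h1 h2]; have [us|su] := leP u%:num s%:num.
  by apply: W1; rewrite /= h1 add0r.
by apply: W2; rewrite /= ltW//; move: h2; rewrite /= add0r.
Qed.

Lemma past_bits c s : before c s -> past s [set w | bits c (path_bit w)].
Proof.
move=> cs; rewrite /past path_eventsE; apply: sub_sigma_algebra; exists c => //.
Qed.

Lemma window_start :
  stays 0%:nng = [set w : cpath R | same_word n x (w 0%:nng)].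
Proof.
apply/seteqP; split=> w; first exact: word_window.
move=> xw u /= /andP[h1 h2]; rewrite (_ : u = 0%:nng)//.
by apply/val_inj/eqP; rewrite /= eq_le h1 (le_trans h2)// addr0.
Qed.

Lemma past_window0 s : past s (stays s).
Proof.
rewrite /stays [in X in past X _](_ : s = sum_nonneg 0%:nng s); first exact: past_window.
by apply/val_inj; rewrite /= add0r.
Qed.

Variable Q : probability (cpath R) R.
Hypothesis QE : forall A, Q A = Px (shift n x) (embed_path @^-1` A).

(** The factor exp (M s) compensates the killing. Both sides then start alike and pass from time u
    to u + t by the same operator [confined_op], so [functional_unique] applies. *)
Lemma confined_law c s g : before c s -> cylf g ->
  expR (M * s%:num) *
    \int[Px x]_(w in [set w | bits c (path_bit w)] `&` stays s) g (w s) =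
  \int[Q]_(w in [set w | bits c (path_bit w)]) g (w s).
Proof.
pose J s c g := expR (M * s%:num) *
    \int[Px x]_(w in [set w | bits c (path_bit w)] `&` stays s) g (w s).
pose J' s c g := \int[Q]_(w in [set w | bits c (path_bit w)]) g (w s).
have QI t d (f : cantor_space -> R) : cylf f -> J' t d f =
    \int[Px (shift n x)]_(w in [set w | bits d (path_bit (embed_path w))])
      f (pre (w (prod_nonneg word_scale t))).
  by move=> cf; rewrite /J' (path_pushforward QE)//; exact: measurable_path_bits.
change (before c s -> cylf g -> J s c g = J' s c g); move: s c g.
apply: functional_unique.
- move=> f cf; rewrite QI// bits_nil.
  have -> : prod_nonneg word_scale 0%:nng = 0%:nng by apply/val_inj; rewrite /= mulr0.
  have cp : cylf (f \o pre).
    by have [k lf] := cf; exists k; apply: level_prefix; apply: levelW lf; exact: leq_addl.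
  rewrite ((HPx (shift n x)).1 _ cp) /= prefix_shift//.
  rewrite /J mulr0 expR0 mul1r window_start.
  rewrite (Rintegral_restrict (Px x) _ (fun w : cpath R => same_word n x (w 0%:nng))).
  rewrite bits_nil.
  have cc : cylf (confine n x f).
    have [k lf] := cf; exists (n + k)%N; apply: level_confine; apply: levelW lf; exact: leq_addl.
  rewrite ((HPx x).1 _ cc) /confine (_ : same_word n x x = true) ?mul1r//.
  exact/same_wordP.
- move=> u t f [m lf]; have lf' : level (n + m) f by apply: levelW lf; exact: leq_addl.
  have lc := level_confined_op gamma theta x t%:num lf'.
  exists (confined_op gamma theta n x m t%:num f); first by exists (n + m)%N.
  move=> d du; split.
    have pF : past u ([set w | bits d (path_bit w)] `&` stays u).
      by apply: past_setI; [exact: past_bits|exact: past_window0].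
    rewrite /J windowD setIA (confined_integral HPx x t lf' pF); last first.
      by move=> w [_ /word_window].
    have cc : cylf (confined_op gamma theta n x m t%:num f) by exists (n + m)%N.
    rewrite RintegralZl; last 2 first.
    - exact: past_measurable pF.
    - exact: (integrable_cylf (Px x) (past_measurable pF) (measurable_eval u) cc).
    by rewrite mulrA -expRD; congr (expR _ * _); rewrite /=; ring.
  rewrite QI; last by exists m.
  rewrite QI; last by exists (n + m)%N.
  have -> : prod_nonneg word_scale (sum_nonneg u t) =
      sum_nonneg (prod_nonneg word_scale u) (prod_nonneg word_scale t).
    by apply/val_inj; rewrite /= mulrDr.
  have pF := @past_scaled_path R pre (@prefix_nonexpansive n x) word_scale d u du.
  rewrite (chain_past_int HPx _ _ pF (level_prefix x lf')).
  by apply: eq_Rintegral => w _; rewrite /confined_op shift_prefix.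
- by move=> u d k b f; rewrite /J Rintegral_bits_cons.
- by move=> u d k b f; have := Rintegral_bits_cons Q setT u d k b f; rewrite !setIT.
- by move=> u d e f de; rewrite /J; under eq_set do rewrite (bits_perm _ de).
- by move=> u d e f de; rewrite /J'; under eq_set do rewrite (bits_perm _ de).
Qed.

Lemma window_measurable s : measurable (stays s).
Proof. by apply: past_measurable; exact: past_window0. Qed.

Lemma confined_law_prob s A : past s A ->
  Q A = ((expR (M * s%:num))%:E * Px x (A `&` stays s))%E.
Proof.
have e0 : 0 <= expR (M * s%:num) := expR_ge0 _.
have mW := window_measurable s.
pose m2 := mscale (NngNum e0) (mrestr (Px x) mW).
apply: (@past_measure_unique R _ Q m2).
  by rewrite (le_lt_trans (probability_le1 Q measurableT))// ltry.
move=> c cs; have mc := measurable_path_bits c.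
have c1 : cylf (fun _ : cantor_space => 1 : R) by exists 0%N.
have := confined_law (c := c) (s := s) cs c1.
rewrite !Rintegral_cst//; last exact: measurableI.
rewrite !mul1r => E.
rewrite /m2 /mscale /mrestr /= -(fineK (prob_fin Q mc)) -E EFinM fineK//.
by apply: prob_fin; exact: measurableI.
Qed.

(** [Q] has total mass 1, so [confined_law_prob] on the full event reads off the survival
    probability. *)
Lemma confined_window_prob s : Px x (stays s) = (expR (- (M * s%:num)))%:E.
Proof.
have mW := window_measurable s.
have := confined_law_prob (@pastT R s); rewrite probability_setT setTI.
rewrite -(fineK (prob_fin (Px x) mW)) -EFinM => -[E]; congr EFin.
have e0 := lt0r_neq0 (expR_gt0 (M * s%:num)).
by apply: (mulfI e0); rewrite -E expRN mulfV.
Qed.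

End confined_law.

(** * Self-similarity of the chain *)

Section chain_self_similar.
Context {R : realType} (gamma theta : {nonneg R}).
Local Notation M := (total_rate gamma theta).
Variable Px : cantor_space -> probability (cpath R) R.
Hypothesis HPx : forall x, chain_law gamma theta x (Px x).

Lemma stayE n (v : n.-tuple bool) x T : cyl v x -> stay v T = stays n x T :> set (cpath R).
Proof.
rewrite /cyl /= => xv; apply/seteqP; split=> w.
  move=> W u /= /andP[_ uT]; rewrite /in_word /= /same_word (W u) ?xv//.
  by rewrite -[T%:num]add0r.
move=> W u uT; have := W u; rewrite /= nonneg_ge0 add0r uT => /(_ isT) /eqP E.
by rewrite /cyl /= E.
Qed.

Lemma embedded_confinement n (v : n.-tuple bool) x (Q : probability (cpath R) R) :
  cyl v x -> (forall A, Q A = Px (shift n x) (embed_path theta n x @^-1` A)) ->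
  confinement Px v x Q.
Proof.
move=> xv QE; split.
  rewrite [LHS]QE (_ : _ @^-1` _ = setT) ?probability_setT//.
  apply/seteqP; split=> // w _ t /=; apply/(cyl_agree _ xv); exact: agree_prefix.
move=> T _; rewrite (stayE T xv).
have pW := confined_window_prob HPx QE T.
rewrite pW; split; first by rewrite lte_fin expR_gt0.
move=> A pA; rewrite (confined_law_prob HPx QE pA) inver gt_eqF ?expR_gt0//.
by rewrite expRN invrK muleC.
Qed.

(** Prefixing [n] letters contracts distances by 3^n and the similarity expands them by the same
    factor. *)
Lemma similarity_isometry n (v : n.-tuple bool) x h : cyl v x -> similarity R n v h ->
  agree_isometry (h \o prefix_with n x).
Proof.
move=> xv [_ sh] k y z /=.
have cp y' : cyl v (prefix_with n x y') by apply/(cyl_agree _ xv); exact: agree_prefix.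
rewrite (@agree_cdist R) sh// -(agree_prefixD n x) (@agree_cdist R).
by rewrite exprD invfM mulrC -ltr_pdivlMr ?exprn_gt0// [in X in _ <-> _ < X]mulrC.
Qed.

Lemma chain_self_similar : self_similar_with Px (fun n => (theta%:num ^+ n)%:nng).
Proof.
move=> n v x n0 xv.
have me := measurable_scaled_path (@prefix_nonexpansive n x) (word_scale theta n).
have [Q QE] := pushforward_probability (Px (shift n x)) me.
exists Q; first exact: embedded_confinement.
move=> h hs l t B l0 HB; have ig := similarity_isometry xv hs.
have [[_ hinj hsurj] _] := hs.
have cp y : cyl v (prefix_with n x y) by apply/(cyl_agree _ xv); exact: agree_prefix.
have gsurj y : exists z, (h \o prefix_with n x) z = y.
  have [z zv <-] := hsurj y I; exists (shift n z).
  by rewrite /= prefix_shift//; exact/(cyl_agree _ xv).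
(* A right inverse of the isometry; it exhibits the image of [B i] under [h] as a preimage under a
   nonexpansive map, hence as a Borel set. *)
have [k gk] := choice gsurj.
have kE y : h (prefix_with n x (k y)) = y := gk y.
have ne : nonexpansive k by move=> m y z yz; apply/ig; rewrite /= !kE.
have imE i z : (h @` B i) (h (prefix_with n x z)) <-> B i (prefix_with n x z).
  split=> [[b Bb hb]|Bz]; last by exists (prefix_with n x z).
  rewrite -(hinj b (prefix_with n x z)) ?inE//; exact: (HB i).2.
have mB i : measurable (h @` B i).
  rewrite (_ : h @` B i = (prefix_with n x \o k) @^-1` B i).
    have := nonexpansive_measurable (phi := prefix_with n x \o k) _ measurableT (HB i).1.
    by rewrite setTI; apply => m y z yz; exact/prefix_nonexpansive/ne.
  by apply/seteqP; split=> y By; [apply/imE; rewrite kE|rewrite -(kE y); apply/imE].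
have -> : h x = (h \o prefix_with n x) (shift n x) by rewrite /= prefix_shift.
rewrite (isometry_law HPx ig); last first.
  rewrite (_ : [set w | _] = \bigcap_(i in [set: 'I_l])
      [set w : cpath R | (h @` B i) (w (prod_nonneg (word_scale theta n) (t i)))]).
    by apply: fin_bigcap_measurable => // i _; exact: measurable_at.
  by apply/seteqP; split=> [w H i _|w H i]; exact: H.
pose u i := prod_nonneg (word_scale theta n) (t i).
rewrite QE; congr (Px _ _); apply/seteqP; split=> w H i.
  change ((h @` B i) (h (prefix_with n x (w (prod_nonneg one_nonneg (u i)))))).
  by rewrite prod_1nonneg; apply/imE; exact: (H i).
change (B i (prefix_with n x (w (u i)))); apply/imE; rewrite -[u i]prod_1nonneg.
exact: (H i).
Qed.

End chain_self_similar.

Theorem theorem3 (R : realType) (gamma theta : {nonneg R}) :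
  exists Px : cantor_space -> probability (cpath R) R,
    [/\ generated_by gamma%:num theta%:num Px,
        (forall Px' : cantor_space -> probability (cpath R) R,
          generated_by gamma%:num theta%:num Px' ->
          forall x (E : set (cpath R)), measurable E -> Px' x E = Px x E),
        SSS Px &
        self_similar_with Px (fun n => (theta%:num ^+ n)%:nng)].
Proof.
have [Px HPx] := choice (chain_law_exists gamma theta).
have tr := chain_markov_transition HPx; have mf := chain_markov_family HPx.
have sc := chain_stochastically_continuous HPx.
have fl : feller (chain_kernel HPx) by exact: chain_feller.
have ss := chain_self_similar HPx.
exists Px; split=> //.
- by exists (chain_kernel HPx); split=> // n h _; exact: chain_generator.
- move=> Px' [P [trP mfP scP flP genP]] x E mE.
  apply: (chain_law_unique _ (HPx x) mE).
  exact: (generated_chain_law trP genP x mfP).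
exists (chain_kernel HPx); split=> //; split; first exact: chain_isometry_invariant.
by exists (fun n => (theta%:num ^+ n)%:nng).
Qed.
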